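(* If every geodesic on $\Sigma_\Gamma$ intersects the open ball $B(\pi(x),\rho)$ and $\rho<\operatorname{inj}(\Gamma,x)$, then $S^+(\ell,\rho,x)$ is a Delone set. Moreover, if $S^+(\ell,\rho,x)$ is Delone, then it is chaotic.
   Context: $\mathbb{D}=\{z\in\mathbb{C}:|z|<1\}$ with hyperbolic metric $d$ induced by $ds=2|dz|/(1-|z|^2)$; geodesics are parametrised with unit speed and the normal bundle of an oriented geodesic is oriented by the standard orientation of $\mathbb{D}$ and that of the geodesic. Standing setting: $\Gamma$ is a cocompact Fuchsian group (discrete subgroup of orientation-preserving isometries of $\mathbb{D}$ with compact quotient) with fundamental domain $\tau$ a hyperbolic polygon whose side-pairing generators are none of them their own inverse; $\Sigma_\Gamma=\Gamma\backslash\mathbb{D}$ with quotient map $\pi$ and induced metric; $\ell$ is a geodesic in $\mathbb{D}$ with unit-speed parametrisation $\kappa_\ell$ such that the image of $\{(\kappa_\ell(t),\kappa_\ell'(t))\}$ in $\operatorname{ST}(\Sigma_\Gamma)$ is a dense orbit of the geodesic flow; $x\in\tau^\circ$ and $\rho>0$. $\operatorname{inj}(\Gamma,x)=\frac12\inf\{d(y,z):y,z\in\Gamma(x),y\ne z\}$. For a geodesic $k$ with unit-speed parametrisation $\kappa$: $\overline{\mathcal{N}(k,\rho)}^+$ is the union of $\{y:d(y,k)<\rho\}$ with the component of its boundary on the positive side of $k$; $p_k$ is orthogonal projection onto $k$; $S^+(k,\rho,x)=\kappa^{-1}(p_k(\Gamma(x)\cap\overline{\mathcal{N}(k,\rho)}^+))\subseteq\mathbb{R}$.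 A set $S\subseteq\mathbb{R}$ is $(\varepsilon,\delta)$-Delone if every point of $\mathbb{R}$ is within $\varepsilon$ of $S$ and distinct points of $S$ are at distance $\ge\delta$; Delone means $(\varepsilon,\delta)$-Delone for some $\varepsilon,\delta>0$. For $r>0$, $(S,S')\in N_r$ means $S\cap(-r,r)\subseteq S'+(-1/r,1/r)$ and $S'\cap(-r,r)\subseteq S+(-1/r,1/r)$. The set $\operatorname{Del}_{\varepsilon,\delta}$ of $(\varepsilon,\delta)$-Delone subsets of $\mathbb{R}$ carries the local rubber topology, in which $\{S':(S,S')\in N_r\}$, $r>0$, form a neighbourhood base at $S$, and $\mathbb{R}$ acts by translation $S\mapsto S-v$. $S$ is periodic if its orbit $[S]=S+\mathbb{R}$ is compact; aperiodic if $S-v\ne S$ for all $v\ne0$; almost chaotic if the union of periodic orbits is dense in the closure $\overline{[S]}$; chaotic if almost chaotic and aperiodic. *)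

(* Defs.v *)
From Stdlib Require Import Reals List.
From Coquelicot Require Import Coquelicot.
Open Scope R_scope.

Definition inD (z : C) : Prop := Cmod z < 1.

(* Hyperbolic distance for ds = 2|dz|/(1-|z|^2):
   d(z,w) = 2 artanh q = ln((1+q)/(1-q)),  q = |z-w| / |1 - z conj(w)|. *)
Definition hdist (z w : C) : R :=
  let q := Cmod (Cminus z w) / Cmod (Cminus (RtoC 1) (Cmult z (Cconj w))) in
  ln ((1 + q) / (1 - q)).

Definition geodesic (k : R -> C) : Prop :=
  (forall t, inD (k t)) /\ (forall s t, hdist (k s) (k t) = Rabs (s - t)).

Definition vel (k : R -> C) (t : R) : C :=
  (Derive (fun s => fst (k s)) t, Derive (fun s => snd (k s)) t).

Definition foot (k : R -> C) (y : C) (t0 : R) : Prop :=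
  forall s, hdist y (k t0) <= hdist y (k s).

Definition dist_geod (k : R -> C) (y : C) (r : R) : Prop :=
  exists t0, foot k y t0 /\ hdist y (k t0) = r.

(* y lies on the positive side of the oriented geodesic k: the positive unit
   normal at a point of k is i * kappa'(t) (so that (tangent, normal) is
   positively oriented); y is on the positive side iff the vector from its
   foot to y has positive component along i * kappa'(t0). *)
Definition pos_side (k : R -> C) (y : C) : Prop :=
  exists t0, foot k y t0 /\ 0 < Im (Cmult (Cminus y (k t0)) (Cconj (vel k t0))).

Definition closed_halfplane (k : R -> C) (y : C) : Prop :=
  inD y /\ exists t0, foot k y t0 /\ 0 <= Im (Cmult (Cminus y (k t0)) (Cconj (vel k t0))).

Definition Nbar_plus (k : R -> C) (rho : R) (y : C) : Prop :=
  inD y /\ ((exists r, dist_geod k y r /\ r < rho) \/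
            ((exists r, dist_geod k y r /\ r = rho) /\ pos_side k y)).

(* Elements of SU(1,1) written as pairs (a,b), i.e. matrices [[a,b],[conj b,conj a]]
   with |a|^2 - |b|^2 = 1, acting by z |-> (a z + b)/(conj b z + conj a). *)
Definition mob (g : C * C) (z : C) : C :=
  Cdiv (Cplus (Cmult (fst g) z) (snd g))
       (Cplus (Cmult (Cconj (snd g)) z) (Cconj (fst g))).

Definition mob_deriv (g : C * C) (z : C) : C :=
  let den := Cplus (Cmult (Cconj (snd g)) z) (Cconj (fst g)) in
  Cdiv (RtoC 1) (Cmult den den).

Definition su11_mul (g h : C * C) : C * C :=
  (Cplus (Cmult (fst g) (fst h)) (Cmult (snd g) (Cconj (snd h))),
   Cplus (Cmult (fst g) (snd h)) (Cmult (snd g) (Cconj (fst h)))).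

Definition su11_inv (g : C * C) : C * C := (Cconj (fst g), Copp (snd g)).

(* Gamma is given by its (full) preimage in SU(1,1); discreteness in
   PSU(1,1) = discreteness of this preimage in SU(1,1). *)
Definition fuchsian (Gam : C * C -> Prop) : Prop :=
  (forall g, Gam g -> Cmod (fst g) ^ 2 - Cmod (snd g) ^ 2 = 1) /\
  Gam (RtoC 1, RtoC 0) /\
  (forall g h, Gam g -> Gam h -> Gam (su11_mul g h)) /\
  (forall g, Gam g -> Gam (su11_inv g)) /\
  (forall g, Gam g -> Gam (Copp (fst g), Copp (snd g))) /\
  (exists eps, 0 < eps /\ forall g, Gam g ->
      Cmod (Cminus (fst g) (RtoC 1)) < eps -> Cmod (snd g) < eps ->
      g = (RtoC 1, RtoC 0)).

(* Gamma \ D is compact: sequentially compact for the quotient metric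
   d(pi y, pi w) = inf_g d(g y, w). *)
Definition cocompact (Gam : C * C -> Prop) : Prop :=
  forall u : nat -> C, (forall n, inD (u n)) ->
  exists (phi : nat -> nat) (w : C),
    (forall n, (phi n < phi (S n))%nat) /\ inD w /\
    forall eps, 0 < eps -> exists N, forall n, (N <= n)%nat ->
      exists g, Gam g /\ hdist (mob g (u (phi n))) w < eps.

Definition hinterior (A : C -> Prop) (y : C) : Prop :=
  exists e, 0 < e /\ forall z, Cmod (Cminus z y) < e -> A z.

Definition hyp_polygon (tau : C -> Prop) : Prop :=
  exists L : list (R -> C),
    (forall k, In k L -> geodesic k) /\
    (forall y, tau y <-> (inD y /\ forall k, In k L -> closed_halfplane k y)) /\
    (exists r, r < 1 /\ forall y, tau y -> Cmod y <= r).

Definition acts_trivially (g : C * C) : Prop := forall z, mob g z = z.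

Definition fundamental_domain (Gam : C * C -> Prop) (tau : C -> Prop) : Prop :=
  (forall y, inD y -> exists g, Gam g /\ tau (mob g y)) /\
  (forall g y, Gam g -> hinterior tau y -> hinterior tau (mob g y) -> acts_trivially g).

(* g is a side-pairing transformation of tau: g(tau) and tau share a side,
   i.e. a non-degenerate geodesic segment. *)
Definition side_pairing (Gam : C * C -> Prop) (tau : C -> Prop) (g : C * C) : Prop :=
  Gam g /\ ~ acts_trivially g /\
  exists k a b, geodesic k /\ a < b /\
    forall t, a <= t <= b -> tau (k t) /\ exists y, tau y /\ mob g y = k t.

Definition no_selfinverse_sidepairing (Gam : C * C -> Prop) (tau : C -> Prop) : Prop :=
  forall g, side_pairing Gam tau g -> ~ acts_trivially (su11_mul g g).

Definition unit_tangent (p v : C) : Prop :=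
  inD p /\ 2 * Cmod v / (1 - Cmod p ^ 2) = 1.

(* The image of t |-> (k t, k' t) in ST(Sigma) is dense, i.e. its
   Gamma-saturation is dense in ST(D). *)
Definition dense_in_ST (Gam : C * C -> Prop) (k : R -> C) : Prop :=
  forall p v eps, unit_tangent p v -> 0 < eps ->
    exists t g, Gam g /\
      Cmod (Cminus (mob g (k t)) p) < eps /\
      Cmod (Cminus (Cmult (mob_deriv g (k t)) (vel k t)) v) < eps.

Definition inj (Gam : C * C -> Prop) (x : C) : Rbar :=
  Rbar_mult (Finite (/ 2))
    (Glb_Rbar (fun r => exists g h, Gam g /\ Gam h /\
                 mob g x <> mob h x /\ r = hdist (mob g x) (mob h x))).

Definition Splus (Gam : C * C -> Prop) (k : R -> C) (rho : R) (x : C) : R -> Prop :=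
  fun t => exists g, Gam g /\ Nbar_plus k rho (mob g x) /\ foot k (mob g x) t.

Definition delone_ed (eps delta : R) (S : R -> Prop) : Prop :=
  (forall y, exists s, S s /\ Rabs (y - s) <= eps) /\
  (forall s s', S s -> S s' -> s <> s' -> delta <= Rabs (s - s')).

Definition delone (S : R -> Prop) : Prop :=
  exists eps delta, 0 < eps /\ 0 < delta /\ delone_ed eps delta S.

Definition Nr (r : R) (S S' : R -> Prop) : Prop :=
  (forall s, S s -> - r < s < r -> exists s', S' s' /\ Rabs (s - s') < / r) /\
  (forall s', S' s' -> - r < s' < r -> exists s, S s /\ Rabs (s - s') < / r).

Definition translate (S : R -> Prop) (v : R) : R -> Prop := fun t => S (t + v).

Definition orbit (S : R -> Prop) : (R -> Prop) -> Prop :=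
  fun T => exists v, forall t, T t <-> translate S v t.

Definition del_open (eps delta : R) (U : (R -> Prop) -> Prop) : Prop :=
  (forall T, U T -> delone_ed eps delta T) /\
  (forall T, U T -> exists r, 0 < r /\
      forall T', delone_ed eps delta T' -> Nr r T T' -> U T').

Definition del_compact (eps delta : R) (K : (R -> Prop) -> Prop) : Prop :=
  (forall T, K T -> delone_ed eps delta T) /\
  forall (I : Type) (U : I -> (R -> Prop) -> Prop),
    (forall i, del_open eps delta (U i)) ->
    (forall T, K T -> exists i, U i T) ->
    exists l : list I, forall T, K T -> exists i, In i l /\ U i T.

Definition del_closure (eps delta : R) (A : (R -> Prop) -> Prop) (T : R -> Prop) : Prop :=
  delone_ed eps delta T /\
  forall U, del_open eps delta U -> U T -> exists T', A T' /\ U T'.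

Definition periodic (eps delta : R) (T : R -> Prop) : Prop :=
  delone_ed eps delta T /\ del_compact eps delta (orbit T).

Definition aperiodic (S : R -> Prop) : Prop :=
  forall v, v <> 0 -> ~ (forall t, translate S v t <-> S t).

Definition almost_chaotic (eps delta : R) (S : R -> Prop) : Prop :=
  forall T, del_closure eps delta (orbit S) T ->
    del_closure eps delta
      (fun P => del_closure eps delta (orbit S) P /\ periodic eps delta P) T.

Definition chaotic (eps delta : R) (S : R -> Prop) : Prop :=
  almost_chaotic eps delta S /\ aperiodic S.

(* Main.v *)
(* Unit tangent vectors are identified with elements g of SU(1,1) up to sign: the geodesic
   of g is t |-> g A_t . 0, where A_t is the translation by t along the real axis, and the
   pattern S(g) of its counted orbit points satisfies S(c g) = S(g) for c in Gamma and
   S(g A_v) = S(g) - v. For an orbit point with hyperboloid coordinates (X0,X1,X2) in the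
   frame g, the signed distance w from the geodesic and the foot s are given by
   sinh w = X2 and exp(2s) = (X0+X1)/(X0-X1), so that everything is algebraic in g.

   Relative density comes from compactness of the set of frames modulo Gamma, uniform
   discreteness from rho < inj.

   Given g and r, moving the geodesic slightly to its positive side lowers every signed
   distance strictly; hence an open set of frames near g (not containing g) has patterns
   r-close to S(g), the boundary points included. As the frames of l are dense modulo
   Gamma, all S(g) lie in the hull of S(l). Frames of closed geodesics are dense: l returns
   to any neighbourhood after time at least 1, and such a return yields a hyperbolic
   element of Gamma whose axis is nearby (closing lemma); their patterns are periodic. A
   period of S(l) would be a period of all S(g), which is impossible already for the
   geodesics through x. *)
Require Import Defs.
From Stdlib Require Import Reals List.
From Stdlib Require Import Lra Lia FinFun.
From Stdlib Require Import Classical ClassicalEpsilon.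
From Stdlib Require Import FunctionalExtensionality PropExtensionality.
From Coquelicot Require Import Coquelicot.
Open Scope R_scope.

(** * The group SU(1,1) *)

Notation "g ** h" := (su11_mul g h) (at level 40, left associativity).

(** The counted strip is half-open, signed distance in (-rho, rho], so g |-> S(g) can be
    discontinuous where an orbit point lies at distance exactly rho from the geodesic, and S(g) need
    not be approximated by the patterns of arbitrary nearby frames. Continuity holds from the
    positive side only; this is why stability is stated around a second frame, which a dense
    geodesic reaches just as well. Density alone does not give recurrence after a definite time: a
    neighbourhood might be met by one short arc. Infinitely many targets on pairwise different
    geodesics are therefore prescribed inside it; if all of them were met within unit time,
    discreteness would put two of them on one lift of the geodesic. Frames are points of R^4 subject
    to one polynomial equation: compactness is Heine-Borel in R^4, continuity is that of
    polynomials, and discreteness of Gamma becomes finiteness of its elements of bounded matrix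
    norm. *)

Definition su11 (g : C * C) : Prop :=
  (fst (fst g)) ^ 2 + (snd (fst g)) ^ 2 - (fst (snd g)) ^ 2 - (snd (snd g)) ^ 2 = 1.

Definition su11_one : C * C := (RtoC 1, RtoC 0).

Definition neg (g : C * C) : C * C := (Copp (fst g), Copp (snd g)).

Definition flow (t : R) : C * C := (RtoC (cosh (t / 2)), RtoC (sinh (t / 2))).

Definition base (g : C * C) : C := mob g (RtoC 0).

(* In hyperboloid coordinates (X0,X1,X2) of the point [base m], [fU m = X0 + X1],
   [fV m = X0 - X1] and [fW m = X2]. *)
Definition fU (m : C * C) : R :=
  (fst (fst m) + fst (snd m)) ^ 2 + (snd (fst m) - snd (snd m)) ^ 2.
Definition fV (m : C * C) : R :=
  (fst (fst m) - fst (snd m)) ^ 2 + (snd (fst m) + snd (snd m)) ^ 2.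
Definition fW (m : C * C) : R :=
  2 * (fst (fst m) * snd (snd m) + snd (fst m) * fst (snd m)).

Ltac mat_unfold :=
  unfold su11, fU, fV, fW, su11_mul, su11_inv, neg, flow, su11_one,
    Cmult, Cplus, Cminus, Cconj, Copp, RtoC in *; simpl in *.

Lemma pair4 (a b c d a' b' c' d' : R) :
  a = a' -> b = b' -> c = c' -> d = d' -> ((a, b), (c, d)) = ((a', b'), (c', d')).
Proof. congruence. Qed.

Lemma su11_mul_assoc (g h k : C * C) : g ** (h ** k) = g ** h ** k.
Proof.
  destruct g as [[a1 a2] [b1 b2]], h as [[c1 c2] [d1 d2]], k as [[e1 e2] [f1 f2]].
  mat_unfold; apply pair4; ring.
Qed.

Lemma su11_mul_1_l (g : C * C) : su11_one ** g = g.
Proof. destruct g as [[a1 a2] [b1 b2]]; mat_unfold; apply pair4; ring. Qed.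

Lemma su11_mul_1_r (g : C * C) : g ** su11_one = g.
Proof. destruct g as [[a1 a2] [b1 b2]]; mat_unfold; apply pair4; ring. Qed.

Lemma su11_inv_l (g : C * C) : su11 g -> su11_inv g ** g = su11_one.
Proof. destruct g as [[a1 a2] [b1 b2]]; mat_unfold; intros; apply pair4; nra. Qed.

Lemma su11_inv_r (g : C * C) : su11 g -> g ** su11_inv g = su11_one.
Proof. destruct g as [[a1 a2] [b1 b2]]; mat_unfold; intros; apply pair4; nra. Qed.

Lemma su11_inv_mul (g h : C * C) : su11_inv (g ** h) = su11_inv h ** su11_inv g.
Proof.
  destruct g as [[a1 a2] [b1 b2]], h as [[c1 c2] [d1 d2]]; mat_unfold; apply pair4; ring.
Qed.

Lemma su11_inv_inv (g : C * C) : su11_inv (su11_inv g) = g.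
Proof. destruct g as [[a1 a2] [b1 b2]]; mat_unfold; apply pair4; ring. Qed.

Lemma su11_invE (g h : C * C) : su11 g -> su11_inv g ** (g ** h) = h.
Proof. intros; now rewrite su11_mul_assoc, su11_inv_l, su11_mul_1_l. Qed.

Lemma su11_invE' (g h : C * C) : su11 g -> g ** (su11_inv g ** h) = h.
Proof. intros; now rewrite su11_mul_assoc, su11_inv_r, su11_mul_1_l. Qed.

Lemma su11_closed_mul (g h : C * C) : su11 g -> su11 h -> su11 (g ** h).
Proof.
  destruct g as [[a1 a2] [b1 b2]], h as [[c1 c2] [d1 d2]]; mat_unfold; intros H K.
  transitivity ((a1 ^ 2 + a2 ^ 2 - b1 ^ 2 - b2 ^ 2) * (c1 ^ 2 + c2 ^ 2 - d1 ^ 2 - d2 ^ 2)).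
  - ring.
  - replace (a1 ^ 2 + a2 ^ 2 - b1 ^ 2 - b2 ^ 2) with 1 by (rewrite <- H; ring).
    replace (c1 ^ 2 + c2 ^ 2 - d1 ^ 2 - d2 ^ 2) with 1 by (rewrite <- K; ring). ring.
Qed.

Lemma su11_closed_inv (g : C * C) : su11 g -> su11 (su11_inv g).
Proof. destruct g as [[a1 a2] [b1 b2]]; mat_unfold; intros; nra. Qed.

Lemma su11_closed_one : su11 su11_one.
Proof. mat_unfold; ring. Qed.

Lemma neg_mul (g h : C * C) : neg g ** h = neg (g ** h).
Proof.
  destruct g as [[a1 a2] [b1 b2]], h as [[c1 c2] [d1 d2]]; mat_unfold; apply pair4; ring.
Qed.

(** * Hyperbolic functions and translations along the real axis *)

Lemma exp_mul_opp (x : R) : exp x * exp (- x) = 1.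
Proof. rewrite <- exp_plus; replace (x + - x) with 0 by ring; apply exp_0. Qed.

Lemma flow_su11 (t : R) : su11 (flow t).
Proof. unfold su11, flow, cosh, sinh; simpl. pose proof (exp_mul_opp (t / 2)); nra. Qed.

Lemma cosh_sinh (x : R) : cosh x ^ 2 - sinh x ^ 2 = 1.
Proof. unfold cosh, sinh. pose proof (exp_mul_opp x); nra. Qed.

Lemma cosh_plus (x y : R) : cosh (x + y) = cosh x * cosh y + sinh x * sinh y.
Proof.
  unfold cosh, sinh; replace (- (x + y)) with (- x + - y) by ring.
  rewrite !exp_plus; field.
Qed.

Lemma sinh_plus (x y : R) : sinh (x + y) = sinh x * cosh y + cosh x * sinh y.
Proof.
  unfold cosh, sinh; replace (- (x + y)) with (- x + - y) by ring.
  rewrite !exp_plus; field.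
Qed.

Lemma cosh_opp (x : R) : cosh (- x) = cosh x.
Proof. unfold cosh; rewrite Ropp_involutive; field. Qed.

Lemma sinh_opp (x : R) : sinh (- x) = - sinh x.
Proof. unfold sinh; rewrite Ropp_involutive; field. Qed.

Lemma cosh_Rabs (x : R) : cosh (Rabs x) = cosh x.
Proof. unfold Rabs; destruct (Rcase_abs x); auto using cosh_opp. Qed.

Lemma sinh_pos (x : R) : 0 < x -> 0 < sinh x.
Proof. intros; rewrite <- sinh_0; now apply sinh_lt. Qed.

Lemma sinh_nonneg (x : R) : 0 <= x -> 0 <= sinh x.
Proof. intros [H|<-]; [left; now apply sinh_pos | rewrite sinh_0; lra]. Qed.

Lemma cosh_pos (x : R) : 0 < cosh x.
Proof. unfold cosh; pose proof (exp_pos x); pose proof (exp_pos (- x)); lra. Qed.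

Lemma cosh_ge_1 (x : R) : 1 <= cosh x.
Proof. pose proof (cosh_sinh x); pose proof (cosh_pos x); nra. Qed.

Lemma cosh_lt (x y : R) : 0 <= x -> x < y -> cosh x < cosh y.
Proof.
  intros H1 H2; pose proof (sinh_nonneg x H1); pose proof (sinh_lt x y H2).
  pose proof (cosh_sinh x); pose proof (cosh_sinh y).
  pose proof (cosh_pos x); pose proof (cosh_pos y); nra.
Qed.

Lemma cosh_lt_inv (x y : R) : 0 <= y -> cosh x < cosh y -> Rabs x < y.
Proof.
  intros Hy H; rewrite <- (cosh_Rabs x) in H.
  destruct (Rlt_le_dec (Rabs x) y) as [|[G|G]]; auto; [|rewrite G in H; lra].
  pose proof (cosh_lt _ _ Hy G); lra.
Qed.

Lemma cosh_le (x y : R) : 0 <= x -> x <= y -> cosh x <= cosh y.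
Proof. intros H1 [H2| ->]; [left; now apply cosh_lt | lra]. Qed.

Lemma cosh_inj (x y : R) : 0 <= x -> 0 <= y -> cosh x = cosh y -> x = y.
Proof.
  intros Hx Hy H; destruct (Rtotal_order x y) as [G|[G|G]]; auto; exfalso.
  - pose proof (cosh_lt _ _ Hx G); lra.
  - pose proof (cosh_lt _ _ Hy G); lra.
Qed.

Lemma cosh_exists (c : R) : 1 < c -> exists d, 0 < d /\ cosh d = c.
Proof.
  intros Hc. set (d := arcsinh (sqrt (c ^ 2 - 1))).
  assert (Hd : sinh d = sqrt (c ^ 2 - 1)) by apply sinh_arcsinh.
  assert (0 < sqrt (c ^ 2 - 1)) by (apply sqrt_lt_R0; nra).
  assert (sqrt (c ^ 2 - 1) ^ 2 = c ^ 2 - 1) by (apply pow2_sqrt; nra).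
  exists d; split.
  - destruct (Rlt_le_dec 0 d) as [|G]; auto.
    assert (0 <= sinh (- d)) by (apply sinh_nonneg; lra). rewrite sinh_opp in *; lra.
  - pose proof (cosh_sinh d); pose proof (cosh_pos d); rewrite Hd in *; nra.
Qed.

Lemma flow_add (s t : R) : flow (s + t) = flow s ** flow t.
Proof.
  unfold flow; mat_unfold; replace ((s + t) / 2) with (s / 2 + t / 2) by field.
  rewrite cosh_plus, sinh_plus; apply pair4; ring.
Qed.

Lemma flow_0 : flow 0 = su11_one.
Proof. unfold flow, su11_one; replace (0 / 2) with 0 by field; now rewrite cosh_0, sinh_0. Qed.

Lemma flow_inv (t : R) : su11_inv (flow t) = flow (- t).
Proof.
  unfold su11_inv, flow; replace (- t / 2) with (- (t / 2)) by field.
  rewrite cosh_opp, sinh_opp; mat_unfold; apply pair4; ring.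
Qed.

(** * The hyperboloid equation X0^2 - X1^2 - X2^2 = 1 and the light-cone coordinates X0 + X1, X0 -
    X1 *)

Lemma fUV (m : C * C) : su11 m -> fU m * fV m = 1 + fW m ^ 2.
Proof.
  destruct m as [[a1 a2] [b1 b2]]; mat_unfold; intros H.
  match goal with |- ?l = 1 + ?w => transitivity
   ((a1 ^ 2 + a2 ^ 2 - b1 ^ 2 - b2 ^ 2) ^ 2 + w); [ring|] end.
  replace (a1 ^ 2 + a2 ^ 2 - b1 ^ 2 - b2 ^ 2) with 1 by (rewrite <- H; ring). ring.
Qed.

Lemma fU_pos (m : C * C) : su11 m -> 0 < fU m.
Proof.
  intros H; pose proof (fUV m H). pose proof (pow2_ge_0 (fW m)).
  assert (0 <= fU m) by (unfold fU; apply Rplus_le_le_0_compat; apply pow2_ge_0).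
  destruct (Req_dec (fU m) 0) as [E|]; [rewrite E in *|]; lra.
Qed.

Lemma fV_pos (m : C * C) : su11 m -> 0 < fV m.
Proof.
  intros H; pose proof (fUV m H). pose proof (pow2_ge_0 (fW m)).
  assert (0 <= fV m) by (unfold fV; apply Rplus_le_le_0_compat; apply pow2_ge_0).
  destruct (Req_dec (fV m) 0) as [E|]; [rewrite E in *|]; lra.
Qed.

(** Translation along the real axis is a Lorentz boost of the (X0,X1)-plane: it rescales the two
    light-cone coordinates inversely to each other and fixes X2. *)
Lemma fU_flow (t : R) (m : C * C) : fU (flow t ** m) = exp t * fU m.
Proof.
  replace (exp t) with (exp (t / 2) * exp (t / 2)) by (rewrite <- exp_plus; f_equal; field).
  destruct m as [[a1 a2] [b1 b2]]; unfold flow, cosh, sinh; mat_unfold; field.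
Qed.

Lemma fV_flow (t : R) (m : C * C) : fV (flow t ** m) = exp (- t) * fV m.
Proof.
  replace (exp (- t)) with (exp (- (t / 2)) * exp (- (t / 2)))
    by (rewrite <- exp_plus; f_equal; field).
  destruct m as [[a1 a2] [b1 b2]]; unfold flow, cosh, sinh; mat_unfold; field.
Qed.

Lemma fW_flow (t : R) (m : C * C) : fW (flow t ** m) = fW m.
Proof.
  destruct m as [[a1 a2] [b1 b2]]; unfold flow, cosh, sinh; mat_unfold.
  pose proof (exp_mul_opp (t / 2)) as E. set (p := exp (t / 2)) in *; set (q := exp (- (t / 2))) in *.
  match goal with |- ?l = ?r => transitivity (p * q * r); [field | rewrite E; ring] end.
Qed.

(* Twice the Minkowski product of the hyperboloid points. *)
Lemma minkowski (m n : C * C) : su11 m -> su11 n ->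
  fU (su11_inv m ** n) + fV (su11_inv m ** n) =
  fU m * fV n + fV m * fU n - 2 * fW m * fW n.
Proof.
  destruct m as [[a1 a2] [b1 b2]], n as [[c1 c2] [d1 d2]]; mat_unfold; intros; ring.
Qed.

(** * Geodesics as orbits of frames *)

Lemma Cmod_sqr (z : C) : Cmod z ^ 2 = fst z ^ 2 + snd z ^ 2.
Proof. unfold Cmod; apply pow2_sqrt; nra. Qed.

Lemma su11_Cmod (g : C * C) : su11 g <-> Cmod (fst g) ^ 2 - Cmod (snd g) ^ 2 = 1.
Proof. rewrite !Cmod_sqr; unfold su11; split; intros; lra. Qed.

Lemma su11_fst_neq0 (g : C * C) : su11 g -> fst g <> RtoC 0.
Proof. rewrite su11_Cmod; intros H E; rewrite E, Cmod_0 in H; nra. Qed.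

Lemma Cconj_neq0 (z : C) : z <> RtoC 0 -> Cconj z <> RtoC 0.
Proof.
  intros H E; apply H, Cmod_eq_0; rewrite <- Cmod_conj, E; apply Cmod_0.
Qed.

Lemma baseE (g : C * C) : base g = Cdiv (snd g) (Cconj (fst g)).
Proof. unfold base, mob; f_equal; ring. Qed.

Lemma mob_base (g h : C * C) : su11 g -> su11 h -> mob g (base h) = base (g ** h).
Proof.
  intros Hg Hh; pose proof (su11_fst_neq0 _ (su11_closed_mul _ _ Hg Hh)) as H1.
  apply Cconj_neq0 in H1. pose proof (Cconj_neq0 _ (su11_fst_neq0 _ Hh)) as H2.
  rewrite !baseE; unfold mob, su11_mul in *; simpl in *.
  rewrite Cplus_conj, !Cmult_conj, Cconj_conj in *.
  field; split; auto.
Qed.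

Lemma inD_base (g : C * C) : su11 g -> inD (base g).
Proof.
  intros Hg; pose proof (su11_fst_neq0 _ Hg) as H1; apply Cconj_neq0 in H1.
  rewrite baseE; unfold inD; rewrite Cmod_div, Cmod_conj by auto.
  apply su11_Cmod in Hg. rewrite <- (Cmod_conj (fst g)) in *.
  apply Cmod_gt_0 in H1. pose proof (Cmod_ge_0 (snd g)).
  apply Rlt_div_l; nra.
Qed.

Lemma frame_at (z : C) : inD z -> exists m, su11 m /\ base m = z.
Proof.
  unfold inD; intros Hz. pose proof (Cmod_ge_0 z).
  assert (Hp : 0 < 1 - Cmod z ^ 2) by nra.
  pose proof (sqrt_lt_R0 _ Hp) as Hs. pose proof (pow2_sqrt _ (Rlt_le _ _ Hp)) as Hq.
  set (s := sqrt _) in *.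
  exists (RtoC (/ s), Cmult (RtoC (/ s)) z); split.
  - rewrite Cmod_sqr in Hq. unfold su11; simpl.
    transitivity (/ s * / s * (1 - (fst z ^ 2 + snd z ^ 2))); [ring|].
    rewrite <- Hq; field; lra.
  - rewrite baseE; simpl.
    replace (Cconj (RtoC (/ s))) with (RtoC (/ s)) by (unfold Cconj, RtoC; simpl; f_equal; ring).
    field. intros E; apply RtoC_inj in E. assert (0 < / s) by now apply Rinv_0_lt_compat. lra.
Qed.

(** By invariance, the quotient q in [hdist] is |b|/|a| for the relative frame (a,b). Since |a|^2 -
    |b|^2 = 1, exp of the distance is (|a|+|b|)/(|a|-|b|) = (|a|+|b|)^2, whence cosh = |a|^2 +
    |b|^2. Nonnegativity is kept so that cosh can be inverted later. *)
Lemma hdist_base (m n : C * C) : su11 m -> su11 n ->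
  0 <= hdist (base m) (base n) /\
  2 * cosh (hdist (base m) (base n)) = fU (su11_inv m ** n) + fV (su11_inv m ** n).
Proof.
  intros Hm Hn.
  pose proof (su11_closed_mul _ _ (su11_closed_inv _ Hm) Hn) as Hk.
  pose proof (su11_fst_neq0 _ Hk) as Ak.
  assert (E : Cmod (Cminus (base m) (base n)) /
    Cmod (Cminus (RtoC 1) (Cmult (base m) (Cconj (base n)))) =
    Cmod (snd (su11_inv m ** n)) / Cmod (fst (su11_inv m ** n))).
  { pose proof (su11_fst_neq0 _ Hm) as Am; pose proof (su11_fst_neq0 _ Hn) as An.
    pose proof (Cconj_neq0 _ Am) as Bm; pose proof (Cconj_neq0 _ An) as Bn.
    rewrite !baseE.
    destruct m as [a b], n as [c d]; unfold su11_mul, su11_inv in *; simpl in *.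
    replace (Cminus (Cdiv b (Cconj a)) (Cdiv d (Cconj c))) with
      (Cdiv (Copp (Cplus (Cmult (Cconj a) d) (Cmult (Copp b) (Cconj c))))
        (Cmult (Cconj a) (Cconj c))) by (field; auto).
    replace (Cminus (RtoC 1) (Cmult (Cdiv b (Cconj a)) (Cconj (Cdiv d (Cconj c))))) with
      (Cdiv (Cplus (Cmult (Cconj a) c) (Cmult (Copp b) (Cconj d))) (Cmult (Cconj a) c)).
    2:{ unfold Cdiv; rewrite Cmult_conj, Cinv_conj, Cconj_conj by auto. field; auto. }
    rewrite !Cmod_div, Cmod_opp, !Cmod_mult, !Cmod_conj by (try apply Cmult_neq_0; auto).
    apply Cmod_gt_0 in Am; apply Cmod_gt_0 in An; apply Cmod_gt_0 in Ak.
    field; repeat split; lra. }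
  unfold hdist; rewrite E.
  set (k := su11_inv m ** n) in *. clearbody k.
  replace (fU k + fV k) with (2 * (Cmod (fst k) ^ 2 + Cmod (snd k) ^ 2))
    by (rewrite !Cmod_sqr; unfold fU, fV; ring).
  apply su11_Cmod in Hk. apply Cmod_gt_0 in Ak. pose proof (Cmod_ge_0 (snd k)) as Bk.
  set (p := Cmod (fst k)) in *; set (q := Cmod (snd k)) in *.
  replace ((1 + q / p) / (1 - q / p)) with ((p + q) / (p - q)) by (field; split; nra).
  assert (0 < p - q) by nra.
  assert (1 <= (p + q) / (p - q)) by (apply Rle_div_r; lra).
  split.
  - rewrite <- ln_1; apply ln_le; lra.
  - unfold cosh; rewrite exp_Ropp, exp_ln by lra.
    replace ((p + q) / (p - q)) with ((p + q) ^ 2).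
    2:{ apply (Rmult_eq_reg_r (p - q)); [|lra]. field_simplify; [|lra]. nra. }
    replace (/ (p + q) ^ 2) with ((p - q) ^ 2). { field. }
    apply (Rmult_eq_reg_r ((p + q) ^ 2)); [|nra]. rewrite Rinv_l by nra.
    replace ((p - q) ^ 2 * (p + q) ^ 2) with ((p ^ 2 - q ^ 2) ^ 2) by ring. rewrite Hk; ring.
Qed.

Definition geod (g : C * C) (t : R) : C := base (g ** flow t).

Lemma hdist_geod (g n : C * C) (t : R) : su11 g -> su11 n ->
  2 * cosh (hdist (base n) (geod g t)) =
  exp (- t) * fU (su11_inv g ** n) + exp t * fV (su11_inv g ** n).
Proof.
  intros Hg Hn. unfold geod.
  assert (Ht : su11 (g ** flow t)) by (apply su11_closed_mul; auto using flow_su11).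
  replace (hdist (base n) (base (g ** flow t))) with (hdist (base (g ** flow t)) (base n)).
  - destruct (hdist_base (g ** flow t) n) as [_ ->]; auto.
    rewrite su11_inv_mul, flow_inv, <- su11_mul_assoc, fU_flow, fV_flow, Ropp_involutive.
    reflexivity.
  - apply cosh_inj; try now apply hdist_base.
    destruct (hdist_base (g ** flow t) n) as [_ E]; auto.
    destruct (hdist_base n (g ** flow t)) as [_ F]; auto.
    rewrite minkowski in E by auto. rewrite minkowski in F by auto. lra.
Qed.

Lemma inD_geod (g : C * C) (t : R) : su11 g -> inD (geod g t).
Proof. intros; apply inD_base, su11_closed_mul; auto using flow_su11. Qed.

(** Equal coordinates make the Minkowski product 2(UV - W^2) = 2, so the relative frame (a,b) has
    |a|^2 + |b|^2 = 1. With |a|^2 - |b|^2 = 1 this gives b = 0: the frames differ by a rotation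
    about 0. *)
Lemma base_by_coords (m n : C * C) : su11 m -> su11 n ->
  fU m = fU n -> fV m = fV n -> fW m = fW n -> base m = base n.
Proof.
  intros Hm Hn EU EV EW.
  destruct (hdist_base m n Hm Hn) as [_ E].
  rewrite minkowski, EU, EV, EW in E by auto.
  pose proof (fUV n Hn).
  assert (E0 : fst (snd (su11_inv m ** n)) = 0 /\ snd (snd (su11_inv m ** n)) = 0).
  { pose proof (minkowski m n Hm Hn) as M. rewrite EU, EV, EW in M.
    pose proof (su11_closed_mul _ _ (su11_closed_inv _ Hm) Hn) as Hk.
    set (k := su11_inv m ** n) in *. clearbody k. destruct k as [[a1 a2] [b1 b2]].
    unfold su11 in Hk; unfold fU at 1, fV at 1 in M; simpl in *.
    assert (b1 ^ 2 + b2 ^ 2 = 0) by nra. split; nra. }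
  assert (EM : n = m ** (su11_inv m ** n)) by now rewrite su11_invE'.
  pose proof (su11_fst_neq0 m Hm) as Am; pose proof (su11_fst_neq0 n Hn) as An.
  set (k := su11_inv m ** n) in *. clearbody k. destruct k as [a [b1 b2]].
  simpl in E0; destruct E0; subst b1 b2.
  rewrite !baseE. destruct m as [p q]. rewrite EM in *; clear EM.
  unfold su11_mul in *; simpl in *.
  replace (0, 0) with (RtoC 0) in * by reflexivity.
  replace (Cplus (Cmult p a) (Cmult q (Cconj (RtoC 0)))) with (Cmult p a) in *
    by (unfold Cconj, RtoC; simpl; rewrite Ropp_0; change (0, 0) with (RtoC 0); ring).
  replace (Cplus (Cmult p (RtoC 0)) (Cmult q (Cconj a))) with (Cmult q (Cconj a)) by ring.
  rewrite Cmult_conj.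
  assert (a <> RtoC 0) by (intros ->; apply An; ring).
  field; split; now apply Cconj_neq0.
Qed.

Lemma fUVW_one : fU su11_one = 1 /\ fV su11_one = 1 /\ fW su11_one = 0.
Proof. unfold fU, fV, fW; simpl; repeat split; ring. Qed.

Lemma fU_of_flow (t : R) : fU (flow t) = exp t.
Proof. rewrite <- (su11_mul_1_r (flow t)), fU_flow; destruct fUVW_one as [-> _]; ring. Qed.

Lemma fV_of_flow (t : R) : fV (flow t) = exp (- t).
Proof. rewrite <- (su11_mul_1_r (flow t)), fV_flow; destruct fUVW_one as [_ [-> _]]; ring. Qed.

Lemma fW_of_flow (t : R) : fW (flow t) = 0.
Proof. rewrite <- (su11_mul_1_r (flow t)), fW_flow; apply fUVW_one. Qed.

Lemma geod_geodesic (g : C * C) : su11 g -> geodesic (geod g).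
Proof.
  intros Hg; split; [intros; now apply inD_geod|]. intros s t.
  assert (Hs : su11 (g ** flow s)) by (apply su11_closed_mul; auto using flow_su11).
  apply cosh_inj; [|apply Rabs_pos|].
  - unfold geod; apply hdist_base; apply su11_closed_mul; auto using flow_su11.
  - apply (Rmult_eq_reg_l 2); [|lra].
    unfold geod at 1; rewrite hdist_geod by auto.
    rewrite su11_invE, fU_of_flow, fV_of_flow, <- !exp_plus, cosh_Rabs by auto.
    unfold cosh. replace (- (s - t)) with (t + - s) by ring.
    replace (s - t) with (- t + s) by ring. field.
Qed.

(** A square root c + id of the unit complex number u + iv by the half-angle formulas; the sign of d
    follows that of v. *)
Lemma unit_sqrt (u v : R) : u ^ 2 + v ^ 2 = 1 ->
  exists c d, c ^ 2 + d ^ 2 = 1 /\ c ^ 2 - d ^ 2 = u /\ 2 * c * d = v.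
Proof.
  intros H. assert (-1 <= u <= 1) by nra.
  pose proof (pow2_sqrt ((1 + u) / 2)) as Hc. pose proof (pow2_sqrt ((1 - u) / 2)) as Hd.
  pose proof (sqrt_pos ((1 + u) / 2)) as Pc. pose proof (sqrt_pos ((1 - u) / 2)) as Pd.
  set (c := sqrt ((1 + u) / 2)) in *; set (d := sqrt ((1 - u) / 2)) in *.
  specialize (Hc ltac:(lra)); specialize (Hd ltac:(lra)).
  assert (E : (2 * c * d) ^ 2 = v ^ 2).
  { replace ((2 * c * d) ^ 2) with (4 * c ^ 2 * d ^ 2) by ring. rewrite Hc, Hd. nra. }
  destruct (Rle_lt_dec 0 v).
  - exists c, d; repeat split; try lra.
    assert (0 <= 2 * c * d) by nra. nra.
  - exists c, (- d); replace ((- d) ^ 2) with (d ^ 2) by ring; repeat split; try lra.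
    assert (0 <= 2 * c * d) by nra. nra.
Qed.

Lemma base_mul (g m n : C * C) : su11 g -> su11 m -> su11 n ->
  base m = base n -> base (g ** m) = base (g ** n).
Proof. intros Hg Hm Hn E; rewrite <- !mob_base, E by auto; auto. Qed.

(** Two coordinates suffice: UV = 1 forces W = 0. *)
Lemma geod_by_coords (g n : C * C) (t : R) : su11 g -> su11 n ->
  fU (su11_inv g ** n) = exp t -> fV (su11_inv g ** n) = exp (- t) ->
  base n = geod g t.
Proof.
  intros Hg Hn EU EV.
  pose proof (su11_closed_mul _ _ (su11_closed_inv _ Hg) Hn) as HN.
  rewrite <- (su11_invE' g n) by auto.
  unfold geod; apply base_mul; auto using flow_su11.
  apply base_by_coords; auto using flow_su11; rewrite ?EU, ?EV, ?fU_of_flow, ?fV_of_flow; auto.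
  rewrite fW_of_flow. pose proof (fUV _ HN) as E. rewrite EU, EV, exp_mul_opp in E. nra.
Qed.

(** An isometric embedding of R is determined by its points at times 0 and 1: a frame at k 0 is
    rotated towards k 1, and then the distances of k t from these two points are two independent
    linear equations for U and V of k t. No smoothness of k is involved. *)
Lemma geodesic_frame (k : R -> C) : geodesic k -> exists g, su11 g /\ k = geod g.
Proof.
  intros [Hin Hd].
  destruct (frame_at (k 0) (Hin 0)) as [m [Hm Em]].
  destruct (frame_at (k 1) (Hin 1)) as [n [Hn En]].
  pose proof (su11_closed_mul _ _ (su11_closed_inv _ Hm) Hn) as Hj.
  destruct (hdist_base m n Hm Hn) as [_ D1]. rewrite Em, En, Hd in D1.
  replace (Rabs (0 - 1)) with 1 in D1 by (rewrite Rabs_left; lra).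
  set (j := su11_inv m ** n) in *.
  pose proof (sinh_pos 1 Rlt_0_1) as S1. pose proof (cosh_sinh 1) as CS.
  pose proof (fUV j Hj) as UV.
  (* The direction of k 1 seen from k 0, namely (X1,X2)/sinh 1. A diagonal element (a,0) of SU(1,1)
     turns the disc by a^2, hence the square root. *)
  destruct (unit_sqrt ((fU j - fV j) / (2 * sinh 1)) (fW j / sinh 1)) as [c [d [E1 [E2 E3]]]].
  { replace (((fU j - fV j) / (2 * sinh 1)) ^ 2 + (fW j / sinh 1) ^ 2) with
      (((fU j + fV j) ^ 2 - 4 * (fU j * fV j) + 4 * fW j ^ 2) / (4 * sinh 1 ^ 2)) by (field; lra).
    rewrite UV, <- D1. replace (4 * sinh 1 ^ 2) with (4 * (cosh 1 ^ 2 - 1)) by lra.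
    field. nra. }
  set (r := ((c, d), RtoC 0) : C * C).
  assert (Hr : su11 r) by (unfold su11; simpl; lra).
  assert (Hg : su11 (m ** r)) by now apply su11_closed_mul.
  assert (Eb : base (m ** r) = k 0).
  { rewrite <- Em. rewrite <- (su11_mul_1_r m) at 2.
    apply base_mul; auto using su11_closed_one.
    rewrite !baseE; simpl. unfold Cdiv; ring. }
  assert (EU : fU (su11_inv (m ** r) ** n) = exp 1 /\ fV (su11_inv (m ** r) ** n) = exp (- (1))).
  { rewrite su11_inv_mul, <- su11_mul_assoc. fold j.
    assert (A : fU (su11_inv r ** j) + fV (su11_inv r ** j) = fU j + fV j).
    { destruct j as [[a1 a2] [b1 b2]]; clear - E1; unfold r; mat_unfold.
      match goal with |- ?l = ?rr => transitivity ((c ^ 2 + d ^ 2) * rr) end.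
      - simpl; ring.
      - replace (c ^ 2 + d ^ 2) with 1 by (rewrite <- E1; ring); ring. }
    assert (B : fU (su11_inv r ** j) - fV (su11_inv r ** j) =
      (c ^ 2 - d ^ 2) * (fU j - fV j) + 2 * (2 * c * d) * fW j).
    { destruct j as [[a1 a2] [b1 b2]]; unfold r; mat_unfold; ring. }
    rewrite E2, E3 in B.
    replace ((fU j - fV j) / (2 * sinh 1) * (fU j - fV j) + 2 * (fW j / sinh 1) * fW j) with
      (((fU j + fV j) ^ 2 - 4 * (fU j * fV j) + 4 * fW j ^ 2) / (2 * sinh 1)) in B
      by (field; lra).
    rewrite UV, <- D1 in B.
    replace (((2 * cosh 1) ^ 2 - 4 * (1 + fW j ^ 2) + 4 * fW j ^ 2) / (2 * sinh 1))
      with (2 * sinh 1) in B.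
    2:{ replace ((2 * cosh 1) ^ 2 - 4 * (1 + fW j ^ 2) + 4 * fW j ^ 2) with (4 * sinh 1 ^ 2) by lra.
        field; lra. }
    rewrite <- D1 in A. unfold cosh, sinh in A, B. split; lra. }
  destruct EU as [EU EV].
  exists (m ** r); split; auto. apply functional_extensionality; intros t.
  destruct (frame_at (k t) (Hin t)) as [p [Hp Ep]]. rewrite <- Ep.
  destruct (hdist_base _ _ Hg Hp) as [_ F0]. rewrite Eb, Ep, Hd in F0.
  pose proof (hdist_geod _ p 1 Hg Hp) as F1.
  rewrite <- (geod_by_coords _ n 1), En, Ep, Hd in F1 by auto.
  rewrite cosh_Rabs in F0, F1.
  set (N := su11_inv (m ** r) ** p) in *.
  replace (cosh (0 - t)) with (cosh t) in F0
    by (rewrite <- (cosh_opp t); f_equal; ring).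
  unfold cosh in F0, F1.
  replace (t - 1) with (t + - (1)) in F1 by ring.
  replace (- (t + - (1))) with (- t + 1) in F1 by ring.
  rewrite !exp_plus in F1.
  assert (exp (- (1)) < exp 1) by (apply exp_increasing; lra).
  assert (fV N = exp (- t)).
  { apply (Rmult_eq_reg_l (exp 1 - exp (- (1)))); [|lra]. nra. }
  apply geod_by_coords; auto; fold N; lra.
Qed.

(** Twice the cosh of the distance to time t is exp(-t) U + exp(t) V, which has its unique minimum
    where exp(2t) = U/V. *)
Lemma foot_geod (g n : C * C) (t : R) : su11 g -> su11 n ->
  foot (geod g) (base n) t <->
  fU (su11_inv g ** n) = exp (2 * t) * fV (su11_inv g ** n).
Proof.
  intros Hg Hn. pose proof (hdist_geod g n) as D.
  pose proof (su11_closed_mul _ _ (su11_closed_inv _ Hg) Hn) as HN.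
  pose proof (fU_pos _ HN) as PU; pose proof (fV_pos _ HN) as PV.
  assert (P : forall s, 0 <= hdist (base n) (geod g s)).
  { intros s. apply hdist_base; auto. apply su11_closed_mul; auto using flow_su11. }
  set (N := su11_inv g ** n) in *.
  split; intros H.
  - set (s := ln (fU N / fV N) / 2).
    assert (Q : 0 < fU N / fV N) by now apply Rdiv_lt_0_compat.
    assert (Es : exp s * exp s = fU N / fV N).
    { rewrite <- exp_plus. replace (s + s) with (ln (fU N / fV N)) by (unfold s; field).
      now apply exp_ln. }
    pose proof (cosh_le _ _ (P t) (H s)) as L.
    pose proof (D t Hg Hn) as Dt; pose proof (D s Hg Hn) as Ds.
    replace (2 * t) with (t + t) by ring. rewrite exp_plus.
    assert (EU : fU N = exp s * exp s * fV N) by (rewrite Es; field; lra).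
    pose proof (exp_mul_opp s) as Is; pose proof (exp_mul_opp t) as It.
    pose proof (exp_pos s) as Ps; pose proof (exp_pos t) as Pt.
    assert (Z : (exp s - exp t) ^ 2 = 0).
    { assert (exp (- t) * fU N + exp t * fV N <= exp (- s) * fU N + exp s * fV N) as L' by lra.
      rewrite EU in L'.
      replace (exp (- s) * (exp s * exp s * fV N)) with (exp s * fV N) in L'
        by (transitivity (exp s * exp (- s) * exp s * fV N); [rewrite Is; ring|ring]).
      apply (Rmult_le_compat_l (exp t)) in L'; [|lra].
      replace (exp t * (exp (- t) * (exp s * exp s * fV N) + exp t * fV N)) with
        (exp t * exp (- t) * (exp s * exp s * fV N) + exp t * exp t * fV N) in L' by ring.
      rewrite It in L'. apply Rle_antisym; [|apply pow2_ge_0].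
      apply (Rmult_le_reg_r (fV N)); auto. lra. }
    rewrite EU. assert (exp s = exp t) as -> by nra. reflexivity.
  - intros s. destruct (Rle_lt_dec (hdist (base n) (geod g t)) (hdist (base n) (geod g s)))
      as [|L]; auto. exfalso. apply cosh_lt in L; auto.
    pose proof (D t Hg Hn) as Dt; pose proof (D s Hg Hn) as Ds. fold N in Dt, Ds.
    rewrite H in Dt, Ds.
    replace (exp (- t) * (exp (2 * t) * fV N)) with (exp t * fV N) in Dt
      by (rewrite <- Rmult_assoc, <- exp_plus; do 2 f_equal; ring).
    replace (exp (- s) * (exp (2 * t) * fV N)) with (exp t * fV N * exp (t - s)) in Ds
      by (rewrite <- (Rmult_assoc (exp (- s))), <- exp_plus;
          rewrite (Rmult_comm (exp t)), Rmult_assoc, <- exp_plus, Rmult_comm;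
          do 2 f_equal; ring).
    replace (exp s) with (exp t * exp (s - t)) in Ds by (rewrite <- exp_plus; f_equal; ring).
    pose proof (cosh_ge_1 (t - s)) as G. unfold cosh in G.
    replace (- (t - s)) with (s - t) in G by ring.
    pose proof (exp_pos t). assert (0 < exp t * fV N) by nra. nra.
Qed.

(** The functions are the real and imaginary parts of B / conj A, the base point of a frame (A,B)
    moving by A' = B/2, B' = A/2. As |A|^2 - |B|^2 = 1, the derivative is 1/(2 conj(A)^2) =
    A^2/(2|A|^4). *)
Lemma is_derive_ratio (A1 A2 B1 B2 : R -> R) (t : R) :
  is_derive A1 t (B1 t / 2) -> is_derive A2 t (B2 t / 2) ->
  is_derive B1 t (A1 t / 2) -> is_derive B2 t (A2 t / 2) ->
  A1 t ^ 2 + A2 t ^ 2 - B1 t ^ 2 - B2 t ^ 2 = 1 ->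
  is_derive (fun s => (B1 s * A1 s - B2 s * A2 s) / (A1 s ^ 2 + A2 s ^ 2)) t
    ((A1 t ^ 2 - A2 t ^ 2) / (2 * (A1 t ^ 2 + A2 t ^ 2) ^ 2)) /\
  is_derive (fun s => (B1 s * A2 s + B2 s * A1 s) / (A1 s ^ 2 + A2 s ^ 2)) t
    (2 * A1 t * A2 t / (2 * (A1 t ^ 2 + A2 t ^ 2) ^ 2)).
Proof.
  intros HA1 HA2 HB1 HB2 H.
  pose proof (is_derive_unique _ _ _ HA1) as EA1; pose proof (is_derive_unique _ _ _ HA2) as EA2.
  pose proof (is_derive_unique _ _ _ HB1) as EB1; pose proof (is_derive_unique _ _ _ HB2) as EB2.
  assert (0 < A1 t ^ 2 + A2 t ^ 2) by nra.
  split; (auto_derive; [repeat split; try (eexists; eassumption); lra|]).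
  all: replace (Derive (fun x => A1 x) t) with (B1 t / 2) by (symmetry; exact EA1).
  all: replace (Derive (fun x => A2 x) t) with (B2 t / 2) by (symmetry; exact EA2).
  all: replace (Derive (fun x => B1 x) t) with (A1 t / 2) by (symmetry; exact EB1).
  all: replace (Derive (fun x => B2 x) t) with (A2 t / 2) by (symmetry; exact EB2).
  (* Multiplying by |A|^2 - |B|^2 = 1 makes the identity homogeneous, so that [field] proves it. *)
  all: match goal with |- _ = ?r =>
    transitivity (r * (A1 t ^ 2 + A2 t ^ 2 - B1 t ^ 2 - B2 t ^ 2)) end;
    [field; lra|rewrite H; ring].
Qed.

Lemma vel_geod (g : C * C) (t : R) : su11 g ->
  let A := fst (g ** flow t) in
  vel (geod g) t = Cdiv (RtoC 1) (Cmult (RtoC 2) (Cmult (Cconj A) (Cconj A))).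
Proof.
  intros Hg A.
  assert (Dc : is_derive (fun s => cosh (s / 2)) t (sinh (t / 2) / 2)).
  { unfold cosh, sinh; auto_derive; auto. unfold Rdiv; field. }
  assert (Ds : is_derive (fun s => sinh (s / 2)) t (cosh (t / 2) / 2)).
  { unfold cosh, sinh; auto_derive; auto. unfold Rdiv; field. }
  assert (Hpos : forall s, su11 (g ** flow s)).
  { intros; apply su11_closed_mul; auto using flow_su11. }
  destruct g as [[a1 a2] [b1 b2]].
  assert (L : forall a b, is_derive (fun s => a * cosh (s / 2) + b * sinh (s / 2)) t
     ((a * sinh (t / 2) + b * cosh (t / 2)) / 2)).
  { intros a b. evar_last.
    - apply @is_derive_plus; apply is_derive_scal; eassumption.
    - unfold plus; simpl; field. }
  assert (L' : forall a b, is_derive (fun s => a * sinh (s / 2) + b * cosh (s / 2)) t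
     ((a * cosh (t / 2) + b * sinh (t / 2)) / 2)).
  { intros a b. evar_last.
    - apply @is_derive_plus; apply is_derive_scal; eassumption.
    - unfold plus; simpl; field. }
  assert (Z : forall s, (a1 * cosh (s / 2) + b1 * sinh (s / 2)) ^ 2 +
     (a2 * cosh (s / 2) + b2 * sinh (s / 2)) ^ 2 -
     (a1 * sinh (s / 2) + b1 * cosh (s / 2)) ^ 2 -
     (a2 * sinh (s / 2) + b2 * cosh (s / 2)) ^ 2 = 1).
  { intros s; rewrite <- (Hpos s). unfold su11, flow; mat_unfold. ring. }
  destruct (is_derive_ratio _ _ _ _ t (L a1 b1) (L a2 b2) (L' a1 b1) (L' a2 b2) (Z t)) as [Q1 Q2].
  pose proof (Z t) as Zt.
  unfold vel.
  transitivity
    ((((a1 * cosh (t / 2) + b1 * sinh (t / 2)) ^ 2 - (a2 * cosh (t / 2) + b2 * sinh (t / 2)) ^ 2) /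
      (2 * ((a1 * cosh (t / 2) + b1 * sinh (t / 2)) ^ 2 +
            (a2 * cosh (t / 2) + b2 * sinh (t / 2)) ^ 2) ^ 2),
     (2 * (a1 * cosh (t / 2) + b1 * sinh (t / 2)) * (a2 * cosh (t / 2) + b2 * sinh (t / 2))) /
      (2 * ((a1 * cosh (t / 2) + b1 * sinh (t / 2)) ^ 2 +
            (a2 * cosh (t / 2) + b2 * sinh (t / 2)) ^ 2) ^ 2)) : C).
  - assert (EG : forall s, geod ((a1, a2), (b1, b2)) s =
      let A1 := a1 * cosh (s / 2) + b1 * sinh (s / 2) in
      let A2 := a2 * cosh (s / 2) + b2 * sinh (s / 2) in
      let B1 := a1 * sinh (s / 2) + b1 * cosh (s / 2) in
      let B2 := a2 * sinh (s / 2) + b2 * cosh (s / 2) in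
      ((B1 * A1 - B2 * A2) / (A1 ^ 2 + A2 ^ 2), (B1 * A2 + B2 * A1) / (A1 ^ 2 + A2 ^ 2))).
    { intros s; pose proof (Z s) as Zs. clear - Zs. cbv zeta.
      pose proof (pow2_ge_0 (a1 * sinh (s / 2) + b1 * cosh (s / 2))).
      pose proof (pow2_ge_0 (a2 * sinh (s / 2) + b2 * cosh (s / 2))).
      unfold geod; rewrite baseE; unfold flow, Cdiv, Cinv; mat_unfold.
      f_equal; field; repeat split; intros E; lra. }
    f_equal; apply is_derive_unique.
    + eapply is_derive_ext; [|exact Q1]. intros s; cbv beta; now rewrite EG.
    + eapply is_derive_ext; [|exact Q2]. intros s; cbv beta; now rewrite EG.
  - pose proof (pow2_ge_0 (a1 * sinh (t / 2) + b1 * cosh (t / 2))) as S1.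
    pose proof (pow2_ge_0 (a2 * sinh (t / 2) + b2 * cosh (t / 2))) as S2.
    assert (EA : A =
      ((a1 * cosh (t / 2) + b1 * sinh (t / 2), a2 * cosh (t / 2) + b2 * sinh (t / 2)) : C))
      by (unfold A, flow; mat_unfold; f_equal; ring).
    rewrite EA.
    set (p := a1 * cosh (t / 2) + b1 * sinh (t / 2)) in *.
    set (q := a2 * cosh (t / 2) + b2 * sinh (t / 2)) in *.
    assert (P : 0 < p ^ 2 + q ^ 2) by lra.
    clearbody p q. clear - P.
    unfold Cdiv, Cinv; mat_unfold.
    assert (0 < (p * (p * 1) + q * (q * 1)) ^ 2) by nra.
    f_equal; field; repeat split; intros E; nra.
Qed.

Lemma Cmod2_pos (z : C) : z <> RtoC 0 -> 0 < Cmod z ^ 2.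
Proof. intros H; apply Cmod_gt_0 in H; nra. Qed.

Lemma Im_scal (z : C) (r : R) : Im (Cmult z (RtoC r)) = Im z * r.
Proof. destruct z; unfold Im, Cmult, RtoC; simpl; ring. Qed.

(** [pos_side] tests the Euclidean chord from the foot, not the initial direction of the
    perpendicular. In the frame (A,B) at the foot, with relative frame (p,q), the tested number is a
    positive multiple of |A|^2 w + I |q|^2, where w = X2/2. The correction I |q|^2 cannot change the
    sign: |I| <= |A|^2, and X1 = 0 gives w^2 = (1 + |q|^2) |q|^2, so |w| > |q|^2 unless q = 0. *)
Lemma side_geod (g n : C * C) (t : R) : su11 g -> su11 n ->
  fU (su11_inv g ** n) = exp (2 * t) * fV (su11_inv g ** n) ->
  0 < Im (Cmult (Cminus (base n) (geod g t)) (Cconj (vel (geod g) t))) <->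
  0 < fW (su11_inv g ** n).
Proof.
  intros Hg Hn HF.
  pose proof (su11_closed_mul _ _ Hg (flow_su11 t)) as HG.
  rewrite vel_geod by auto. unfold geod.
  set (G := g ** flow t) in *.
  pose proof (su11_closed_mul _ _ (su11_closed_inv _ HG) Hn) as HM.
  assert (EM : su11_inv G ** n = flow (- t) ** (su11_inv g ** n)).
  { unfold G; now rewrite su11_inv_mul, flow_inv, su11_mul_assoc. }
  assert (EW : fW (su11_inv g ** n) = fW (su11_inv G ** n)) by now rewrite EM, fW_flow.
  assert (EUV : fU (su11_inv G ** n) = fV (su11_inv G ** n)).
  { rewrite EM, fU_flow, fV_flow, HF, Ropp_involutive.
    rewrite <- Rmult_assoc, <- exp_plus; do 2 f_equal; ring. }
  rewrite EW; clear EW EM HF.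
  rewrite <- (su11_invE' G n) at 1 by auto.
  set (M := su11_inv G ** n) in *. clearbody M G.
  pose proof (su11_fst_neq0 _ (su11_closed_mul _ _ HG HM)) as HD.
  pose proof (su11_fst_neq0 _ HG) as HA.
  destruct G as [A B], M as [p q]. rewrite !baseE.
  unfold su11_mul in *; simpl fst in *; simpl snd in *.
  set (D := Cplus (Cmult A p) (Cmult B (Cconj q))) in *.
  assert (ED : Cconj D = Cplus (Cmult (Cconj A) (Cconj p)) (Cmult (Cconj B) q)).
  { unfold D; now rewrite Cplus_conj, !Cmult_conj, Cconj_conj. }
  pose proof (Cconj_neq0 _ HD) as HD'. pose proof (Cconj_neq0 _ HA) as HA'.
  assert (NA : Cmult A (Cconj A) = RtoC (Cmod A ^ 2)).
  { rewrite <- Cmod2_conj; reflexivity. }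
  assert (NB : Cmult B (Cconj B) = RtoC (Cmod B ^ 2)).
  { rewrite <- Cmod2_conj; reflexivity. }
  assert (ND : Cmult D (Cconj D) = RtoC (Cmod D ^ 2)).
  { rewrite <- Cmod2_conj; reflexivity. }
  pose proof (Cmod2_pos _ HA) as PA. pose proof (Cmod2_pos _ HD) as PD.
  apply su11_Cmod in HG; apply su11_Cmod in HM; simpl fst in *; simpl snd in *.
  assert (K0 : 0 < 2 * (Cmod A ^ 2 * Cmod A ^ 2 * Cmod D ^ 2)).
  { assert (0 < Cmod A ^ 2 * Cmod A ^ 2) by nra. nra. }
  assert (EZ : Cmult (Cminus (Cdiv (Cplus (Cmult A q) (Cmult B (Cconj p))) (Cconj D))
      (Cdiv B (Cconj A)))
     (Cconj (Cdiv (RtoC 1) (Cmult (RtoC 2) (Cmult (Cconj A) (Cconj A))))) =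
     Cmult (Cmult q (Cmult (Cconj A) D))
       (RtoC (/ (2 * (Cmod A ^ 2 * Cmod A ^ 2 * Cmod D ^ 2))))).
  { rewrite RtoC_inv, !RtoC_mult, <- NA, <- ND by lra.
    replace (Cminus (Cdiv (Cplus (Cmult A q) (Cmult B (Cconj p))) (Cconj D))
      (Cdiv B (Cconj A))) with (Cdiv q (Cmult (Cconj A) (Cconj D))).
    2:{ transitivity (Cdiv (Cmult q (Cminus (Cmult A (Cconj A)) (Cmult B (Cconj B))))
          (Cmult (Cconj A) (Cconj D))).
        - rewrite NA, NB, <- RtoC_minus, HG. field; auto.
        - rewrite ED in *. field; auto. }
    replace (Cconj (Cdiv (RtoC 1) (Cmult (RtoC 2) (Cmult (Cconj A) (Cconj A))))) with
      (Cdiv (RtoC 1) (Cmult (RtoC 2) (Cmult A A))).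
    2:{ unfold Cdiv. rewrite Cmult_conj, Cinv_conj, !Cmult_conj, Cconj_conj.
        - f_equal; [|do 2 f_equal]; unfold Cconj, RtoC; simpl; f_equal; ring.
        - repeat apply Cmult_neq_0; auto. intros E; apply RtoC_inj in E; lra. }
    field; repeat split; auto. }
  rewrite EZ, Im_scal; clear EZ ND NA NB ED.
  assert (K : 0 < / (2 * (Cmod A ^ 2 * Cmod A ^ 2 * Cmod D ^ 2))).
  { now apply Rinv_0_lt_compat. }
  set (kap := / _) in *. clearbody kap.
  rewrite !Cmod_sqr in *.
  clear HD HD' HA' PD K0. unfold D; clear D.
  destruct A as [A1 A2], B as [B1 B2], p as [p1 p2], q as [q1 q2].
  unfold fU, fV, fW in *; unfold Im, Cmult, Cplus, Cconj in *; simpl fst in *; simpl snd in *.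
  set (w := p1 * q2 + p2 * q1).
  set (I := A1 * B2 - A2 * B1).
  match goal with |- 0 < ?e * kap <-> _ =>
    replace e with ((A1 ^ 2 + A2 ^ 2) * w + I * (q1 ^ 2 + q2 ^ 2)) by (unfold w, I; ring) end.
  assert (Ew : w ^ 2 = (1 + (q1 ^ 2 + q2 ^ 2)) * (q1 ^ 2 + q2 ^ 2)).
  { replace (1 + (q1 ^ 2 + q2 ^ 2)) with (p1 ^ 2 + p2 ^ 2) by lra.
    assert (p1 * q1 - p2 * q2 = 0) by lra. unfold w.
    transitivity ((p1 ^ 2 + p2 ^ 2) * (q1 ^ 2 + q2 ^ 2) - (p1 * q1 - p2 * q2) ^ 2); [ring|].
    rewrite H; ring. }
  assert (EI : I ^ 2 <= (A1 ^ 2 + A2 ^ 2) * (B1 ^ 2 + B2 ^ 2)).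
  { pose proof (pow2_ge_0 (A1 * B1 + A2 * B2)). unfold I; nra. }
  assert (0 <= q1 ^ 2 + q2 ^ 2) by nra.
  clearbody w I.
  set (al := A1 ^ 2 + A2 ^ 2) in *. set (be := B1 ^ 2 + B2 ^ 2) in *.
  set (Q := q1 ^ 2 + q2 ^ 2) in *. clearbody al be Q.
  assert (HI : - al <= I <= al) by (split; nra).
  assert (L : 0 < al * w + I * Q <-> 0 < w).
  { split; intros G.
    - destruct (Rlt_le_dec 0 w) as [|N]; auto. exfalso.
      assert (Q <= - w) by nra. assert (I * Q <= al * Q) by nra. nra.
    - assert (0 < Q) by nra. assert (Q < w) by nra.
      assert (- (al * Q) <= I * Q) by nra. nra. }
  split; intros G.
  - assert (0 < w) by (apply L; nra). lra.
  - assert (0 < w) as G' by lra. apply L in G'. nra.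
Qed.

Lemma foot_sinh (g n : C * C) (t : R) : su11 g -> su11 n ->
  fU (su11_inv g ** n) = exp (2 * t) * fV (su11_inv g ** n) ->
  sinh (hdist (base n) (geod g t)) = Rabs (fW (su11_inv g ** n)).
Proof.
  intros Hg Hn H.
  pose proof (su11_closed_mul _ _ (su11_closed_inv _ Hg) Hn) as HN.
  pose proof (hdist_geod g n t Hg Hn) as D. pose proof (fUV _ HN) as UV.
  assert (P : 0 <= hdist (base n) (geod g t)).
  { apply hdist_base; auto. apply su11_closed_mul; auto using flow_su11. }
  rewrite H in D, UV. set (N := su11_inv g ** n) in *.
  replace (exp (- t) * (exp (2 * t) * fV N)) with (exp t * fV N) in D
    by (rewrite <- Rmult_assoc, <- exp_plus; do 2 f_equal; ring).
  replace (exp (2 * t)) with (exp t * exp t) in UV by (rewrite <- exp_plus; f_equal; ring).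
  pose proof (cosh_sinh (hdist (base n) (geod g t))) as CS.
  pose proof (sinh_nonneg _ P).
  assert (E : cosh (hdist (base n) (geod g t)) = exp t * fV N) by lra.
  rewrite E in CS.
  apply Rsqr_inj; [auto|apply Rabs_pos|]. rewrite <- Rsqr_abs. unfold Rsqr. nra.
Qed.

Lemma sinh_lt_inv (x y : R) : sinh x < sinh y -> x < y.
Proof.
  intros H; destruct (Rtotal_order x y) as [|[E|G]]; auto; exfalso.
  - rewrite E in H; lra.
  - apply sinh_lt in G; lra.
Qed.

Lemma sinh_inj (x y : R) : sinh x = sinh y -> x = y.
Proof. intros H; rewrite <- (arcsinh_sinh x), <- (arcsinh_sinh y); now f_equal. Qed.

Lemma exp_double_inj (V s t : R) : 0 < V -> exp (2 * s) * V = exp (2 * t) * V -> s = t.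
Proof. intros HV H; apply Rmult_eq_reg_r, exp_inv in H; lra. Qed.

(** Since sinh is increasing, the one-sided closed neighbourhood is a half-open interval for X2; the
    side condition matters only at its endpoints. *)
Lemma Nbar_plus_geod (g n : C * C) (rho t : R) : su11 g -> su11 n -> 0 < rho ->
  fU (su11_inv g ** n) = exp (2 * t) * fV (su11_inv g ** n) ->
  Nbar_plus (geod g) rho (base n) <->
  - sinh rho < fW (su11_inv g ** n) <= sinh rho.
Proof.
  intros Hg Hn Hr H.
  pose proof (foot_sinh g n t Hg Hn H) as S.
  pose proof (fV_pos _ (su11_closed_mul _ _ (su11_closed_inv _ Hg) Hn)) as PV.
  assert (U : forall s, foot (geod g) (base n) s -> s = t).
  { intros s Hs; apply foot_geod in Hs; auto. rewrite H in Hs.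
    symmetry; eapply exp_double_inj; eauto. }
  assert (F : foot (geod g) (base n) t) by now apply foot_geod.
  pose proof (side_geod g n t Hg Hn H) as Sd.
  pose proof (sinh_pos rho Hr).
  set (w := fW _) in *. set (d := hdist (base n) (geod g t)) in *.
  split.
  - intros [_ [[r [[s [Fs Es]] Hlt]]|[[r [[s [Fs Es]] Heq]] [s' [Fs' Ps]]]]].
    + rewrite (U s Fs) in Es; fold d in Es. subst r. apply sinh_lt in Hlt.
      rewrite S in Hlt. apply Rabs_def2 in Hlt. lra.
    + rewrite (U s Fs) in Es; fold d in Es. rewrite (U s' Fs') in Ps. apply Sd in Ps.
      rewrite Rabs_pos_eq in S by lra. subst r. rewrite <- Heq. lra.
  - intros [H1 H2]; split; [now apply inD_base|].
    destruct H2 as [H2|H2].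
    + left; exists d; split; [exists t; split; auto|].
      apply sinh_lt_inv; rewrite S. apply Rabs_def1; lra.
    + right; split.
      * exists d; split; [exists t; split; auto|].
        apply sinh_inj; rewrite S, Rabs_pos_eq; lra.
      * exists t; split; auto. apply Sd; lra.
Qed.

(** * Patterns *)

Definition pattern (Gam : C * C -> Prop) (h : C * C) (rho : R) (g : C * C) : R -> Prop :=
  fun t => exists c, Gam c /\
    - sinh rho < fW (su11_inv g ** (c ** h)) <= sinh rho /\
    fU (su11_inv g ** (c ** h)) = exp (2 * t) * fV (su11_inv g ** (c ** h)).

Lemma Splus_geod (Gam : C * C -> Prop) (g h : C * C) (rho : R) :
  (forall c, Gam c -> su11 c) -> su11 g -> su11 h -> 0 < rho ->
  Splus Gam (geod g) rho (base h) = pattern Gam h rho g.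
Proof.
  intros HG Hg Hh Hr.
  apply functional_extensionality; intros t; apply propositional_extensionality.
  split; intros [c [Hc H]]; exists c; pose proof (HG c Hc) as Sc;
    pose proof (su11_closed_mul _ _ Sc Hh) as Sch; split; auto.
  - rewrite mob_base in H by auto. destruct H as [HN HF].
    apply foot_geod in HF; auto. split; auto.
    eapply Nbar_plus_geod; eauto.
  - rewrite mob_base by auto. destruct H as [HN HF]. split.
    + eapply Nbar_plus_geod; eauto.
    + now apply foot_geod.
Qed.

Lemma fuchsian_su11 (Gam : C * C -> Prop) (g : C * C) : fuchsian Gam -> Gam g -> su11 g.
Proof. intros H Hg; apply su11_Cmod; now apply H. Qed.

Lemma fuchsian_mul (Gam : C * C -> Prop) (g h : C * C) :
  fuchsian Gam -> Gam g -> Gam h -> Gam (g ** h).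
Proof. intros H; apply H. Qed.

Lemma fuchsian_inv (Gam : C * C -> Prop) (g : C * C) :
  fuchsian Gam -> Gam g -> Gam (su11_inv g).
Proof. intros H; apply H. Qed.

Lemma fuchsian_neg (Gam : C * C -> Prop) (g : C * C) : fuchsian Gam -> Gam g -> Gam (neg g).
Proof. intros H; apply H. Qed.

Lemma fuchsian_one (Gam : C * C -> Prop) : fuchsian Gam -> Gam su11_one.
Proof. intros H; apply H. Qed.

Lemma pattern_Gam (Gam : C * C -> Prop) (h g c : C * C) (rho : R) :
  fuchsian Gam -> Gam c -> pattern Gam h rho (c ** g) = pattern Gam h rho g.
Proof.
  intros HG Hc. pose proof (fuchsian_su11 _ _ HG Hc) as Sc.
  apply functional_extensionality; intros t; apply propositional_extensionality.
  split; intros [d [Hd H]].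
  - exists (su11_inv c ** d); split; [apply (fuchsian_mul Gam); auto; now apply (fuchsian_inv Gam)|].
    rewrite su11_inv_mul in H. now rewrite !su11_mul_assoc in *.
  - exists (c ** d); split; [now apply fuchsian_mul|].
    rewrite su11_inv_mul, <- !su11_mul_assoc, su11_invE by auto. auto.
Qed.

Lemma pattern_flow (Gam : C * C -> Prop) (h g : C * C) (rho v : R) :
  pattern Gam h rho (g ** flow v) = translate (pattern Gam h rho g) v.
Proof.
  apply functional_extensionality; intros t; apply propositional_extensionality.
  assert (E : forall n, fU (su11_inv (g ** flow v) ** n) =
      exp (2 * t) * fV (su11_inv (g ** flow v) ** n) <->
    fU (su11_inv g ** n) = exp (2 * (t + v)) * fV (su11_inv g ** n)).
  { intros n. rewrite su11_inv_mul, flow_inv, <- su11_mul_assoc, fU_flow, fV_flow.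
    rewrite Ropp_involutive.
    replace (exp (2 * (t + v))) with (exp (2 * t) * exp v * exp v)
      by (rewrite <- !exp_plus; f_equal; ring).
    pose proof (exp_mul_opp v). pose proof (exp_pos v).
    set (X := fU _); set (Y := fV _). split; intros K.
    - apply (Rmult_eq_reg_l (exp (- v))); [|apply Rgt_not_eq, exp_pos].
      rewrite K.
      transitivity (exp v * exp (- v) * (exp (2 * t) * exp v * Y)); [rewrite H|]; ring.
    - rewrite K.
      transitivity (exp v * exp (- v) * (exp (2 * t) * exp v * Y)); [|rewrite H]; ring. }
  unfold translate, pattern.
  split; intros [d [Hd [H1 H2]]]; exists d; split; auto; split; try (now apply E in H2);
    try now apply E.
  - now rewrite su11_inv_mul, flow_inv, <- su11_mul_assoc, fW_flow in H1.
  - now rewrite su11_inv_mul, flow_inv, <- su11_mul_assoc, fW_flow.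
Qed.

(** * Topology of the space of frames *)

(** Neighbourhoods are taken in all of R^4, where every function in use is polynomial or a
    composition with one; membership in SU(1,1) is carried as a separate premise. *)
Definition near (e : R) (g g' : C * C) : Prop :=
  Rabs (fst (fst g') - fst (fst g)) < e /\ Rabs (snd (fst g') - snd (fst g)) < e /\
  Rabs (fst (snd g') - fst (snd g)) < e /\ Rabs (snd (snd g') - snd (snd g)) < e.

Definition nbhd (g : C * C) (P : C * C -> Prop) : Prop :=
  exists e, 0 < e /\ forall g', near e g g' -> P g'.

Lemma near_le (e e' : R) (g g' : C * C) : e <= e' -> near e g g' -> near e' g g'.
Proof. unfold near; intros; intuition lra. Qed.

Lemma near_refl (e : R) (g : C * C) : 0 < e -> near e g g.
Proof. intros; unfold near; rewrite !Rminus_diag, Rabs_R0; auto. Qed.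

Lemma near_sym (e : R) (g g' : C * C) : near e g g' -> near e g' g.
Proof.
  unfold near; intros [H1 [H2 [H3 H4]]].
  rewrite Rabs_minus_sym in H1; rewrite Rabs_minus_sym in H2.
  rewrite Rabs_minus_sym in H3; rewrite Rabs_minus_sym in H4; auto.
Qed.

Lemma near_trans (e e' : R) (g g' g'' : C * C) :
  near e g g' -> near e' g' g'' -> near (e + e') g g''.
Proof.
  unfold near; intros [H1 [H2 [H3 H4]]] [K1 [K2 [K3 K4]]].
  repeat split.
  - replace (fst (fst g'') - fst (fst g)) with
      (fst (fst g') - fst (fst g) + (fst (fst g'') - fst (fst g'))) by ring.
    eapply Rle_lt_trans; [apply Rabs_triang|]; lra.
  - replace (snd (fst g'') - snd (fst g)) with
      (snd (fst g') - snd (fst g) + (snd (fst g'') - snd (fst g'))) by ring.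
    eapply Rle_lt_trans; [apply Rabs_triang|]; lra.
  - replace (fst (snd g'') - fst (snd g)) with
      (fst (snd g') - fst (snd g) + (fst (snd g'') - fst (snd g'))) by ring.
    eapply Rle_lt_trans; [apply Rabs_triang|]; lra.
  - replace (snd (snd g'') - snd (snd g)) with
      (snd (snd g') - snd (snd g) + (snd (snd g'') - snd (snd g'))) by ring.
    eapply Rle_lt_trans; [apply Rabs_triang|]; lra.
Qed.

Global Instance nbhd_filter (g : C * C) : ProperFilter (nbhd g).
Proof.
  split; [|split].
  - intros P [e [He H]]; exists g; apply H; now apply near_refl.
  - exists 1; split; [lra|auto].
  - intros P Q [e [He HP]] [f [Hf HQ]].
    exists (Rmin e f); split; [now apply Rmin_glb_lt|].
    intros g' Hg'; split; [apply HP|apply HQ]; apply (near_le (Rmin e f));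
      auto using Rmin_l, Rmin_r.
  - intros P Q HPQ [e [He HP]]; exists e; split; auto.
Qed.

Lemma nbhd_nbhd (g : C * C) (P : C * C -> Prop) :
  nbhd g P -> nbhd g (fun g' => nbhd g' P).
Proof.
  intros [e [He H]]; exists (e / 2); split; [lra|]. intros g' Hg'.
  exists (e / 2); split; [lra|]. intros g'' Hg''. apply H.
  replace e with (e / 2 + e / 2) by field. eapply near_trans; eauto.
Qed.

Lemma nbhd_all (g : C * C) (P : C * C -> Prop) : (forall g', P g') -> nbhd g P.
Proof. intros H; exists 1; split; [lra|auto]. Qed.

Lemma nbhd_and (g : C * C) (P Q : C * C -> Prop) :
  nbhd g P -> nbhd g Q -> nbhd g (fun g' => P g' /\ Q g').
Proof. apply filter_and. Qed.

Lemma nbhd_imp (g : C * C) (P Q : C * C -> Prop) :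
  (forall g', P g' -> Q g') -> nbhd g P -> nbhd g Q.
Proof. apply filter_imp. Qed.

Lemma nbhd_list {A : Type} (l : list A) (g : C * C) (P : A -> C * C -> Prop) :
  (forall a, In a l -> nbhd g (P a)) -> nbhd g (fun g' => forall a, In a l -> P a g').
Proof.
  induction l as [|a l IH]; intros H; [apply nbhd_all; intros ? ? []|].
  eapply nbhd_imp; [|apply nbhd_and; [apply (H a); now left|apply IH; intros; apply H; now right]].
  intros g' [H1 H2] b [<-|Hb]; auto.
Qed.

(** * Continuous functions of a frame *)

Definition cont (F : C * C -> R) (g : C * C) : Prop := filterlim F (nbhd g) (locally (F g)).

Lemma cont_const (a : R) (g : C * C) : cont (fun _ => a) g.
Proof. apply filterlim_const. Qed.

Lemma cont_plus (F G : C * C -> R) (g : C * C) :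
  cont F g -> cont G g -> cont (fun x => F x + G x) g.
Proof.
  intros HF HG. eapply filterlim_comp_2; [exact HF|exact HG|]. apply @filterlim_plus.
Qed.

Lemma cont_opp (F : C * C -> R) (g : C * C) : cont F g -> cont (fun x => - F x) g.
Proof. intros HF; eapply filterlim_comp; [exact HF|]. apply @filterlim_opp. Qed.

Lemma cont_minus (F G : C * C -> R) (g : C * C) :
  cont F g -> cont G g -> cont (fun x => F x - G x) g.
Proof. intros; apply cont_plus; auto using cont_opp. Qed.

Lemma cont_mult (F G : C * C -> R) (g : C * C) :
  cont F g -> cont G g -> cont (fun x => F x * G x) g.
Proof.
  intros HF HG. eapply filterlim_comp_2; [exact HF|exact HG|]. apply @filterlim_mult.
Qed.

Lemma cont_pow (F : C * C -> R) (n : nat) (g : C * C) :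
  cont F g -> cont (fun x => F x ^ n) g.
Proof. intros HF; induction n; simpl; [apply cont_const|now apply cont_mult]. Qed.

Lemma cont_comp (F : C * C -> R) (f : R -> R) (g : C * C) :
  cont F g -> continuous f (F g) -> cont (fun x => f (F x)) g.
Proof. intros HF Hf; eapply filterlim_comp; [exact HF|exact Hf]. Qed.

Lemma cont_nbhd (F : C * C -> R) (g : C * C) (P : R -> Prop) :
  cont F g -> locally (F g) P -> nbhd g (fun x => P (F x)).
Proof. intros HF HP; now apply HF. Qed.

Lemma cont_coord (g : C * C) :
  cont (fun x => fst (fst x)) g /\ cont (fun x => snd (fst x)) g /\
  cont (fun x => fst (snd x)) g /\ cont (fun x => snd (snd x)) g.
Proof.
  repeat split; intros P [e He]; exists e; (split; [apply cond_pos|]); intros g' Hg';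
    apply He; apply Hg'.
Qed.

Lemma cont_lt (F : C * C -> R) (g : C * C) (c : R) :
  cont F g -> F g < c -> nbhd g (fun x => F x < c).
Proof. intros HF H; apply (cont_nbhd F g (fun y => y < c)); auto. now apply open_lt. Qed.

Lemma cont_gt (F : C * C -> R) (g : C * C) (c : R) :
  cont F g -> c < F g -> nbhd g (fun x => c < F x).
Proof. intros HF H; apply (cont_nbhd F g (fun y => c < y)); auto. now apply open_gt. Qed.

Ltac solve_cont :=
  repeat first [ simple apply cont_const | simple apply cont_plus | simple apply cont_minus
    | simple apply cont_mult | simple apply cont_opp | simple apply cont_pow
    | match goal with |- cont _ ?g => apply (cont_coord g) end ].

Ltac cont_unfold :=
  unfold fU, fV, fW, su11_mul, su11_inv, Cmult, Cplus, Cconj, Copp; cbn [fst snd]; solve_cont.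

Lemma cont_fU_inv (n g : C * C) : cont (fun x => fU (su11_inv x ** n)) g.
Proof. cont_unfold. Qed.

Lemma cont_fV_inv (n g : C * C) : cont (fun x => fV (su11_inv x ** n)) g.
Proof. cont_unfold. Qed.

Lemma cont_fW_inv (n g : C * C) : cont (fun x => fW (su11_inv x ** n)) g.
Proof. cont_unfold. Qed.

(** * Matrix norm, compactness and discreteness *)

Definition size (g : C * C) : R := fU g + fV g.

(** The squared Frobenius norm of the 2x2 matrix, hence submultiplicative; on SU(1,1) it is also
    2X0, that is, 2 cosh of the distance from 0 to the base point. *)
Lemma sizeE (g : C * C) : size g =
  2 * (fst (fst g) ^ 2 + snd (fst g) ^ 2 + fst (snd g) ^ 2 + snd (snd g) ^ 2).
Proof. unfold size, fU, fV; ring. Qed.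

Lemma cont_size (g : C * C) : cont size g.
Proof. unfold size; cont_unfold. Qed.

Lemma size_inv (g : C * C) : size (su11_inv g) = size g.
Proof. rewrite !sizeE; destruct g as [[a1 a2] [b1 b2]]; simpl; ring. Qed.

Lemma size_mul (g h : C * C) : size (g ** h) <= size g * size h.
Proof.
  rewrite !sizeE; destruct g as [[a1 a2] [b1 b2]], h as [[c1 c2] [d1 d2]]; mat_unfold.
  pose proof (pow2_ge_0 (a1 * c1 - a2 * c2 - (b1 * d1 + b2 * d2))).
  pose proof (pow2_ge_0 (a1 * c2 + a2 * c1 - (b2 * d1 - b1 * d2))).
  pose proof (pow2_ge_0 (a1 * d1 - a2 * d2 - (b1 * c1 + b2 * c2))).
  pose proof (pow2_ge_0 (a1 * d2 + a2 * d1 - (b2 * c1 - b1 * c2))).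
  lra.
Qed.

Lemma size_pos (g : C * C) : 0 <= size g.
Proof.
  rewrite sizeE. pose proof (pow2_ge_0 (fst (fst g))); pose proof (pow2_ge_0 (snd (fst g))).
  pose proof (pow2_ge_0 (fst (snd g))); pose proof (pow2_ge_0 (snd (snd g))). lra.
Qed.

Lemma size_coord (g : C * C) (M : R) : 0 <= M -> size g <= 2 * M ^ 2 ->
  - M <= fst (fst g) <= M /\ - M <= snd (fst g) <= M /\
  - M <= fst (snd g) <= M /\ - M <= snd (snd g) <= M.
Proof. rewrite sizeE; intros; repeat split; nra. Qed.

Lemma size_flow (t : R) : size (flow t) = 2 * cosh t.
Proof. unfold size; rewrite fU_of_flow, fV_of_flow; unfold cosh; field. Qed.

(** Heine-Borel in a box of R^4, with radii depending on the centre. The centres may lie off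
    SU(1,1). *)
Lemma size_compact (M : R) (d : C * C -> R) : (forall g, 0 < d g) ->
  exists l : list (C * C), forall g, size g <= M -> exists c, In c l /\ near (d c) c g.
Proof.
  intros Hd.
  set (N := M ^ 2 + 1).
  assert (HN : 0 <= N /\ M <= 2 * N ^ 2) by (unfold N; nra).
  set (tomat := fun x : Compactness.Tn 4 R =>
    let '(a, (b, (c, (e, _)))) := x in (((a, b), (c, e)) : C * C)).
  set (lo := (- N, (- N, (- N, (- N, tt)))) : Compactness.Tn 4 R).
  set (hi := (N, (N, (N, (N, tt)))) : Compactness.Tn 4 R).
  (* [compactness_list] yields the finite subcover under a double negation. *)
  destruct (NNPP _ (compactness_list 4 lo hi (fun x => mkposreal _ (Hd (tomat x))))) as [l Hl].
  exists (map tomat l). intros g Hg.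
  destruct (size_coord g N (proj1 HN)) as [C1 [C2 [C3 C4]]]; [lra|].
  destruct g as [[a b] [c e]].
  destruct (Hl (a, (b, (c, (e, tt))))) as [t [T1 [_ T2]]].
  { simpl in *; auto. }
  exists (tomat t); split; [now apply in_map|].
  destruct t as [a' [b' [c' [e' []]]]]. unfold near; simpl in *; tauto.
Qed.

(** g^(-1) g' - 1 = g^(-1) (g' - g): each entry is a sum of four products of an entry a of g, with
    |a| <= a^2 + 1, and a difference below e. *)
Lemma near_su11_bound (e : R) (g g' : C * C) : 0 <= e ->
  near e g g' -> su11 g ->
  let m := su11_inv g ** g' in
  Rabs (fst (fst m) - 1) <= 4 * e * size g + 4 * e /\
  Rabs (snd (fst m)) <= 4 * e * size g + 4 * e /\
  Rabs (fst (snd m)) <= 4 * e * size g + 4 * e /\ Rabs (snd (snd m)) <= 4 * e * size g + 4 * e.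
Proof.
  intros He [H1 [H2 [H3 H4]]] Hg. destruct g as [[a1 a2] [b1 b2]], g' as [[c1 c2] [d1 d2]].
  rewrite sizeE. mat_unfold.
  set (x1 := c1 - a1) in *; set (x2 := c2 - a2) in *.
  set (x3 := d1 - b1) in *; set (x4 := d2 - b2) in *.
  replace c1 with (a1 + x1) by (unfold x1; ring). replace c2 with (a2 + x2) by (unfold x2; ring).
  replace d1 with (b1 + x3) by (unfold x3; ring). replace d2 with (b2 + x4) by (unfold x4; ring).
  apply Rabs_def2 in H1; apply Rabs_def2 in H2; apply Rabs_def2 in H3; apply Rabs_def2 in H4.
  assert (B : forall a x, - e < x < e -> - (e * (a ^ 2 + 1)) <= a * x <= e * (a ^ 2 + 1)).
  { intros a x Hx. assert (- (a ^ 2 + 1) <= a <= a ^ 2 + 1) by nra.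
    destruct (Rle_lt_dec 0 a); split; nra. }
  assert (I1 : - e < x1 < e) by lra. assert (I2 : - e < x2 < e) by lra.
  assert (I3 : - e < x3 < e) by lra. assert (I4 : - e < x4 < e) by lra.
  pose proof (B a1 x1 I1); pose proof (B a1 x2 I2); pose proof (B a1 x3 I3); pose proof (B a1 x4 I4).
  pose proof (B a2 x1 I1); pose proof (B a2 x2 I2); pose proof (B a2 x3 I3); pose proof (B a2 x4 I4).
  pose proof (B b1 x1 I1); pose proof (B b1 x2 I2); pose proof (B b1 x3 I3); pose proof (B b1 x4 I4).
  pose proof (B b2 x1 I1); pose proof (B b2 x2 I2); pose proof (B b2 x3 I3); pose proof (B b2 x4 I4).
  pose proof (pow2_ge_0 a1); pose proof (pow2_ge_0 a2); pose proof (pow2_ge_0 b1).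
  pose proof (pow2_ge_0 b2).
  assert (0 <= e * a1 ^ 2) by nra. assert (0 <= e * a2 ^ 2) by nra.
  assert (0 <= e * b1 ^ 2) by nra. assert (0 <= e * b2 ^ 2) by nra.
  repeat split; apply Rabs_le; simpl in *; lra.
Qed.

Lemma Cmod_le_coords (z : C) (b : R) : Rabs (fst z) <= b -> Rabs (snd z) <= b -> Cmod z <= 2 * b.
Proof.
  intros H1 H2. pose proof (Rabs_pos (fst z)). pose proof (Rabs_pos (snd z)).
  apply Rsqr_incr_0; [|apply Cmod_ge_0|lra].
  rewrite Rsqr_pow2, Cmod_sqr, <- (pow2_abs (fst z)), <- (pow2_abs (snd z)).
  unfold Rsqr; nra.
Qed.

(** Discreteness is given at the identity only. Two elements g, g' in one small ball have g^(-1) g'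
    near 1, hence coincide; finitely many such balls cover the bounded set, and one element is
    picked from each. *)
Lemma fuchsian_finite (Gam : C * C -> Prop) (M : R) : fuchsian Gam ->
  exists l : list (C * C), forall g, Gam g -> size g <= M -> In g l.
Proof.
  intros HG. pose proof HG as [_ [_ [_ [_ [_ [eps [He Hdisc]]]]]]].
  assert (HM : 0 <= Rabs M) by apply Rabs_pos.
  (* Two elements of a d-ball are 2d apart, which bounds the coordinates of g^(-1) g' - 1 by 8d(size
     g + 1) <= 8 eps/20; passing to [Cmod] costs another factor 2. *)
  set (d := eps / (20 * (Rabs M + 1))).
  assert (Hd : 0 < d) by (apply Rdiv_lt_0_compat; nra).
  destruct (size_compact M (fun _ => d) (fun _ => Hd)) as [l Hl].
  assert (Uq : forall c g g', Gam g -> Gam g' -> size g <= M -> near d c g -> near d c g' ->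
    g = g').
  { intros c g g' Hg Hg' Hs N1 N2.
    pose proof (fuchsian_su11 _ _ HG Hg) as Sg.
    apply near_sym in N1. pose proof (near_trans _ _ _ _ _ N1 N2) as N3.
    destruct (near_su11_bound (d + d) g g' ltac:(lra) N3 Sg) as [B1 [B2 [B3 B4]]].
    pose proof (fuchsian_mul Gam _ _ HG (fuchsian_inv Gam _ HG Hg) Hg') as Hm.
    set (m := su11_inv g ** g') in *.
    assert (Q : 4 * (d + d) * size g + 4 * (d + d) <= eps * (8 / 20)).
    { pose proof (Rle_abs M).
      assert (E : d * (Rabs M + 1) = eps / 20) by (unfold d; field; lra).
      assert (d * size g <= d * Rabs M) by (apply Rmult_le_compat_l; lra). lra. }
    assert (Em : m = su11_one).
    { apply (Hdisc m Hm).
      - eapply Rle_lt_trans; [apply Cmod_le_coords with (b := eps * (8 / 20))|lra].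
        + exact (Rle_trans _ _ _ B1 Q).
        + simpl; rewrite Ropp_0, Rplus_0_r; exact (Rle_trans _ _ _ B2 Q).
      - eapply Rle_lt_trans; [apply Cmod_le_coords with (b := eps * (8 / 20))|]; lra. }
    rewrite <- (su11_invE' g g') by auto. fold m. rewrite Em, su11_mul_1_r; auto. }
  (* For a ball that contains no such element the choice is arbitrary; a surplus list entry does no
     harm. *)
  set (pick := fun c => epsilon (inhabits su11_one) (fun g => Gam g /\ size g <= M /\ near d c g)).
  exists (map pick l). intros g Hg Hs. destruct (Hl g Hs) as [c [Hc Nc]].
  assert (P : Gam (pick c) /\ size (pick c) <= M /\ near d c (pick c)).
  { unfold pick; apply epsilon_spec; exists g; auto. }
  replace g with (pick c); [now apply in_map|]. apply (Uq c); tauto.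
Qed.

(** * Relative density and uniform discreteness *)

Lemma foot_exists (m : C * C) : su11 m -> exists s, fU m = exp (2 * s) * fV m.
Proof.
  intros Hm. pose proof (fU_pos m Hm); pose proof (fV_pos m Hm).
  exists (ln (fU m / fV m) / 2).
  replace (2 * (ln (fU m / fV m) / 2)) with (ln (fU m / fV m)) by field.
  rewrite exp_ln; [field; lra|now apply Rdiv_lt_0_compat].
Qed.

(** Fermi coordinates along the geodesic: s is the foot and k = cosh w for the signed distance w. *)
Lemma polar (m : C * C) (s : R) : su11 m -> fU m = exp (2 * s) * fV m ->
  exists k, 1 <= k /\ fU m = exp s * k /\ fV m = exp (- s) * k /\ k ^ 2 = 1 + fW m ^ 2.
Proof.
  intros Hm H. pose proof (fV_pos m Hm). pose proof (fUV m Hm) as UV.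
  pose proof (exp_pos s). pose proof (exp_mul_opp s) as E.
  replace (exp (2 * s)) with (exp s * exp s) in H by (rewrite <- exp_plus; f_equal; ring).
  exists (exp s * fV m). rewrite H in UV.
  assert (K : (exp s * fV m) ^ 2 = 1 + fW m ^ 2) by (rewrite <- UV; ring).
  assert (0 < exp s * fV m) by nra. pose proof (pow2_ge_0 (fW m)).
  repeat split; auto.
  - nra.
  - rewrite H; ring.
  - transitivity (exp s * exp (- s) * fV m); [rewrite E|]; ring.
Qed.

Lemma list_upper_bound {A : Type} (f : A -> R) (l : list A) :
  exists L, forall a, In a l -> f a <= L.
Proof.
  induction l as [|a l [L HL]]; [exists 0; intros ? []|].
  exists (Rmax (f a) L). intros b [<-|Hb]; [apply Rmax_l|].
  eapply Rle_trans; [apply HL; auto|apply Rmax_r].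
Qed.

Lemma size_base (g : C * C) (r : R) : su11 g -> r < 1 -> Cmod (base g) <= r ->
  size g <= 4 / (1 - r ^ 2).
Proof.
  intros Hg Hr H. pose proof (su11_fst_neq0 _ Hg) as Ha.
  pose proof (Cmod_ge_0 (base g)).
  rewrite baseE, Cmod_div, Cmod_conj in * by now apply Cconj_neq0.
  apply Cmod_gt_0 in Ha. apply Rle_div_l in H; [|auto].
  apply su11_Cmod in Hg. rewrite sizeE.
  pose proof (Cmod_sqr (fst g)) as E1. pose proof (Cmod_sqr (snd g)) as E2.
  pose proof (Cmod_ge_0 (snd g)).
  assert (0 <= r) by nra.
  apply (Rle_div_r _ 4 (1 - r ^ 2)); [nra|].
  assert (Cmod (snd g) ^ 2 <= r ^ 2 * Cmod (fst g) ^ 2) by nra.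
  replace (2 * (fst (fst g) ^ 2 + snd (fst g) ^ 2 + fst (snd g) ^ 2 + snd (snd g) ^ 2))
    with (4 * Cmod (fst g) ^ 2 - 2) by lra.
  assert (Cmod (fst g) ^ 2 * (1 - r ^ 2) <= 1) by lra. assert (0 < 1 - r ^ 2) by nra. lra.
Qed.

(** A frame based in the bounded polygon has bounded size, since the size depends on the base point
    only. *)
Lemma reduce_frame (Gam : C * C -> Prop) (tau : C -> Prop) :
  fuchsian Gam -> hyp_polygon tau -> fundamental_domain Gam tau ->
  exists M, forall g, su11 g -> exists c, Gam c /\ size (c ** g) <= M.
Proof.
  intros HG [L [_ [_ [r [Hr Hb]]]]] [Hf _].
  exists (4 / (1 - r ^ 2)). intros g Hg.
  destruct (Hf (base g) (inD_base g Hg)) as [c [Hc Ht]].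
  pose proof (fuchsian_su11 _ _ HG Hc). exists c; split; auto.
  rewrite mob_base in Ht by auto. apply size_base; auto. now apply su11_closed_mul.
Qed.

Lemma choice {A B : Type} (P : A -> B -> Prop) :
  (forall x, exists y, P x y) -> exists f, forall x, P x (f x).
Proof.
  intros H. exists (fun x => proj1_sig (constructive_indefinite_description _ (H x))).
  intros x; apply proj2_sig.
Qed.

(** Being closer than rho to a fixed orbit point at a fixed time is an open condition on the frame.
    Finitely many pairs of a time and an orbit point therefore serve all frames of bounded size, and
    translation by Gamma covers the rest. *)
Lemma uniform_hit (Gam : C * C -> Prop) (tau : C -> Prop) (h : C * C) (rho : R) :
  fuchsian Gam -> hyp_polygon tau -> fundamental_domain Gam tau -> su11 h -> 0 < rho ->
  (forall k, geodesic k -> exists t g, Gam g /\ hdist (k t) (mob g (base h)) < rho) ->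
  exists L, forall g, su11 g -> exists t c, Rabs t <= L /\ Gam c /\
    exp (- t) * fU (su11_inv g ** (c ** h)) + exp t * fV (su11_inv g ** (c ** h)) <
    2 * cosh rho.
Proof.
  intros HG Hp Hf Hh Hrho Hhit.
  set (F := fun t c g => exp (- t) * fU (su11_inv g ** (c ** h)) +
    exp t * fV (su11_inv g ** (c ** h))).
  assert (HF : forall t c g, cont (F t c) g).
  { intros; unfold F. apply cont_plus; apply cont_mult;
      auto using cont_const, cont_fU_inv, cont_fV_inv. }
  set (det := fun g : C * C =>
    fst (fst g) ^ 2 + snd (fst g) ^ 2 - fst (snd g) ^ 2 - snd (snd g) ^ 2).
  assert (loc : forall g, exists p : R * R, 0 < fst p /\
    exists c, Gam c /\ forall g', near (fst p) g g' -> su11 g' -> F (snd p) c g' < 2 * cosh rho).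
  { intros g. destruct (classic (su11 g)) as [Hg|Hg].
    - destruct (Hhit _ (geod_geodesic g Hg)) as [t [c [Hc Hd]]].
      pose proof (fuchsian_su11 _ _ HG Hc) as Sc.
      pose proof (su11_closed_mul _ _ Sc Hh) as Sch.
      rewrite mob_base in Hd by auto.
      assert (Ht : su11 (g ** flow t)) by (apply su11_closed_mul; auto using flow_su11).
      assert (HL : F t c g < 2 * cosh rho).
      { unfold geod in Hd. destruct (hdist_base _ _ Ht Sch) as [P E].
        apply cosh_lt in Hd; auto.
        rewrite su11_inv_mul, flow_inv, <- su11_mul_assoc, fU_flow, fV_flow in E.
        rewrite Ropp_involutive in E. unfold F; lra. }
      destruct (cont_lt _ _ _ (HF t c g) HL) as [d [Hd0 Hn]].
      exists (d, t); split; auto. exists c; auto.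
    (* A centre off SU(1,1) gets a ball that misses SU(1,1), where the claim is vacuous. *)
    - assert (Cd : cont det g) by (unfold det; solve_cont).
      destruct (cont_nbhd _ _ (fun y => y <> 1) Cd) as [d [Hd0 Hn]].
      { apply (open_neq 1). exact Hg. }
      exists (d, 0); split; auto. exists su11_one; split; [now apply fuchsian_one|].
      intros g' N1 N2. exfalso. now apply (Hn g' N1). }
  apply choice in loc. destruct loc as [p Hp'].
  destruct (reduce_frame Gam tau HG Hp Hf) as [M HM].
  destruct (size_compact M (fun g => fst (p g)) (fun g => proj1 (Hp' g))) as [l Hl].
  destruct (list_upper_bound (fun g => Rabs (snd (p g))) l) as [L HL].
  exists L. intros g Hg.
  destruct (HM g Hg) as [a [Ha Hs]]. pose proof (fuchsian_su11 _ _ HG Ha) as Sa.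
  destruct (Hl _ Hs) as [b [Hb Hn]].
  destruct (Hp' b) as [_ [c [Hc HFc]]].
  exists (snd (p b)), (su11_inv a ** c). split; [now apply HL|]. split.
  - apply (fuchsian_mul Gam); auto. now apply (fuchsian_inv Gam).
  - specialize (HFc _ Hn (su11_closed_mul _ _ Sa Hg)). unfold F in HFc.
    rewrite su11_inv_mul in HFc. now rewrite <- !su11_mul_assoc in *.
Qed.

(** Hyperbolic Pythagoras: the distance d from the orbit point to time t satisfies cosh d = cosh w
    cosh(s - t). Both factors are at least 1, so d < rho gives |w| < rho and |s - t| < rho; the
    second term of L + rho comes from the latter. *)
Lemma pattern_relatively_dense (Gam : C * C -> Prop) (h g : C * C) (rho L : R) :
  fuchsian Gam -> su11 h -> su11 g -> 0 < rho ->
  (forall g, su11 g -> exists t c, Rabs t <= L /\ Gam c /\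
    exp (- t) * fU (su11_inv g ** (c ** h)) + exp t * fV (su11_inv g ** (c ** h)) <
    2 * cosh rho) ->
  forall y, exists s, pattern Gam h rho g s /\ Rabs (y - s) <= L + rho.
Proof.
  intros HG Hh Hg Hrho H y.
  assert (Sg : su11 (g ** flow y)) by (apply su11_closed_mul; auto using flow_su11).
  destruct (H _ Sg) as [t [c [Ht [Hc Hlt]]]].
  pose proof (fuchsian_su11 _ _ HG Hc) as Sc.
  assert (Sm : su11 (su11_inv (g ** flow y) ** (c ** h))).
  { repeat apply su11_closed_mul; auto. now apply su11_closed_inv. }
  destruct (foot_exists _ Sm) as [s Hs].
  destruct (polar _ s Sm Hs) as [k [Hk [EU [EV EW]]]].
  rewrite EU, EV in Hlt.
  replace (exp (- t) * (exp s * k) + exp t * (exp (- s) * k)) with (2 * (k * cosh (s - t))) in Hlt.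
  2:{ unfold cosh. replace (s - t) with (- t + s) by ring.
      replace (- (- t + s)) with (t + - s) by ring. rewrite !exp_plus. field. }
  pose proof (cosh_ge_1 (s - t)) as C1.
  assert (C2 : cosh (s - t) < cosh rho) by nra. apply cosh_lt_inv in C2; [|lra].
  assert (C3 : k < cosh rho) by nra.
  pose proof (cosh_sinh rho) as CS. pose proof (sinh_pos rho Hrho).
  assert (fW (su11_inv (g ** flow y) ** (c ** h)) ^ 2 < sinh rho ^ 2) by nra.
  exists (s + y). split.
  - change (translate (pattern Gam h rho g) y s). rewrite <- pattern_flow.
    exists c; repeat split; auto; nra.
  - replace (y - (s + y)) with (- s) by ring. rewrite Rabs_Ropp.
    replace s with (t + (s - t)) by ring. eapply Rle_trans; [apply Rabs_triang|]. lra.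
Qed.

Lemma inj_lower (Gam : C * C -> Prop) (h : C * C) (rho : R) :
  Rbar_lt (Finite rho) (inj Gam (base h)) ->
  exists i, rho < i /\ forall c d, Gam c -> Gam d -> mob c (base h) <> mob d (base h) ->
    2 * i <= hdist (mob c (base h)) (mob d (base h)).
Proof.
  unfold inj. set (E := fun r => _). pose proof (Glb_Rbar_correct E) as [Hlb _].
  assert (HE : forall c d, Gam c -> Gam d -> mob c (base h) <> mob d (base h) ->
    Rbar_le (Glb_Rbar E) (hdist (mob c (base h)) (mob d (base h)))).
  { intros c d Hc Hd Hn; apply Hlb; exists c, d; auto. }
  destruct (Glb_Rbar E) as [i| |]; intros H.
  - exists (/ 2 * i). simpl in H; split; auto. intros c d Hc Hd Hn.
    specialize (HE c d Hc Hd Hn). simpl in HE. lra.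
  (* The infimum is infinite only if no two orbit points differ; any bound above rho will do. *)
  - exists (rho + 1); split; [lra|]. intros c d Hc Hd Hn. destruct (HE c d Hc Hd Hn).
  - exfalso. unfold Rbar_mult, Rbar_mult' in H.
    destruct (Rle_dec 0 (/ 2)) as [Hle|]; [|lra].
    destruct (Rle_lt_or_eq_dec 0 (/ 2) Hle); simpl in H; lra.
Qed.

(* With signed distances u, v of two orbit points from the geodesic and feet at distance D,
   cosh d = cosh u cosh v cosh D - sinh u sinh v <= cosh^2 rho cosh D + sinh^2 rho, while
   d >= 2i > 2 rho. *)
Lemma pattern_separated (Gam : C * C -> Prop) (h g : C * C) (rho : R) :
  fuchsian Gam -> su11 h -> su11 g -> 0 < rho ->
  Rbar_lt (Finite rho) (inj Gam (base h)) ->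
  exists delta, 0 < delta /\ forall s s', pattern Gam h rho g s -> pattern Gam h rho g s' ->
    s <> s' -> delta <= Rabs (s - s').
Proof.
  intros HG Hh Hg Hrho Hinj.
  destruct (inj_lower _ _ _ Hinj) as [i [Hi Hsep]].
  (* The distance comparison solved for cosh D gives cosh D >= [q]; and [q] > 1 because cosh(2 rho)
     = cosh^2 rho + sinh^2 rho < cosh(2i). *)
  set (q := (cosh (2 * i) - sinh rho ^ 2) / cosh rho ^ 2).
  pose proof (cosh_sinh rho) as CS. pose proof (cosh_ge_1 rho) as CR.
  pose proof (sinh_pos rho Hrho) as SR.
  assert (Hq : 1 < q).
  { unfold q. apply Rlt_div_r; [nra|].
    assert (cosh (2 * rho) < cosh (2 * i)) by (apply cosh_lt; lra).
    replace (2 * rho) with (rho + rho) in * by ring. rewrite cosh_plus in *. nra. }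
  destruct (cosh_exists q Hq) as [delta [Hd Ed]].
  exists delta; split; auto.
  intros s s' [c [Hc [Wc Fc]]] [c' [Hc' [Wc' Fc']]] Hss.
  pose proof (fuchsian_su11 _ _ HG Hc) as Sc. pose proof (fuchsian_su11 _ _ HG Hc') as Sc'.
  assert (Sch : su11 (c ** h)) by now apply su11_closed_mul.
  assert (Sch' : su11 (c' ** h)) by now apply su11_closed_mul.
  pose proof (su11_closed_mul _ _ (su11_closed_inv _ Hg) Sch) as Sm.
  pose proof (su11_closed_mul _ _ (su11_closed_inv _ Hg) Sch') as Sm'.
  destruct (polar _ s Sm Fc) as [k [Hk [EU [EV EW]]]].
  destruct (polar _ s' Sm' Fc') as [k' [Hk' [EU' [EV' EW']]]].
  destruct (hdist_base _ _ Sch Sch') as [P E].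
  replace (su11_inv (c ** h) ** (c' ** h)) with
    (su11_inv (su11_inv g ** (c ** h)) ** (su11_inv g ** (c' ** h))) in E.
  2:{ rewrite su11_inv_mul, su11_inv_inv, <- su11_mul_assoc.
      now rewrite su11_invE'. }
  rewrite minkowski, EU, EV, EU', EV' in E by auto.
  set (w := fW (su11_inv g ** (c ** h))) in *. set (w' := fW (su11_inv g ** (c' ** h))) in *.
  replace (exp s * k * (exp (- s') * k') + exp (- s) * k * (exp s' * k')) with
    (2 * (k * k' * cosh (s - s'))) in E.
  2:{ unfold cosh. unfold Rminus. replace (- (s + - s')) with (- s + s') by ring.
      rewrite !exp_plus. field. }
  assert (EC : cosh (hdist (base (c ** h)) (base (c' ** h))) = k * k' * cosh (s - s') - w * w')
    by lra.
  assert (W2 : w ^ 2 <= sinh rho ^ 2) by nra. assert (W2' : w' ^ 2 <= sinh rho ^ 2) by nra.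
  assert (K : k <= cosh rho) by nra. assert (K' : k' <= cosh rho) by nra.
  assert (Hne : mob c (base h) <> mob c' (base h)).
  { rewrite !mob_base by auto. intros Eb.
    pose proof (foot_geod g (c ** h) s Hg Sch) as F1.
    pose proof (foot_geod g (c' ** h) s Hg Sch') as F3.
    rewrite Eb in F1. apply F1 in Fc. apply F3 in Fc. rewrite Fc' in Fc.
    apply exp_double_inj in Fc; [now apply Hss|now apply fV_pos]. }
  specialize (Hsep c c' Hc Hc' Hne). rewrite !mob_base in Hsep by auto.
  apply cosh_le in Hsep; [|lra]. rewrite EC in Hsep.
  pose proof (cosh_ge_1 (s - s')) as C1.
  assert (k * k' <= cosh rho ^ 2) by nra.
  assert (k * k' * cosh (s - s') <= cosh rho ^ 2 * cosh (s - s')) by nra.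
  assert (- (w * w') <= sinh rho ^ 2) by nra.
  assert (Q : q <= cosh (s - s')).
  { unfold q; apply Rle_div_l; [nra|]. lra. }
  rewrite <- Ed, <- (cosh_Rabs (s - s')) in Q.
  destruct (Rle_lt_dec delta (Rabs (s - s'))) as [|L]; auto.
  apply cosh_lt in L; [|apply Rabs_pos]. lra.
Qed.

(** * Stability of patterns *)

(** Translation by e along the imaginary axis, the perpendicular at time 0, towards the positive
    side. *)
Definition push (e : R) : C * C := (RtoC (cosh (e / 2)), (0, sinh (e / 2))).

Lemma push_su11 (e : R) : su11 (push e).
Proof. unfold su11, push; simpl. pose proof (cosh_sinh (e / 2)); nra. Qed.

Lemma fW_push (g n : C * C) (e : R) :
  fW (su11_inv (g ** push e) ** n) =
  fW (su11_inv g ** n) * cosh e - size (su11_inv g ** n) / 2 * sinh e.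
Proof.
  rewrite su11_inv_mul, <- su11_mul_assoc. set (m := su11_inv g ** n). clearbody m.
  rewrite sizeE. replace e with (e / 2 + e / 2) at 2 3 by field.
  rewrite cosh_plus, sinh_plus. destruct m as [[a1 a2] [b1 b2]].
  unfold push. set (c := cosh (e / 2)); set (s := sinh (e / 2)). mat_unfold. field.
Qed.

(** The push is a boost X2 -> X2 cosh e - X0 sinh e. Here X0 > |X2| and sinh e > cosh e - 1, so the
    decrease is strict for every point and every e > 0. *)
Lemma fW_push_lt (g n : C * C) (e : R) : su11 g -> su11 n -> 0 < e ->
  fW (su11_inv (g ** push e) ** n) < fW (su11_inv g ** n).
Proof.
  intros Hg Hn He. rewrite fW_push.
  pose proof (su11_closed_mul _ _ (su11_closed_inv _ Hg) Hn) as Hm.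
  set (m := su11_inv g ** n) in *.
  pose proof (fU_pos m Hm). pose proof (fV_pos m Hm). pose proof (fUV m Hm) as UV.
  pose proof (sinh_pos e He). pose proof (cosh_ge_1 e).
  assert (cosh e - 1 < sinh e).
  { unfold cosh, sinh. assert (exp (- e) < 1) by (rewrite <- exp_0; apply exp_increasing; lra). lra. }
  unfold size. set (W := fW m) in *. set (X0 := (fU m + fV m) / 2).
  assert (HU : fU m + fV m = 2 * X0) by (unfold X0; field).
  assert (1 + W ^ 2 <= X0 ^ 2) by (rewrite <- UV; unfold X0; pose proof (pow2_ge_0 (fU m - fV m)); lra).
  assert (0 < X0) by lra. assert (W < X0) by nra.
  destruct (Rle_lt_dec W 0); nra.
Qed.

Lemma nbhd_push (g : C * C) (P : C * C -> Prop) : nbhd g P ->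
  exists e0, 0 < e0 /\ forall e, 0 < e < e0 -> nbhd (g ** push e) P.
Proof.
  intros HP. apply nbhd_nbhd in HP. destruct HP as [d [Hd HP]].
  assert (L : forall p q, locally 0 (fun e => Rabs (p * cosh (e / 2) + q * sinh (e / 2) - p) < d)).
  { intros p q.
    assert (Cn : continuous (fun e => p * cosh (e / 2) + q * sinh (e / 2) - p) 0).
    { apply (@ex_derive_continuous R_AbsRing R_NormedModule).
      unfold cosh, sinh; auto_derive; auto. }
    apply (Cn (fun y => Rabs y < d)).
    replace (0 / 2) with 0 by field. rewrite cosh_0, sinh_0.
    replace (p * 1 + q * 0 - p) with 0 by ring.
    exists (mkposreal d Hd). intros y Hy. unfold ball in Hy; simpl in Hy.
    unfold AbsRing_ball, abs, minus, plus, opp in Hy; simpl in Hy.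
    now rewrite Ropp_0, Rplus_0_r in Hy. }
  destruct g as [[a1 a2] [b1 b2]].
  destruct (filter_and _ _ (filter_and _ _ (L a1 b2) (L a2 (- b1)))
    (filter_and _ _ (L b1 (- a2)) (L b2 a1))) as [e0 He].
  exists e0; split; [apply cond_pos|]. intros e He'. apply HP.
  destruct (He e) as [[H1 H2] [H3 H4]].
  { unfold ball; simpl; unfold AbsRing_ball, abs, minus, plus, opp; simpl.
    rewrite Ropp_0, Rplus_0_r, Rabs_pos_eq; lra. }
  unfold near, push; mat_unfold. repeat split.
  - eapply Rle_lt_trans; [|exact H1]. right; f_equal; ring.
  - eapply Rle_lt_trans; [|exact H2]. right; f_equal; ring.
  - eapply Rle_lt_trans; [|exact H3]. right; f_equal; ring.
  - eapply Rle_lt_trans; [|exact H4]. right; f_equal; ring.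
Qed.

Lemma small_list {A : Type} (l : list A) (Q : A -> R -> Prop) :
  (forall a, In a l -> exists e0, 0 < e0 /\ forall e, 0 < e < e0 -> Q a e) ->
  exists e0, 0 < e0 /\ forall e, 0 < e < e0 -> forall a, In a l -> Q a e.
Proof.
  induction l as [|a l IH]; intros H.
  - exists 1; split; [lra|intros ? ? ? []].
  - destruct IH as [e1 [H1 K1]]; [intros; apply H; now right|].
    destruct (H a) as [e2 [H2 K2]]; [now left|].
    exists (Rmin e1 e2); split; [now apply Rmin_glb_lt|].
    intros e He b Hb. pose proof (Rmin_l e1 e2); pose proof (Rmin_r e1 e2).
    destruct Hb as [<-|Hb]; [apply K2|apply K1]; auto; lra.
Qed.

Lemma foot_near (g n : C * C) (r : R) : su11 g -> su11 n -> 0 < r ->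
  nbhd g (fun g' => forall s s', fU (su11_inv g ** n) = exp (2 * s) * fV (su11_inv g ** n) ->
    fU (su11_inv g' ** n) = exp (2 * s') * fV (su11_inv g' ** n) -> Rabs (s - s') < r).
Proof.
  intros Hg Hn Hr.
  pose proof (su11_closed_mul _ _ (su11_closed_inv _ Hg) Hn) as Hm.
  pose proof (fU_pos _ Hm) as PU. pose proof (fV_pos _ Hm) as PV.
  set (f := fun x => ln (fU (su11_inv x ** n)) - ln (fV (su11_inv x ** n))).
  assert (Cf : cont f g).
  { unfold f; apply cont_minus.
    - apply (cont_comp (fun x => fU (su11_inv x ** n)) ln); [apply cont_fU_inv|].
      now apply continuous_ln.
    - apply (cont_comp (fun x => fV (su11_inv x ** n)) ln); [apply cont_fV_inv|].
      now apply continuous_ln. }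
  pose proof (cont_gt _ _ _ (cont_fU_inv n g) PU) as N1.
  pose proof (cont_gt _ _ _ (cont_fV_inv n g) PV) as N2.
  assert (N3 : nbhd g (fun x => f x < f g + r)) by (apply cont_lt; auto; lra).
  assert (N4 : nbhd g (fun x => f g - r < f x)) by (apply cont_gt; auto; lra).
  eapply nbhd_imp; [|apply nbhd_and; [apply nbhd_and; [exact N1|exact N2]|
    apply nbhd_and; [exact N3|exact N4]]].
  intros g' [[K1 K2] [K3 K4]] s s' E E'.
  assert (S : forall u v t, 0 < v -> u = exp (2 * t) * v -> 2 * t = ln u - ln v).
  { intros u v t Hv ->. rewrite ln_mult, ln_exp by (auto using exp_pos). ring. }
  pose proof (S _ _ s PV E) as S1. pose proof (S _ _ s' K2 E') as S2.
  unfold f in *. apply Rabs_def1; lra.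
Qed.

(* Pushing the geodesic to its positive side lowers the signed distance of every orbit
   point strictly, so that the points at signed distance [rho] (counted) and [-rho]
   (not counted) keep their status. *)
Lemma status_push (g n : C * C) (sg : R) : su11 g -> su11 n -> 0 < sg ->
  exists e0, 0 < e0 /\ forall e, 0 < e < e0 -> nbhd (g ** push e) (fun g' =>
    (- sg < fW (su11_inv g ** n) <= sg <-> - sg < fW (su11_inv g' ** n) <= sg)).
Proof.
  intros Hg Hn Hs. set (F := fun x => fW (su11_inv x ** n)).
  assert (CF : forall x, cont F x) by (intros; apply cont_fW_inv).
  change (exists e0, 0 < e0 /\ forall e, 0 < e < e0 -> nbhd (g ** push e) (fun g' =>
    (- sg < F g <= sg <-> - sg < F g' <= sg))).
  assert (Lt : forall e, 0 < e -> nbhd (g ** push e) (fun x => F x < F g)).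
  { intros e He. apply cont_lt; auto. now apply fW_push_lt. }
  destruct (Rtotal_order (F g) (- sg)) as [G|[G|G]].
  - apply nbhd_push. eapply nbhd_imp; [|apply (cont_lt _ _ _ (CF g) G)].
    intros x Hx; simpl in Hx; lra.
  - exists 1; split; [lra|]. intros e He.
    eapply nbhd_imp; [|apply Lt; lra]. intros x Hx; simpl in Hx; lra.
  - destruct (Rtotal_order (F g) sg) as [K|[K|K]].
    + apply nbhd_push. eapply nbhd_imp;
        [|apply nbhd_and; [apply (cont_lt _ _ _ (CF g) K)|apply (cont_gt _ _ _ (CF g) G)]].
      intros x [H1 H2]; lra.
    + destruct (nbhd_push _ _ (cont_gt _ _ _ (CF g) G)) as [e0 [He0 N]].
      exists e0; split; auto. intros e He.
      eapply nbhd_imp; [|apply nbhd_and; [apply (N e He)|apply (Lt e); lra]].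
      intros x [H1 H2]; lra.
    + apply nbhd_push. eapply nbhd_imp; [|apply (cont_gt _ _ _ (CF g) K)].
      intros x Hx; simpl in Hx; lra.
Qed.

Lemma size_foot (m : C * C) (s r rho : R) : su11 m -> 0 < rho -> - r < s < r ->
  - sinh rho < fW m <= sinh rho -> fU m = exp (2 * s) * fV m ->
  size m <= 2 * (cosh rho * cosh r).
Proof.
  intros Hm Hrho Hs HW H. destruct (polar m s Hm H) as [k [Hk [EU [EV EW]]]].
  unfold size; rewrite EU, EV.
  replace (exp s * k + exp (- s) * k) with (2 * (k * cosh s)) by (unfold cosh; field).
  pose proof (cosh_sinh rho). pose proof (cosh_ge_1 rho). pose proof (cosh_ge_1 s).
  assert (fW m ^ 2 <= sinh rho ^ 2) by nra.
  assert (k <= cosh rho) by nra.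
  assert (cosh s <= cosh r).
  { rewrite <- (cosh_Rabs s). apply cosh_le; [apply Rabs_pos|]. apply Rabs_le; lra. }
  nra.
Qed.

(** Recovers c from the position of its orbit point in the frame g; a point at bounded distance thus
    leaves only finitely many c in Gamma. *)
Lemma size_conj (g c h : C * C) : su11 g -> su11 h ->
  size c <= size g * (size (su11_inv g ** (c ** h)) * size h).
Proof.
  intros Hg Hh.
  assert (E : c = g ** (su11_inv g ** (c ** h) ** su11_inv h)).
  { rewrite <- su11_mul_assoc, su11_invE', <- su11_mul_assoc, su11_inv_r, su11_mul_1_r; auto. }
  rewrite E at 1. eapply Rle_trans; [apply size_mul|].
  apply Rmult_le_compat_l; [apply size_pos|].
  eapply Rle_trans; [apply size_mul|]. rewrite size_inv. lra.
Qed.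

(** [Nr] looks only at a bounded window, where finitely many orbit points can occur. For each of
    them a small enough push keeps the status, on a whole neighbourhood of the pushed frame, and
    moves the foot by less than 1/r. At g itself this can fail, when a point lies on the boundary of
    the strip. *)
Lemma pattern_stable (Gam : C * C -> Prop) (h g : C * C) (rho r : R) :
  fuchsian Gam -> su11 h -> su11 g -> 0 < rho -> 0 < r ->
  exists g1, su11 g1 /\ nbhd g1 (fun g' => su11 g' ->
    Nr r (pattern Gam h rho g) (pattern Gam h rho g')).
Proof.
  intros HG Hh Hg Hrho Hr.
  set (B := 2 * (cosh rho * cosh r)).
  assert (HB : 0 < B) by (unfold B; pose proof (cosh_ge_1 rho); pose proof (cosh_ge_1 r); nra).
  (* By [size_conj] and [size_foot] this bound covers each c whose foot lies in (-r, r) for some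
     frame of size at most [size g + 1], so one list serves g and all nearby g'. *)
  destruct (fuchsian_finite Gam ((size g + 1) * (B * size h)) HG) as [l Hl].
  pose proof (sinh_pos rho Hrho) as Hsg. assert (Hr' : 0 < / r) by now apply Rinv_0_lt_compat.
  destruct (small_list l (fun c e => Gam c -> nbhd (g ** push e) (fun g' =>
    (- sinh rho < fW (su11_inv g ** (c ** h)) <= sinh rho <->
     - sinh rho < fW (su11_inv g' ** (c ** h)) <= sinh rho) /\
    forall s s', fU (su11_inv g ** (c ** h)) = exp (2 * s) * fV (su11_inv g ** (c ** h)) ->
      fU (su11_inv g' ** (c ** h)) = exp (2 * s') * fV (su11_inv g' ** (c ** h)) ->
      Rabs (s - s') < / r))) as [e1 [He1 K1]].
  { intros c _. destruct (classic (Gam c)) as [Hc|Hc]; [|exists 1; split; [lra|tauto]].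
    assert (Sn : su11 (c ** h)) by (apply su11_closed_mul; eauto using fuchsian_su11).
    destruct (status_push g (c ** h) (sinh rho) Hg Sn Hsg) as [ea [Ha Ka]].
    destruct (nbhd_push _ _ (foot_near g (c ** h) (/ r) Hg Sn Hr')) as [eb [Hb Kb]].
    exists (Rmin ea eb); split; [now apply Rmin_glb_lt|].
    intros e He _. pose proof (Rmin_l ea eb); pose proof (Rmin_r ea eb).
    apply nbhd_and; [apply Ka|apply Kb]; lra. }
  destruct (nbhd_push g (fun x => size x < size g + 1)) as [e2 [He2 K2]].
  { apply cont_lt; [apply cont_size|lra]. }
  set (e := Rmin e1 e2 / 2).
  assert (He : 0 < e < e1 /\ e < e2).
  { unfold e; pose proof (Rmin_l e1 e2); pose proof (Rmin_r e1 e2).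
    assert (0 < Rmin e1 e2) by now apply Rmin_glb_lt. lra. }
  exists (g ** push e); split; [apply su11_closed_mul; auto using push_su11|].
  assert (N1 : nbhd (g ** push e) (fun g' => forall c, In c l -> Gam c ->
    (- sinh rho < fW (su11_inv g ** (c ** h)) <= sinh rho <->
     - sinh rho < fW (su11_inv g' ** (c ** h)) <= sinh rho) /\
    forall s s', fU (su11_inv g ** (c ** h)) = exp (2 * s) * fV (su11_inv g ** (c ** h)) ->
      fU (su11_inv g' ** (c ** h)) = exp (2 * s') * fV (su11_inv g' ** (c ** h)) ->
      Rabs (s - s') < / r)).
  { apply nbhd_list. intros c Hc. destruct (classic (Gam c)) as [Gc|Gc].
    - eapply nbhd_imp; [|apply (K1 e (proj1 He) c Hc Gc)]. auto.
    - apply nbhd_all; tauto. }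
  eapply nbhd_imp; [|apply nbhd_and; [exact N1|apply (K2 e); lra]].
  intros g' [H1 H2] Hg'.
  assert (Fin : forall g0 c s, su11 g0 -> size g0 <= size g + 1 -> Gam c ->
    - sinh rho < fW (su11_inv g0 ** (c ** h)) <= sinh rho ->
    fU (su11_inv g0 ** (c ** h)) = exp (2 * s) * fV (su11_inv g0 ** (c ** h)) ->
    - r < s < r -> In c l).
  { intros g0 c s S0 Z0 Gc Wc Fc Hs. apply Hl; auto.
    assert (Sm : su11 (su11_inv g0 ** (c ** h))).
    { repeat apply su11_closed_mul; eauto using fuchsian_su11, su11_closed_inv. }
    pose proof (size_foot _ s r rho Sm Hrho Hs Wc Fc) as Q. fold B in Q.
    eapply Rle_trans; [apply (size_conj g0 c h S0 Hh)|].
    pose proof (size_pos g0); pose proof (size_pos h).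
    pose proof (size_pos (su11_inv g0 ** (c ** h))).
    apply Rmult_le_compat; auto; [nra|]. apply Rmult_le_compat_r; auto. }
  assert (Sm : forall g0 c, su11 g0 -> Gam c -> su11 (su11_inv g0 ** (c ** h))).
  { intros; repeat apply su11_closed_mul; eauto using fuchsian_su11, su11_closed_inv. }
  split.
  - intros s [c [Gc [Wc Fc]]] Hs.
    destruct (H1 c) as [I1 I2]; auto. { eapply (Fin g); eauto; lra. }
    destruct (foot_exists _ (Sm g' c Hg' Gc)) as [s' Fs'].
    exists s'; split; [|now apply I2]. exists c; repeat split; auto; now apply I1.
  - intros s' [c [Gc [Wc Fc]]] Hs'.
    destruct (H1 c) as [I1 I2]; auto. { eapply (Fin g'); eauto; lra. }
    destruct (foot_exists _ (Sm g c Hg Gc)) as [s Fs].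
    exists s; split; [|now apply I2]. exists c; repeat split; auto; now apply I1.
Qed.

(** * Density of the frames of closed geodesics *)

Lemma Cconj_minus (z w : C) : Cconj (Cminus z w) = Cminus (Cconj z) (Cconj w).
Proof. destruct z, w; unfold Cconj, Cminus, Cplus, Copp; simpl; f_equal; ring. Qed.

(* A frame is determined up to sign by its base point and its velocity 1/(2 conj(a)^2). *)
Lemma frame_from_tangent (g : C * C) (d : R) : su11 g -> 0 < d ->
  exists eps, 0 < eps /\ forall G, su11 G -> Cmod (Cminus (base G) (base g)) < eps ->
    Cmod (Cminus
      (Cdiv (RtoC 1) (Cmult (RtoC 2) (Cmult (Cconj (fst G)) (Cconj (fst G)))))
      (Cdiv (RtoC 1) (Cmult (RtoC 2) (Cmult (Cconj (fst g)) (Cconj (fst g)))))) < eps ->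
    near d g G \/ near d g (neg G).
Proof.
  intros Hg Hd. pose proof (su11_fst_neq0 _ Hg) as Ha. pose proof (Cmod2_pos _ Ha) as Pa.
  set (K := Cmod (fst g) ^ 2) in *. set (eta := d / 4).
  assert (Heta : 0 < eta) by (unfold eta; lra).
  (* The three bounds give in turn |A|^2 <= 2K, then X Y <= eta^2, and last the closeness of the
     second entries. *)
  set (eps := Rmin (/ (4 * K)) (Rmin (eta ^ 2 / (4 * K ^ 2)) (eta / (2 * K)))).
  assert (E1 : eps <= / (4 * K)) by apply Rmin_l.
  assert (E2 : eps <= eta ^ 2 / (4 * K ^ 2)) by (eapply Rle_trans; [apply Rmin_r|apply Rmin_l]).
  assert (E3 : eps <= eta / (2 * K)) by (eapply Rle_trans; [apply Rmin_r|apply Rmin_r]).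
  assert (E0 : 0 < eps).
  { unfold eps; repeat apply Rmin_glb_lt; [apply Rinv_0_lt_compat|apply Rdiv_lt_0_compat|
      apply Rdiv_lt_0_compat]; nra. }
  apply (Rmult_le_compat_r (4 * K)) in E1; [|lra]. rewrite Rinv_l in E1 by lra.
  apply Rle_div_r in E2; [|nra]. apply Rle_div_r in E3; [|lra].
  clearbody eps. exists eps; split; auto. intros G HG H1 H2.
  pose proof (su11_fst_neq0 _ HG) as HA. pose proof (Cmod2_pos _ HA) as PA.
  set (X := Cmod (Cminus (fst G) (fst g))). set (Y := Cmod (Cplus (fst G) (fst g))).
  (* The velocities differ by a multiple of conj(A^2 - a^2) = conj((A - a)(A + a)); a small product
     has a small factor, and which one decides the sign. *)
  assert (XY : X * Y < 2 * eps * (Cmod (fst G) ^ 2 * K)).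
  { replace (Cminus (Cdiv (RtoC 1) (Cmult (RtoC 2) (Cmult (Cconj (fst G)) (Cconj (fst G)))))
      (Cdiv (RtoC 1) (Cmult (RtoC 2) (Cmult (Cconj (fst g)) (Cconj (fst g))))))
      with (Cdiv (Copp (Cconj (Cmult (Cminus (fst G) (fst g)) (Cplus (fst G) (fst g)))))
        (Cmult (RtoC 2) (Cmult (Cmult (Cconj (fst G)) (Cconj (fst G)))
          (Cmult (Cconj (fst g)) (Cconj (fst g)))))) in H2.
    2:{ rewrite Cmult_conj, Cconj_minus, Cplus_conj.
        field; repeat split; auto using Cconj_neq0. }
    rewrite Cmod_div in H2.
    2:{ repeat apply Cmult_neq_0; auto using Cconj_neq0. intros E; apply RtoC_inj in E; lra. }
    rewrite Cmod_opp, Cmod_conj, !Cmod_mult, !Cmod_conj, Cmod_R, Rabs_pos_eq in H2 by lra.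
    fold X Y in H2. apply Rlt_div_l in H2.
    - unfold K; lra.
    - pose proof (proj1 (Cmod_gt_0 _) HA). pose proof (proj1 (Cmod_gt_0 _) Ha).
      repeat apply Rmult_lt_0_compat; lra. }
  assert (TA : Cmod (fst G) ^ 2 <= K + X * Y).
  { unfold X, Y, K. rewrite <- Cmod_mult. replace (Cmod (fst G) ^ 2) with
      (Cmod (Cmult (fst G) (fst G))) by (rewrite Cmod_mult; ring).
    replace (Cmod (fst g) ^ 2) with (Cmod (Cmult (fst g) (fst g))) by (rewrite Cmod_mult; ring).
    eapply Rle_trans; [|apply Cmod_triangle]. right; f_equal; ring. }
  assert (A2 : Cmod (fst G) ^ 2 <= 2 * K) by nra.
  assert (XY' : X * Y <= eta ^ 2) by nra.
  pose proof (proj1 (su11_Cmod G) HG) as SG. pose proof (proj1 (su11_Cmod g) Hg) as Sg.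
  pose proof (Cmod_ge_0 (snd G)) as QB. pose proof (Cmod_ge_0 (snd g)) as Qb.
  pose proof (Cmod_ge_0 (fst G)) as QA. pose proof (Cmod_ge_0 (fst g)) as Qa.
  assert (A1 : Cmod (fst G) <= 2 * K) by nra.
  assert (HX : 0 <= X) by apply Cmod_ge_0. assert (HY : 0 <= Y) by apply Cmod_ge_0.
  (* With the sign e settled, the second entry is recovered from the base point as base times conj
     of the first entry. *)
  assert (Hb : forall e Z, (e = RtoC 1 \/ e = RtoC (-1)) ->
    Z = Cmod (Cminus (Cmult e (fst G)) (fst g)) -> Z <= eta ->
    Cmod (Cminus (Cmult e (snd G)) (snd g)) <= 2 * eta).
  { intros e Z He EZ HZ.
    assert (Ce : Cconj e = e) by (destruct He as [-> | ->]; unfold Cconj, RtoC; simpl; f_equal; ring).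
    assert (Me : Cmod e = 1).
    { destruct He as [-> | ->]; rewrite Cmod_R; [apply Rabs_R1|].
      rewrite Rabs_left; lra. }
    assert (EB : Cminus (Cmult e (snd G)) (snd g) =
      Cplus (Cmult (Cminus (base G) (base g)) (Cmult e (Cconj (fst G))))
        (Cmult (base g) (Cconj (Cminus (Cmult e (fst G)) (fst g))))).
    { rewrite !baseE, Cconj_minus, Cmult_conj, Ce. field; split; now apply Cconj_neq0. }
    rewrite EB. eapply Rle_trans; [apply Cmod_triangle|].
    rewrite !Cmod_mult, !Cmod_conj, Me, <- EZ.
    assert (Cmod (base g) < 1) by now apply inD_base.
    pose proof (Cmod_ge_0 (base g)). pose proof (Cmod_ge_0 (Cminus (base G) (base g))).
    nra. }
  assert (N : forall e, (e = RtoC 1 \/ e = RtoC (-1)) ->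
    Cmod (Cminus (Cmult e (fst G)) (fst g)) <= eta ->
    near d g (Cmult e (fst G), Cmult e (snd G))).
  { intros e He HZ. pose proof (Hb e _ He eq_refl HZ) as HB.
    assert (R4 : forall z : C, Rabs (fst z) <= Cmod z /\ Rabs (snd z) <= Cmod z).
    { intros z. pose proof (Rmax_Cmod z).
      split; eapply Rle_trans; [apply Rmax_l|eassumption|apply Rmax_r|eassumption]. }
    destruct (R4 (Cminus (Cmult e (fst G)) (fst g))) as [R1 R2].
    destruct (R4 (Cminus (Cmult e (snd G)) (snd g))) as [R3 R5].
    assert (eta < d /\ 2 * eta < d) as [D1 D2] by (unfold eta; lra).
    unfold near; repeat split;
      (eapply Rle_lt_trans; [eassumption|]; eapply Rle_lt_trans; [eassumption|]; auto). }
  destruct (Rle_lt_dec X Y) as [L|L].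
  - left. replace G with (Cmult (RtoC 1) (fst G), Cmult (RtoC 1) (snd G)).
    + apply N; auto. rewrite Cmult_1_l. fold X. nra.
    + rewrite !Cmult_1_l; now destruct G.
  - right. replace (neg G) with (Cmult (RtoC (-1)) (fst G), Cmult (RtoC (-1)) (snd G)).
    + apply N; auto.
      replace (Cminus (Cmult (RtoC (-1)) (fst G)) (fst g)) with (Copp (Cplus (fst G) (fst g))).
      * rewrite Cmod_opp; fold Y; nra.
      * unfold RtoC; destruct G as [[] []], g as [[] []];
          apply injective_projections; simpl; ring.
    + unfold neg, RtoC; destruct G as [[] []]; unfold Copp, Cmult; simpl; apply pair4; ring.
Qed.

Lemma unit_tangent_frame (g : C * C) : su11 g ->
  unit_tangent (base g)
    (Cdiv (RtoC 1) (Cmult (RtoC 2) (Cmult (Cconj (fst g)) (Cconj (fst g))))).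
Proof.
  intros Hg; split; [now apply inD_base|].
  pose proof (su11_fst_neq0 _ Hg) as Ha. pose proof (Cconj_neq0 _ Ha) as Ha'.
  rewrite baseE, !Cmod_div, !Cmod_mult, !Cmod_conj, !Cmod_R, !Rabs_pos_eq; auto; try lra.
  2:{ repeat apply Cmult_neq_0; auto. intros E; apply RtoC_inj in E; lra. }
  apply su11_Cmod in Hg. apply Cmod_gt_0 in Ha.
  set (p := Cmod (fst g)) in *. set (q := Cmod (snd g)) in *.
  replace (1 - (q / p) ^ 2) with ((p ^ 2 - q ^ 2) / p ^ 2) by (field; lra).
  rewrite Hg. field; lra.
Qed.

(** The chain rule: the image of the tangent vector under c is the velocity of the frame moved by
    c. *)
Lemma mob_deriv_vel (c g : C * C) (t : R) : su11 c -> su11 g ->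
  let A := fst (c ** (g ** flow t)) in
  Cmult (mob_deriv c (geod g t)) (vel (geod g) t) =
  Cdiv (RtoC 1) (Cmult (RtoC 2) (Cmult (Cconj A) (Cconj A))).
Proof.
  intros Hc Hg A. rewrite vel_geod by auto. unfold geod.
  assert (HG : su11 (g ** flow t)) by (apply su11_closed_mul; auto using flow_su11).
  pose proof (su11_fst_neq0 _ (su11_closed_mul _ _ Hc HG)) as HA. fold A in HA.
  apply Cconj_neq0 in HA.
  set (G := g ** flow t) in *. pose proof (Cconj_neq0 _ (su11_fst_neq0 _ HG)) as HB.
  rewrite baseE. unfold mob_deriv.
  assert (E : Cconj A = Cmult (Cplus (Cmult (Cconj (snd c)) (Cdiv (snd G) (Cconj (fst G))))
    (Cconj (fst c))) (Cconj (fst G))).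
  { unfold A, su11_mul; simpl. rewrite Cplus_conj, !Cmult_conj, Cconj_conj. field; auto. }
  rewrite E in *.
  assert (HD : Cplus (Cmult (Cconj (snd c)) (Cdiv (snd G) (Cconj (fst G)))) (Cconj (fst c))
    <> RtoC 0).
  { intros Z; apply HA; rewrite Z; ring. }
  set (D := Cplus (Cmult (Cconj (snd c)) (Cdiv (snd G) (Cconj (fst G)))) (Cconj (fst c))) in *.
  clearbody D. field; auto.
Qed.

(** A tangent vector fixes its frame up to sign only; Gamma contains -1, so the sign is absorbed in
    c. *)
Lemma dense_frames (Gam : C * C -> Prop) (gl g : C * C) (P : C * C -> Prop) :
  fuchsian Gam -> su11 gl -> dense_in_ST Gam (geod gl) -> su11 g -> nbhd g P ->
  exists c t, Gam c /\ P (c ** (gl ** flow t)).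
Proof.
  intros HG Hgl Hd Hg [d [Hd0 HP]].
  destruct (frame_from_tangent g d Hg Hd0) as [eps [He Hclose]].
  destruct (Hd _ _ _ (unit_tangent_frame g Hg) He) as [t [c [Hc [H1 H2]]]].
  pose proof (fuchsian_su11 _ _ HG Hc) as Sc.
  assert (Ht : su11 (gl ** flow t)) by (apply su11_closed_mul; auto using flow_su11).
  rewrite mob_deriv_vel in H2 by auto.
  unfold geod in H1 at 1; rewrite mob_base in H1 by auto.
  destruct (Hclose (c ** (gl ** flow t))) as [N|N]; auto using su11_closed_mul.
  - exists c, t; auto.
  - exists (neg c), t; split; [now apply (fuchsian_neg Gam)|].
    apply HP. now rewrite neg_mul.
Qed.

(* The isomorphism SL(2,R) -> SU(1,1) that carries diag(e^(t/2), e^(-t/2)) to [flow t]. *)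
Definition of_sl2 (p q r s : R) : C * C :=
  (((p + s) / 2, (r - q) / 2), ((p - s) / 2, (q + r) / 2)).

Lemma of_sl2_mul (p q r s p' q' r' s' : R) :
  of_sl2 p q r s ** of_sl2 p' q' r' s' =
  of_sl2 (p * p' + q * r') (p * q' + q * s') (r * p' + s * r') (r * q' + s * s').
Proof. unfold of_sl2; mat_unfold; apply pair4; field. Qed.

Lemma of_sl2_su11 (p q r s : R) : p * s - q * r = 1 <-> su11 (of_sl2 p q r s).
Proof. unfold su11, of_sl2; simpl. split; intros; lra. Qed.

Lemma of_sl2_flow (t : R) : flow t = of_sl2 (exp (t / 2)) 0 0 (exp (- (t / 2))).
Proof. unfold flow, of_sl2, cosh, sinh, RtoC. apply pair4; field. Qed.

Lemma of_sl2_surj (g : C * C) : g = of_sl2 (fst (fst g) + fst (snd g))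
  (snd (snd g) - snd (fst g)) (snd (fst g) + snd (snd g)) (fst (fst g) - fst (snd g)).
Proof. destruct g as [[a1 a2] [b1 b2]]; unfold of_sl2; simpl; apply pair4; field. Qed.

(* [E ** flow (- T)] is hyperbolic with eigenvectors close to the coordinate axes; they are
   the columns of [P]. *)
Lemma near_axis (e T : R) (E : C * C) : 0 < e <= 1 / 80 -> 1 <= T -> su11 E ->
  near e su11_one E ->
  exists P T', su11 P /\ 0 < T' /\ near (20 * e) su11_one P /\
    E ** flow (- T) ** P = P ** flow (- T').
Proof.
  intros He HT HE [N1 [N2 [N3 N4]]].
  rewrite (of_sl2_surj E) in HE |- *.
  simpl in N1, N2, N3, N4.
  apply Rabs_def2 in N1; apply Rabs_def2 in N2; apply Rabs_def2 in N3; apply Rabs_def2 in N4.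
  set (p := fst (fst E) + fst (snd E)) in *. set (q := snd (snd E) - snd (fst E)) in *.
  set (r := snd (fst E) + snd (snd E)) in *. set (s := fst (fst E) - fst (snd E)) in *.
  assert (Bp : 1 - 2 * e < p < 1 + 2 * e) by (unfold p; lra).
  assert (Bs : 1 - 2 * e < s < 1 + 2 * e) by (unfold s; lra).
  assert (Bq : - (2 * e) < q < 2 * e) by (unfold q; lra).
  assert (Br : - (2 * e) < r < 2 * e) by (unfold r; lra).
  clearbody p q r s. clear N1 N2 N3 N4. apply of_sl2_su11 in HE.
  rewrite of_sl2_flow.
  replace (- T / 2) with (- (T / 2)) by field. rewrite Ropp_involutive.
  set (la := exp (T / 2)). set (li := exp (- (T / 2))).
  assert (Hll : la * li = 1) by apply exp_mul_opp.
  assert (Hla : 3 / 2 <= la).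
  { unfold la. destruct (Req_dec (T / 2) 0); [lra|]. pose proof (exp_ineq1 (T / 2)). lra. }
  assert (Hli : 0 < li) by apply exp_pos.
  assert (Hli2 : li <= 2 / 3) by nra.
  rewrite of_sl2_mul.
  replace (p * li + q * 0) with (p * li) by ring. replace (p * 0 + q * la) with (q * la) by ring.
  replace (r * li + s * 0) with (r * li) by ring. replace (r * 0 + s * la) with (s * la) by ring.
  set (tr := p * li + s * la).
  (* T >= 1 gives la >= 3/2, so la + li >= 13/6; and e <= 1/80 gives p, s > 39/40. The product of
     the two bounds exceeds 2. *)
  assert (Htr : 2 < tr).
  { assert (13 / 6 <= la + li) by nra. unfold tr. nra. }
  assert (Hs : 0 < sqrt (tr ^ 2 - 4)) by (apply sqrt_lt_R0; nra).
  assert (Hs2 : sqrt (tr ^ 2 - 4) ^ 2 = tr ^ 2 - 4) by (apply pow2_sqrt; nra).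
  set (mu := (tr + sqrt (tr ^ 2 - 4)) / 2).
  assert (Hmu : 1 < mu) by (unfold mu; lra).
  assert (Hmu2 : mu ^ 2 - tr * mu + 1 = 0) by (unfold mu; nra).
  set (mi := / mu).
  assert (Hmm : mu * mi = 1) by (apply Rinv_r; lra).
  assert (Hmi : 0 < mi < 1) by (split; nra).
  assert (Hsum : mu + mi = tr).
  { apply (Rmult_eq_reg_l mu); [|lra]. rewrite Rmult_plus_distr_l, Hmm. lra. }
  clearbody mu mi. clear Hs Hs2.
  (* The eigenvectors are (1,y) for mi and (x,1) for mu. Both are solved with the same denominator,
     since mu - p li = s la - mi. *)
  set (d := s * la - mi).
  assert (Hd : la / 4 <= d).
  { unfold d. assert (39 / 40 * la <= s * la) by (apply Rmult_le_compat_r; lra). lra. }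
  assert (Hd' : 3 / 8 <= d) by lra.
  set (x := q * la / d). set (y := - (r * li) / d).
  assert (Ex : x * d = q * la) by (unfold x; field; lra).
  assert (Ey : y * d = - (r * li)) by (unfold y; field; lra).
  clearbody x y.
  assert (Bx : - (8 * e) < x < 8 * e).
  { assert (- (2 * e) * la < q * la < 2 * e * la) by (split; apply Rmult_lt_compat_r; lra).
    assert (2 * e * la <= 2 * e * (4 * d)) by (apply Rmult_le_compat_l; lra).
    split; apply (Rmult_lt_reg_r d); lra. }
  assert (By : - (8 * e) < y < 8 * e).
  { assert (- (2 * e) * li < r * li < 2 * e * li) by (split; apply Rmult_lt_compat_r; lra).
    assert (2 * e * li <= 2 * e * 1) by (apply Rmult_le_compat_l; lra).
    assert (2 * e * (3 / 2) <= 2 * e * (4 * d)) by (apply Rmult_le_compat_l; lra).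
    split; apply (Rmult_lt_reg_r d); lra. }
  assert (Bxy : - e <= x * y <= e).
  { assert (0 <= (8 * e - x) * (8 * e + y)) by (apply Rmult_le_pos; lra).
    assert (0 <= (8 * e + x) * (8 * e - y)) by (apply Rmult_le_pos; lra).
    assert (0 <= (8 * e - x) * (8 * e - y)) by (apply Rmult_le_pos; lra).
    assert (0 <= (8 * e + x) * (8 * e + y)) by (apply Rmult_le_pos; lra).
    assert (e * e <= e * (1 / 80)) by (apply Rmult_le_compat_l; lra).
    lra. }
  assert (Hn : 0 < sqrt (1 - x * y)) by (apply sqrt_lt_R0; lra).
  assert (Hn2 : sqrt (1 - x * y) ^ 2 = 1 - x * y) by (apply pow2_sqrt; lra).
  set (n := sqrt (1 - x * y)) in *. clearbody n.
  (* Scales the matrix of eigenvectors to determinant 1. *)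
  set (k := / n). assert (Hk : k * n = 1) by (apply Rinv_l; lra).
  clearbody k.
  assert (Hk2 : k ^ 2 * (1 - x * y) = 1).
  { rewrite <- Hn2. transitivity ((k * n) ^ 2); [ring|rewrite Hk; ring]. }
  (* The other row of the eigenvector equation for (1,y), which amounts to the characteristic
     equation. *)
  assert (Exy : x * y * d = mi - p * li).
  { apply (Rmult_eq_reg_r d); [|lra].
    transitivity ((x * d) * (y * d)); [ring|]. rewrite Ex, Ey.
    transitivity (- (q * r) * (la * li)); [ring|]. rewrite Hll.
    transitivity (mi * tr - mi ^ 2 - p * s * (la * li)); [|unfold tr, d; ring].
    rewrite Hll, <- Hsum.
    transitivity (mu * mi - p * s); [rewrite Hmm; lra|ring]. }
  assert (Bn : 1 - e <= n <= 1 + e).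
  { clear - Hn2 Hn Bxy He. split.
    - destruct (Rle_lt_dec (1 - e) n) as [|L]; auto. exfalso.
      assert (n * n < (1 - e) * 1) by (apply Rmult_le_0_lt_compat; lra). lra.
    - destruct (Rle_lt_dec n (1 + e)) as [|L]; auto. exfalso.
      assert ((1 + e) * 1 < n * n) by (apply Rmult_le_0_lt_compat; lra). lra. }
  assert (Bk : 1 - 2 * e <= k <= 1 + 2 * e).
  { assert (0 < k) by (clear - Hk Hn; nra).
    split; apply (Rmult_le_reg_r n); auto; rewrite Hk.
    - assert ((1 - 2 * e) * n <= (1 - 2 * e) * (1 + e)) by (apply Rmult_le_compat_l; lra).
      assert (0 <= e * e) by (apply Rmult_le_pos; lra). lra.
    - assert ((1 + 2 * e) * (1 - e) <= (1 + 2 * e) * n) by (apply Rmult_le_compat_l; lra).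
      assert (e * e <= e * (1 / 80)) by (apply Rmult_le_compat_l; lra). lra. }
  exists (of_sl2 k (k * x) (k * y) k), (2 * ln mu).
  assert (Hlm : 0 < ln mu) by (rewrite <- ln_1; apply ln_increasing; lra).
  split; [apply of_sl2_su11; transitivity (k ^ 2 * (1 - x * y)); [ring|auto]|].
  split; [lra|]. split.
  - assert (Bkx : forall z, - (8 * e) < z < 8 * e -> - (10 * e) < k * z < 10 * e).
    { intros z Hz. split.
      - assert (k * - (8 * e) <= k * z) by (apply Rmult_le_compat_l; lra).
        assert (k * (8 * e) <= (1 + 2 * e) * (8 * e)) by (apply Rmult_le_compat_r; lra).
        assert (e * e <= e * (1 / 80)) by (apply Rmult_le_compat_l; lra). lra.
      - assert (k * z <= k * (8 * e)) by (apply Rmult_le_compat_l; lra).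
        assert (k * (8 * e) <= (1 + 2 * e) * (8 * e)) by (apply Rmult_le_compat_r; lra).
        assert (e * e <= e * (1 / 80)) by (apply Rmult_le_compat_l; lra). lra. }
    pose proof (Bkx x Bx). pose proof (Bkx y By).
    unfold near, of_sl2; simpl; repeat split; apply Rabs_def1; lra.
  - rewrite of_sl2_flow.
    replace (- (2 * ln mu) / 2) with (- ln mu) by field.
    rewrite Ropp_involutive, exp_Ropp, exp_ln by lra.
    assert (mi = / mu) as <-.
    { apply (Rmult_eq_reg_l mu); [|lra]. rewrite Hmm, Rinv_r; lra. }
    rewrite !of_sl2_mul. f_equal.
    + transitivity (k * (p * li + (q * la) * y)); [ring|]. rewrite <- Ex.
      transitivity (k * (p * li + x * y * d)); [ring|]. rewrite Exy. ring.
    + transitivity (k * (x * (p * li) + q * la)); [ring|]. rewrite <- Ex.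
      transitivity (k * x * (tr - mi)); [unfold tr, d; ring|]. rewrite <- Hsum. ring.
    + transitivity (k * (r * li + y * (s * la))); [ring|].
      replace (r * li) with (- (y * d)) by lra. unfold d; ring.
    + transitivity (k * ((r * li) * x + s * la)); [ring|].
      replace (r * li) with (- (y * d)) by lra.
      transitivity (k * (s * la - x * y * d)); [ring|]. rewrite Exy.
      transitivity (k * (tr - mi)); [unfold tr; ring|]. rewrite <- Hsum; ring.
Qed.

(** * Recurrence and the closing lemma *)

Lemma pigeonhole {A : Type} (f : nat -> A) (l : list A) :
  (forall i, In (f i) l) -> exists i j, i <> j /\ f i = f j.
Proof.
  intros H. apply NNPP; intros N.
  assert (Inj : Injective f).
  { intros i j E. apply NNPP; intros Hij; apply N; exists i, j; auto. }
  pose proof (Injective_map_NoDup Inj (seq_NoDup (S (length l)) 0)) as ND.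
  apply (NoDup_incl_length (l' := l)) in ND.
  - rewrite length_map, length_seq in ND; lia.
  - intros a Ha. apply in_map_iff in Ha. destruct Ha as [i [<- _]]; auto.
Qed.

Lemma near_mul (z : R) (F P : C * C) : 0 < z -> near z su11_one P ->
  near (z * (size F + 2)) F (F ** P).
Proof.
  intros Hz [N1 [N2 [N3 N4]]].
  destruct F as [[a1 a2] [b1 b2]], P as [[p1 p2] [q1 q2]]. simpl in N1, N2, N3, N4.
  apply Rabs_def2 in N1; apply Rabs_def2 in N2; apply Rabs_def2 in N3; apply Rabs_def2 in N4.
  rewrite sizeE. unfold near; mat_unfold.
  assert (B : forall a x, - z < x < z -> - (z * (a ^ 2 + 1 / 4)) <= a * x <= z * (a ^ 2 + 1 / 4)).
  { intros a x Hx. assert (- (a ^ 2 + 1 / 4) <= a <= a ^ 2 + 1 / 4).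
    { pose proof (pow2_ge_0 (a - 1 / 2)); pose proof (pow2_ge_0 (a + 1 / 2)); lra. }
    assert (Rabs (a * x) <= (a ^ 2 + 1 / 4) * z).
    { rewrite Rabs_mult. apply Rmult_le_compat; try apply Rabs_pos; apply Rabs_le; lra. }
    apply Rabs_le_between in H0. lra. }
  set (x1 := p1 - 1) in *. assert (E1 : p1 = 1 + x1) by (unfold x1; ring). clearbody x1. subst p1.
  assert (I1 : - z < x1 < z) by lra. assert (I2 : - z < p2 < z) by lra.
  assert (I3 : - z < q1 < z) by lra. assert (I4 : - z < q2 < z) by lra.
  pose proof (B a1 _ I1); pose proof (B a1 _ I2); pose proof (B a1 _ I3); pose proof (B a1 _ I4).
  pose proof (B a2 _ I1); pose proof (B a2 _ I2); pose proof (B a2 _ I3); pose proof (B a2 _ I4).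
  pose proof (B b1 _ I1); pose proof (B b1 _ I2); pose proof (B b1 _ I3); pose proof (B b1 _ I4).
  pose proof (B b2 _ I1); pose proof (B b2 _ I2); pose proof (B b2 _ I3); pose proof (B b2 _ I4).
  assert (0 <= z * a1 ^ 2) by (apply Rmult_le_pos; [lra|apply pow2_ge_0]).
  assert (0 <= z * a2 ^ 2) by (apply Rmult_le_pos; [lra|apply pow2_ge_0]).
  assert (0 <= z * b1 ^ 2) by (apply Rmult_le_pos; [lra|apply pow2_ge_0]).
  assert (0 <= z * b2 ^ 2) by (apply Rmult_le_pos; [lra|apply pow2_ge_0]).
  simpl in *. repeat split; apply Rabs_def1; lra.
Qed.

(** The rotation about 0 by the angle 2 arccot x; it tends to the identity as x grows. *)
Definition rot (x : R) : C * C := ((x / sqrt (x ^ 2 + 1), / sqrt (x ^ 2 + 1)), RtoC 0).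

Lemma rot_sqrt (x : R) : 0 < sqrt (x ^ 2 + 1) /\ sqrt (x ^ 2 + 1) ^ 2 = x ^ 2 + 1.
Proof.
  assert (0 < x ^ 2 + 1) by (pose proof (pow2_ge_0 x); lra).
  split; [now apply sqrt_lt_R0|apply pow2_sqrt; lra].
Qed.

Lemma rot_su11 (x : R) : su11 (rot x).
Proof.
  destruct (rot_sqrt x) as [H1 H2]. unfold su11, rot, RtoC; cbn [fst snd].
  set (s := sqrt (x ^ 2 + 1)) in *.
  transitivity ((x ^ 2 + 1) / s ^ 2); [field; lra|]. rewrite H2. field. nra.
Qed.

Lemma rot_near (x : R) : 1 <= x -> near (/ x) su11_one (rot x).
Proof.
  intros Hx. destruct (rot_sqrt x) as [H1 H2]. unfold near, rot, su11_one, RtoC; cbn [fst snd].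
  set (s := sqrt (x ^ 2 + 1)) in *.
  assert (Hs : x < s) by nra.
  assert (/ s < / x) by (apply Rinv_lt_contravar; nra).
  assert (0 < / s) by now apply Rinv_0_lt_compat.
  assert (Hi : x / s = 1 - (s - x) * / s) by (field; lra).
  assert (s - x < 1) by nra.
  assert (0 < (s - x) * / s) by (apply Rmult_lt_0_compat; lra).
  assert ((s - x) * / s < 1 * / s) by (apply Rmult_lt_compat_r; lra).
  repeat split; apply Rabs_def1; lra.
Qed.

(* Two frames on the same geodesic have proportional first columns in SL(2,R); for the
   frames [g ** rot n] the slope relative to [g] is 1/n. *)
Lemma returns (Gam : C * C -> Prop) (gl g : C * C) (Q : C * C -> Prop) :
  fuchsian Gam -> su11 gl -> dense_in_ST Gam (geod gl) -> su11 g -> nbhd g Q ->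
  exists F c T, su11 F /\ Q F /\ Gam c /\ 1 <= T /\ Q (c ** F ** flow T).
Proof.
  intros HG Hgl Hd Hg HQ.
  assert (HQ' : nbhd g (fun x => Q x /\ size x < size g + 1)).
  { apply nbhd_and; auto. apply cont_lt; [apply cont_size|lra]. }
  apply nbhd_nbhd in HQ'. destruct HQ' as [z [Hz HQ']].
  pose proof (size_pos g) as Sg.
  (* Slopes 1/x this small keep all frames [g ** rot (x n)] within z of g; the extra 1 ensures x >=
     1, as [rot_near] requires. *)
  destruct (nfloor_ex ((size g + 2) / z + 1)) as [n0 [_ Hn0]].
  { assert (0 < (size g + 2) / z) by (apply Rdiv_lt_0_compat; lra). lra. }
  set (x := fun n : nat => INR (n + n0) + 1).
  assert (Hx : forall n, (size g + 2) / z + 1 < x n).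
  { intros n; unfold x. rewrite plus_INR. pose proof (pos_INR n). lra. }
  assert (Hpos : 0 < (size g + 2) / z) by (apply Rdiv_lt_0_compat; lra).
  assert (NR : forall n, nbhd (g ** rot (x n)) (fun y => Q y /\ size y < size g + 1)).
  { intros n. apply HQ'. specialize (Hx n).
    apply (near_le (/ x n * (size g + 2))).
    - rewrite Rmult_comm. apply (Rle_div_l (size g + 2) z (x n)); [lra|].
      apply Rmult_le_reg_r with (/ z); [now apply Rinv_0_lt_compat|].
      replace (z * x n * / z) with (x n) by (field; lra). unfold Rdiv in Hx; lra.
    - apply near_mul; [apply Rinv_0_lt_compat; lra|apply rot_near; lra]. }
  (* (c1,c2) is the first column of g^(-1) y in SL(2,R). The flow multiplies it by a scalar, so
     c1/c2 is constant along a geodesic. *)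
  set (c1 := fun y => fst (fst (su11_inv g ** y)) + fst (snd (su11_inv g ** y))).
  set (c2 := fun y => snd (fst (su11_inv g ** y)) + snd (snd (su11_inv g ** y))).
  assert (C1 : forall y, cont c1 y) by (intros; unfold c1; cont_unfold).
  assert (C2 : forall y, cont c2 y) by (intros; unfold c2; cont_unfold).
  assert (Cf : forall y t, c1 (y ** flow t) = exp (t / 2) * c1 y /\
                           c2 (y ** flow t) = exp (t / 2) * c2 y).
  { intros y t; unfold c1, c2. rewrite !su11_mul_assoc.
    destruct (su11_inv g ** y) as [[a1 a2] [b1 b2]]; unfold flow, cosh, sinh; mat_unfold.
    split; field. }
  assert (Cr : forall n, 0 < c2 (g ** rot (x n)) /\
    c1 (g ** rot (x n)) = x n * c2 (g ** rot (x n))).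
  { intros n; unfold c1, c2. rewrite su11_invE by auto. unfold rot; simpl.
    destruct (rot_sqrt (x n)) as [H1 _]. simpl in H1.
    split; [|field; lra]. rewrite Rplus_0_r. now apply Rinv_0_lt_compat. }
  (* The windows of half-width 1/2 around c1/c2 = x n are disjoint for different n, as the x n are 1
     apart. *)
  assert (Hhit : forall n, exists p : (C * C) * R, Gam (fst p) /\
    let F := fst p ** (gl ** flow (snd p)) in
    (Q F /\ size F < size g + 1) /\
    (0 < c2 F /\ 0 < c1 F - (x n - / 2) * c2 F /\ c1 F - (x n + / 2) * c2 F < 0)).
  { intros n. destruct (Cr n) as [K1 K2].
    destruct (dense_frames Gam gl (g ** rot (x n)) (fun F =>
      (Q F /\ size F < size g + 1) /\
      (0 < c2 F /\ 0 < c1 F - (x n - / 2) * c2 F /\ c1 F - (x n + / 2) * c2 F < 0)))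
      as [c [t [Hc HF]]]; auto using su11_closed_mul, rot_su11.
    - apply nbhd_and; [apply NR|]. apply nbhd_and; [apply cont_gt; auto|].
      apply nbhd_and.
      + apply (cont_gt (fun F => c1 F - (x n - / 2) * c2 F)).
        * apply cont_minus; auto. apply cont_mult; auto using cont_const.
        * rewrite K2. lra.
      + apply (cont_lt (fun F => c1 F - (x n + / 2) * c2 F)).
        * apply cont_minus; auto. apply cont_mult; auto using cont_const.
        * rewrite K2. lra.
    - exists (c, t); auto. }
  apply choice in Hhit. destruct Hhit as [p Hp].
  set (F := fun n => fst (p n) ** (gl ** flow (snd (p n)))) in *.
  assert (HF : forall n, su11 (F n)).
  { intros n; unfold F. apply su11_closed_mul.
    - apply (fuchsian_su11 Gam); auto. apply Hp.
    - apply su11_closed_mul; auto using flow_su11. }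
  assert (Hret : forall i j, F j =
    fst (p j) ** su11_inv (fst (p i)) ** F i ** flow (snd (p j) - snd (p i))).
  { intros i j. unfold F. rewrite <- !su11_mul_assoc. f_equal.
    rewrite su11_invE by (apply (fuchsian_su11 Gam); auto; apply Hp).
    rewrite <- flow_add. do 2 f_equal. ring. }
  destruct (classic (exists i j, 1 <= snd (p j) - snd (p i))) as [[i [j Hij]]|Hno].
  - exists (F i), (fst (p j) ** su11_inv (fst (p i))), (snd (p j) - snd (p i)).
    repeat split; auto; try apply Hp.
    + apply (fuchsian_mul Gam); auto; [|apply (fuchsian_inv Gam); auto]; apply Hp.
    + rewrite <- Hret. apply Hp.
  (* All hitting times now lie within 1 of each other, so the elements [D n] of Gamma have bounded
     size and two of them agree. The corresponding frames lie on one geodesic, against the disjoint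
     windows for c1/c2. *)
  - exfalso.
    assert (Hb : forall i j, snd (p j) - snd (p i) < 1).
    { intros i j. destruct (Rlt_le_dec (snd (p j) - snd (p i)) 1); auto.
      exfalso; apply Hno; exists i, j; auto. }
    set (D := fun n => fst (p n) ** su11_inv (fst (p 0%nat))).
    destruct (fuchsian_finite Gam ((size g + 1) * (2 * cosh 1 * (size g + 1))) HG) as [l Hl].
    destruct (pigeonhole D l) as [i [j [Hij ED]]].
    { intros n. apply Hl.
      - apply (fuchsian_mul Gam); auto; [|apply (fuchsian_inv Gam); auto]; apply Hp.
      - assert (E : D n = F n ** (flow (- (snd (p n) - snd (p 0%nat))) ** su11_inv (F 0%nat))).
        { rewrite (Hret 0%nat n). fold (D n). rewrite <- flow_inv, <- su11_inv_mul.
          rewrite <- (su11_mul_assoc (D n)). rewrite <- su11_mul_assoc.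
          rewrite su11_inv_r, su11_mul_1_r; auto using su11_closed_mul, flow_su11. }
        rewrite E. eapply Rle_trans; [apply size_mul|].
        apply Rmult_le_compat; try apply size_pos; [left; apply Hp|].
        eapply Rle_trans; [apply size_mul|].
        apply Rmult_le_compat; try apply size_pos.
        + rewrite size_flow, <- cosh_Rabs. apply Rmult_le_compat_l; [lra|].
          apply cosh_le; [apply Rabs_pos|].
          pose proof (Hb 0%nat n); pose proof (Hb n 0%nat). apply Rabs_le; lra.
        + rewrite size_inv. left; apply Hp. }
    assert (Ep : fst (p i) = fst (p j)).
    { assert (S0 : su11 (fst (p 0%nat))) by (apply (fuchsian_su11 Gam); auto; apply Hp).
      rewrite <- (su11_mul_1_r (fst (p i))), <- (su11_mul_1_r (fst (p j))).
      rewrite <- (su11_inv_l (fst (p 0%nat))), !su11_mul_assoc by auto.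
      unfold D in ED; now rewrite ED. }
    assert (EF : F j = F i ** flow (snd (p j) - snd (p i))).
    { rewrite (Hret i j) at 1. rewrite <- Ep, su11_inv_r, su11_mul_1_l; auto.
      apply (fuchsian_su11 Gam); auto; apply Hp. }
    destruct (Hp i) as [_ [_ [P1 [P2 P3]]]]. destruct (Hp j) as [_ [_ [R1 [R2 R3]]]].
    fold (F i) in P1, P2, P3. fold (F j) in R1, R2, R3.
    rewrite EF in R1, R2, R3.
    destruct (Cf (F i) (snd (p j) - snd (p i))) as [E1 E2]. rewrite E1, E2 in *.
    set (k := exp ((snd (p j) - snd (p i)) / 2)) in *.
    assert (Hk : 0 < k) by apply exp_pos. clearbody k.
    assert (T2 : 0 < c1 (F i) - (x j - / 2) * c2 (F i)).
    { apply (Rmult_lt_reg_l k); auto. lra. }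
    assert (T3 : c1 (F i) - (x j + / 2) * c2 (F i) < 0).
    { apply (Rmult_lt_reg_l k); auto. lra. }
    assert (U1 : x i - x j < 1) by (apply (Rmult_lt_reg_r (c2 (F i))); auto; lra).
    assert (U2 : x j - x i < 1) by (apply (Rmult_lt_reg_r (c2 (F i))); auto; lra).
    unfold x in U1, U2. rewrite !plus_INR in *.
    assert (INR i < INR (S j)) by (rewrite S_INR; lra).
    assert (INR j < INR (S i)) by (rewrite S_INR; lra).
    apply INR_lt in H, H0. lia.
Qed.

(** A return F' = c F A_T with E = F^(-1) F' near 1 means F^(-1) c F = E A_(-T). By [near_axis] this
    is conjugate to A_(-T') through some P near 1, so F P frames the axis of c. The translation runs
    backwards, hence the inverse of c in the conclusion. *)
Lemma periodic_frames_dense (Gam : C * C -> Prop) (gl g : C * C) (Q : C * C -> Prop) :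
  fuchsian Gam -> su11 gl -> dense_in_ST Gam (geod gl) -> su11 g -> nbhd g Q ->
  exists g' c T, su11 g' /\ Q g' /\ Gam c /\ 0 < T /\ c ** g' = g' ** flow T.
Proof.
  intros HG Hgl Hd Hg [e0 [He0 HQ]].
  pose proof (size_pos g) as Sg.
  (* Makes F P closer than e0/2 to F: the displacement is at most 20 e (size F + 2). *)
  set (e := Rmin (1 / 80) (e0 / (40 * (size g + 3)))).
  assert (He : 0 < e <= 1 / 80).
  { unfold e; split; [apply Rmin_glb_lt; [lra|apply Rdiv_lt_0_compat; lra]|apply Rmin_l]. }
  assert (He' : e * (40 * (size g + 3)) <= e0).
  { apply (Rle_div_r e e0 (40 * (size g + 3))); [lra|apply Rmin_r]. }
  clearbody e.
  (* F and F' are within 2d of each other, and 8d(size F + 1) < e brings E within e of 1. *)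
  set (d := Rmin (e0 / 2) (e / (20 * (size g + 3)))).
  assert (Hd0 : 0 < d) by (unfold d; apply Rmin_glb_lt; [|apply Rdiv_lt_0_compat]; lra).
  assert (Hd1 : d <= e0 / 2) by apply Rmin_l.
  assert (Hd2 : d * (20 * (size g + 3)) <= e).
  { apply (Rle_div_r d e (20 * (size g + 3))); [lra|apply Rmin_r]. }
  clearbody d.
  destruct (returns Gam gl g (fun x => near d g x /\ size x < size g + 1))
    as [F [c [T [HF [[NF SF] [Hc [HT [NF' SF']]]]]]]]; auto.
  { apply nbhd_and; [exists d; auto|]. apply cont_lt; [apply cont_size|lra]. }
  pose proof (fuchsian_su11 _ _ HG Hc) as Sc.
  set (F' := c ** F ** flow T) in *.
  assert (HF' : su11 F') by (repeat apply su11_closed_mul; auto using flow_su11).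
  assert (HE : su11 (su11_inv F ** F')).
  { apply su11_closed_mul; auto using su11_closed_inv. }
  assert (NE : near e su11_one (su11_inv F ** F')).
  { pose proof (near_trans _ _ _ _ _ (near_sym _ _ _ NF) NF') as NFF.
    destruct (near_su11_bound (d + d) F F' ltac:(lra) NFF HF) as [B1 [B2 [B3 B4]]].
    pose proof (size_pos F).
    assert (BB : 4 * (d + d) * size F + 4 * (d + d) < e).
    { assert (d * size F <= d * (size g + 1)) by (apply Rmult_le_compat_l; lra).
      assert (0 <= d * size g) by (apply Rmult_le_pos; lra). lra. }
    unfold near, su11_one; simpl fst at 2 4 6 8; simpl snd at 2 4 6 8.
    simpl. rewrite !Rminus_0_r.
    repeat split; eapply Rle_lt_trans; eauto. }
  destruct (near_axis e T _ He HT HE NE) as [P [T' [HP [HT' [NP EP]]]]].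
  assert (EM : c ** (F ** P) = F ** P ** flow (- T')).
  { rewrite <- (su11_mul_assoc F P), <- EP. unfold F'.
    rewrite !su11_mul_assoc, su11_inv_r, su11_mul_1_l by auto.
    rewrite <- (su11_mul_assoc (c ** F)), <- flow_add.
    replace (T + - T) with 0 by ring. now rewrite flow_0, su11_mul_1_r. }
  exists (F ** P), (su11_inv c), T'. repeat split; auto using su11_closed_mul.
  - apply HQ. replace e0 with (e0 / 2 + e0 / 2) by field.
    apply (near_trans _ _ g F); [eapply near_le; eauto|].
    apply (near_le (20 * e * (size F + 2))); [|apply near_mul; auto; lra].
    assert (e * size F <= e * (size g + 1)) by (apply Rmult_le_compat_l; lra). lra.
  - now apply (fuchsian_inv Gam).
  - assert (E2 : F ** P = c ** (F ** P) ** flow T').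
    { rewrite EM, <- (su11_mul_assoc (F ** P)), <- flow_add.
      replace (- T' + T') with 0 by ring. now rewrite flow_0, su11_mul_1_r. }
    rewrite E2 at 1. now rewrite <- (su11_mul_assoc c), su11_invE.
Qed.

(** * Hulls of Delone sets *)

(** Membership in the hull without reference to [eps] and [delta]: that T is Delone with the same
    constants is a consequence, not a premise. *)
Definition limit_of_translates (S T : R -> Prop) : Prop :=
  forall r, 0 < r -> exists v, Nr r T (translate S v).

Lemma delone_ed_translate (eps delta v : R) (S : R -> Prop) :
  delone_ed eps delta S -> delone_ed eps delta (translate S v).
Proof.
  intros [H1 H2]; split.
  - intros y. destruct (H1 (y + v)) as [s [Hs Hys]].
    exists (s - v). unfold translate. replace (s - v + v) with s by ring. split; auto.
    replace (y - (s - v)) with (y + v - s) by ring; auto.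
  - intros s s' Hs Hs' N. replace (s - s') with (s + v - (s' + v)) by ring.
    apply H2; auto. lra.
Qed.

Lemma large_radius (a k : R) : 0 < k -> exists r, 0 < r /\ a < r /\ / r <= k.
Proof.
  intros Hk. assert (0 < / k) by now apply Rinv_0_lt_compat.
  pose proof (Rle_abs a). pose proof (Rabs_pos a).
  exists (Rabs a + 1 + / k). repeat split; try lra.
  apply Rle_trans with (/ / k); [apply Rinv_le_contravar; lra|rewrite Rinv_inv; lra].
Qed.

(* A separated set approaching distance [eps] from [y] without attaining it would
   have three points in a small neighbourhood of [{y - eps, y + eps}]. *)
Lemma delone_ed_limit (eps delta : R) (S T : R -> Prop) : 0 < delta -> 0 < eps ->
  delone_ed eps delta S -> limit_of_translates S T -> delone_ed eps delta T.
Proof.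
  intros Hd He HS HT.
  assert (HSv : forall v, delone_ed eps delta (translate S v)) by (intros; now apply delone_ed_translate).
  assert (Sep : forall s s', T s -> T s' -> s <> s' -> delta <= Rabs (s - s')).
  { intros s s' Hs Hs' N. apply Rnot_lt_le; intros L.
    assert (P : 0 < Rabs (s - s')) by (apply Rabs_pos_lt; lra).
    set (k := Rmin (Rabs (s - s')) (delta - Rabs (s - s')) / 3).
    assert (Hk : 0 < k /\ 3 * k <= Rabs (s - s') /\ 3 * k <= delta - Rabs (s - s')).
    { unfold k. pose proof (Rmin_l (Rabs (s - s')) (delta - Rabs (s - s'))).
      pose proof (Rmin_r (Rabs (s - s')) (delta - Rabs (s - s'))).
      assert (0 < Rmin (Rabs (s - s')) (delta - Rabs (s - s'))) by (apply Rmin_glb_lt; lra).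
      lra. }
    destruct (large_radius (Rabs s + Rabs s') k (proj1 Hk)) as [r [Hr [Hr1 Hr2]]].
    destruct (HT r Hr) as [v [HN _]]. clearbody k.
    pose proof (Rabs_pos s). pose proof (Rabs_pos s').
    destruct (HN s Hs) as [u [Hu Du]]; [apply Rabs_lt_between; lra|].
    destruct (HN s' Hs') as [u' [Hu' Du']]; [apply Rabs_lt_between; lra|].
    destruct (Req_dec u u') as [E|E].
    - subst u'. revert Du Du' Hk. unfold Rabs; repeat destruct Rcase_abs; lra.
    - pose proof (proj2 (HSv v) u u' Hu Hu' E) as Q.
      revert Q Du Du' Hk. unfold Rabs; repeat destruct Rcase_abs; lra. }
  split; auto.
  intros y.
  assert (App : forall k, 0 < k -> exists s, T s /\ Rabs (y - s) <= eps + k).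
  { intros k Hk. destruct (large_radius (Rabs y + eps) k Hk) as [r [Hr [Hr1 Hr2]]].
    destruct (HT r Hr) as [v [_ HN]].
    destruct (proj1 (HSv v) y) as [u [Hu Du]].
    destruct (HN u Hu) as [s [Hs Ds]].
    - apply Rabs_lt_between. replace u with (y + - (y - u)) by ring.
      eapply Rle_lt_trans; [apply Rabs_triang|]. rewrite Rabs_Ropp; lra.
    - exists s; split; auto. replace (y - s) with (y - u + - (s - u)) by ring.
      eapply Rle_trans; [apply Rabs_triang|]. rewrite Rabs_Ropp; lra. }
  apply NNPP; intros N.
  assert (Far : forall s, T s -> eps < Rabs (y - s)).
  { intros s Hs. apply Rnot_le_lt; intros L; apply N; exists s; auto. }
  destruct (App (delta / 4)) as [s1 [H1 D1]]; [lra|]. pose proof (Far s1 H1) as F1.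
  destruct (App ((Rabs (y - s1) - eps) / 2)) as [s2 [H2 D2]]; [lra|]. pose proof (Far s2 H2) as F2.
  destruct (App ((Rabs (y - s2) - eps) / 2)) as [s3 [H3 D3]]; [lra|]. pose proof (Far s3 H3) as F3.
  assert (N12 : s1 <> s2) by (intros <-; lra).
  assert (N13 : s1 <> s3) by (intros <-; lra).
  assert (N23 : s2 <> s3) by (intros <-; lra).
  pose proof (Sep s1 s2 H1 H2 N12) as S12. pose proof (Sep s1 s3 H1 H3 N13) as S13.
  pose proof (Sep s2 s3 H2 H3 N23) as S23.
  clear - D1 D2 D3 F1 F2 F3 S12 S13 S23 He Hd.
  unfold Rabs in *; repeat destruct Rcase_abs; lra.
Qed.

(** The approximating translates have period v, so T has points arbitrarily close to s + v; in a
    uniformly discrete set one of them must be s + v itself. *)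
Lemma period_limit (eps delta v : R) (S T : R -> Prop) : 0 < delta ->
  delone_ed eps delta T -> limit_of_translates S T ->
  (forall t, S (t + v) <-> S t) -> forall s, T s -> T (s + v).
Proof.
  intros Hd [_ Sep] HT Hv s Hs.
  assert (App : forall k, 0 < k -> exists s', T s' /\ Rabs (s' - (s + v)) <= k).
  { intros k Hk. assert (Hk2 : 0 < Rmin (k / 2) 1) by (apply Rmin_glb_lt; lra).
    destruct (large_radius (Rabs s + Rabs v + 1) _ Hk2) as [r [Hr [Hr1 Hr2]]].
    pose proof (Rmin_l (k / 2) 1); pose proof (Rmin_r (k / 2) 1).
    destruct (HT r Hr) as [w [HN1 HN2]].
    pose proof (Rabs_pos s). pose proof (Rabs_pos v).
    destruct (HN1 s Hs) as [u [Hu Du]]; [apply Rabs_lt_between; lra|].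
    destruct (HN2 (u + v)) as [s' [Hs' Ds']].
    - unfold translate in *. replace (u + v + w) with (u + w + v) by ring. now apply Hv.
    - apply Rabs_lt_between. replace (u + v) with (s + v + - (s - u)) by ring.
      eapply Rle_lt_trans; [apply Rabs_triang|]. rewrite Rabs_Ropp.
      pose proof (Rabs_triang s v). lra.
    - exists s'; split; auto.
      replace (s' - (s + v)) with (s' - (u + v) + - (s - u)) by ring.
      eapply Rle_trans; [apply Rabs_triang|]. rewrite Rabs_Ropp; lra. }
  destruct (App (delta / 4)) as [s1 [H1 D1]]; [lra|].
  destruct (Req_dec s1 (s + v)) as [<-|N]; auto. exfalso.
  assert (P : 0 < Rabs (s1 - (s + v))) by (apply Rabs_pos_lt; lra).
  destruct (App (Rabs (s1 - (s + v)) / 2)) as [s2 [H2 D2]]; [lra|].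
  assert (N12 : s1 <> s2) by (intros <-; lra).
  pose proof (Sep s1 s2 H1 H2 N12) as S12.
  clear - D1 D2 S12 Hd. unfold Rabs in *; repeat destruct Rcase_abs; lra.
Qed.

Lemma Nr_translate (r v v' : R) (S : R -> Prop) : Rabs (v - v') < / r ->
  Nr r (translate S v) (translate S v').
Proof.
  intros H; split; intros s Hs _.
  - exists (s + v - v'); unfold translate in *.
    replace (s + v - v' + v') with (s + v) by ring; split; auto.
    replace (s - (s + v - v')) with (- (v - v')) by ring. now rewrite Rabs_Ropp.
  - exists (s + v' - v); unfold translate in *.
    replace (s + v' - v + v) with (s + v') by ring; split; auto.
    replace (s + v' - v - s) with (- (v - v')) by ring. now rewrite Rabs_Ropp.
Qed.

Lemma orbit_eq (S T : R -> Prop) : orbit S T -> exists v, T = translate S v.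
Proof.
  intros [v Hv]; exists v. apply functional_extensionality; intros t.
  now apply propositional_extensionality.
Qed.

Lemma period_iter (S : R -> Prop) (p : R) (n : nat) :
  (forall t, S (t + p) <-> S t) -> forall t, S (t + INR n * p) <-> S t.
Proof.
  intros H; induction n as [|n IH]; intros t.
  - simpl; replace (t + 0 * p) with t by ring; tauto.
  - rewrite S_INR. replace (t + (INR n + 1) * p) with (t + INR n * p + p) by ring.
    now rewrite H.
Qed.

Lemma translate_mod_period (S : R -> Prop) (p v : R) : 0 < p ->
  (forall t, S (t + p) <-> S t) -> exists v', 0 <= v' <= p /\ translate S v = translate S v'.
Proof.
  intros Hp H.
  assert (Pos : forall v, 0 <= v -> exists v', 0 <= v' <= p /\ translate S v = translate S v').
  { intros w Hw. destruct (nfloor_ex (w / p)) as [n [Hn1 Hn2]].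
    { apply Rdiv_le_0_compat; lra. }
    apply Rle_div_r in Hn1; [|lra]. apply Rlt_div_l in Hn2; [|lra].
    exists (w - INR n * p). split; [lra|].
    apply functional_extensionality; intros t; apply propositional_extensionality.
    unfold translate. rewrite <- (period_iter S p n H (t + (w - INR n * p))).
    replace (t + (w - INR n * p) + INR n * p) with (t + w) by ring. tauto. }
  destruct (Rle_lt_dec 0 v) as [Hv|Hv]; [now apply Pos|].
  destruct (nfloor_ex (- v / p)) as [n [Hn1 Hn2]].
  { apply Rdiv_le_0_compat; lra. }
  apply Rlt_div_l in Hn2; [|lra].
  destruct (Pos (v + INR (Datatypes.S n) * p)) as [v' [Hv' E]].
  { rewrite S_INR. lra. }
  exists v'; split; auto. rewrite <- E.
  apply functional_extensionality; intros t; apply propositional_extensionality.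
  unfold translate. rewrite <- (period_iter S p (Datatypes.S n) H (t + v)).
  now rewrite Rplus_assoc.
Qed.

(** The orbit is the image of the interval [0,p] under the continuous map v |-> S - v. *)
Lemma periodic_of_period (eps delta p : R) (S : R -> Prop) : 0 < p ->
  delone_ed eps delta S -> (forall t, S (t + p) <-> S t) -> periodic eps delta S.
Proof.
  intros Hp HS H. split; auto. split.
  { intros T HT; apply orbit_eq in HT; destruct HT as [v ->]; now apply delone_ed_translate. }
  intros I U HU Hcov.
  assert (loc : forall v, exists q : R * I, 0 < fst q /\
    forall v', Rabs (v' - v) < fst q -> U (snd q) (translate S v')).
  { intros v. destruct (Hcov (translate S v)) as [i Hi].
    { exists v; intros; tauto. }
    destruct (HU i) as [_ HO]. destruct (HO _ Hi) as [r [Hr HN]].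
    exists (/ r, i); split; [now apply Rinv_0_lt_compat|].
    intros v' Hv'. apply HN; [now apply delone_ed_translate|].
    apply Nr_translate. now rewrite Rabs_minus_sym. }
  apply choice in loc. destruct loc as [f Hf].
  destruct (NNPP _ (compactness_list 1 (0, tt) (p, tt)
    (fun x => mkposreal _ (proj1 (Hf (fst x)))))) as [l Hl].
  exists (map (fun x => snd (f (fst x))) l).
  intros T HT. apply orbit_eq in HT. destruct HT as [v ->].
  destruct (translate_mod_period S p v Hp H) as [v' [Hv' ->]].
  destruct (Hl (v', tt)) as [[t []] [Ht [_ Hc]]]; [simpl; auto|].
  simpl in Hc. exists (snd (f t)); split.
  - apply in_map_iff. exists (t, tt); auto.
  - now apply Hf.
Qed.

(** * Aperiodicity *)

(** The rotation fixes X0 and turns the plane (X1,X2) by the angle with cosine c^2 - d^2 and sine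
    2cd; note that U - V = 2X1. *)
Lemma fW_rot (x : R) (j : C * C) :
  let c := x / sqrt (x ^ 2 + 1) in let d := / sqrt (x ^ 2 + 1) in
  fW (su11_inv (rot x) ** j) = (c ^ 2 - d ^ 2) * fW j - c * d * (fU j - fV j) /\
  fU (su11_inv (rot x) ** j) - fV (su11_inv (rot x) ** j) =
    (c ^ 2 - d ^ 2) * (fU j - fV j) + 4 * (c * d) * fW j /\
  size (su11_inv (rot x) ** j) = size j.
Proof.
  intros c d.
  assert (E : c ^ 2 + d ^ 2 = 1).
  { pose proof (rot_su11 x) as H. unfold su11, rot in H. cbn [fst snd RtoC] in H.
    fold c d in H. lra. }
  unfold rot; fold c d. clearbody c d. rewrite !sizeE.
  destruct j as [[a1 a2] [b1 b2]]. repeat split.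
  - mat_unfold; ring.
  - mat_unfold; ring.
  - match goal with |- _ = ?r => transitivity ((c ^ 2 + d ^ 2) * r) end.
    + mat_unfold; ring.
    + rewrite E; ring.
Qed.

Lemma size_rot (x : R) : size (rot x) = 2.
Proof.
  rewrite sizeE. pose proof (rot_su11 x) as H. unfold su11 in H.
  unfold rot in *; cbn [fst snd RtoC] in *. lra.
Qed.

(* All geodesics through x have 0 in their pattern. A common period v would put at
   k(v), for each of these geodesics k, the foot of one of finitely many orbit points; but a
   given point y has its foot at distance |v| from x on at most two geodesics through x. *)
Lemma no_common_period (Gam : C * C -> Prop) (h : C * C) (rho v : R) :
  fuchsian Gam -> su11 h -> 0 < rho -> v <> 0 ->
  (forall g, su11 g -> forall s, pattern Gam h rho g s -> pattern Gam h rho g (s + v)) -> False.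
Proof.
  intros HG Hh Hrho Hv Hper.
  pose proof (sinh_pos rho Hrho) as Hsg.
  set (g := fun n : nat => h ** rot (INR n)).
  assert (Sg : forall n, su11 (g n)) by (intros; apply su11_closed_mul; auto using rot_su11).
  assert (Zero : forall n, pattern Gam h rho (g n) 0).
  { intros n. exists su11_one; split; [now apply fuchsian_one|].
    unfold g. rewrite su11_mul_1_l, su11_inv_mul, <- su11_mul_assoc, su11_inv_l by auto.
    destruct (fW_rot (INR n) su11_one) as [E1 [E2 E3]].
    destruct fUVW_one as [U1 [V1 W1]]. rewrite U1, V1, W1 in E1, E2. unfold size in E3.
    rewrite U1, V1 in E3.
    rewrite E1. split; [split; lra|]. rewrite Rmult_0_r, exp_0. lra. }
  assert (Hc : forall n, exists c, Gam c /\
    - sinh rho < fW (su11_inv (g n) ** (c ** h)) <= sinh rho /\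
    fU (su11_inv (g n) ** (c ** h)) = exp (2 * v) * fV (su11_inv (g n) ** (c ** h))).
  { intros n. pose proof (Hper (g n) (Sg n) 0 (Zero n)) as K.
    rewrite Rplus_0_l in K. exact K. }
  apply choice in Hc. destruct Hc as [c Hc].
  assert (Sm : forall n, su11 (su11_inv (g n) ** (c n ** h))).
  { intros n; repeat apply su11_closed_mul; auto using su11_closed_inv.
    apply (fuchsian_su11 Gam); auto; apply Hc. }
  destruct (fuchsian_finite Gam
    (size h * 2 * (2 * (cosh rho * cosh (Rabs v + 1)) * size h)) HG) as [l Hl].
  (* The side of the geodesic on which the point lies is recorded too, because the foot leaves two
     mirror positions. *)
  set (b := fun n => if Rle_dec 0 (fW (su11_inv (g n) ** (c n ** h))) then true else false).
  destruct (pigeonhole (fun n => (c n, b n)) (list_prod l (true :: false :: nil)))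
    as [i [j [Hij E]]].
  { intros n. apply in_prod; [|destruct (b n); simpl; auto].
    destruct (Hc n) as [Gc [Wc Fc]]. apply Hl; auto.
    eapply Rle_trans; [apply (size_conj (g n) (c n) h (Sg n) Hh)|].
    apply Rmult_le_compat; try apply size_pos.
    - apply Rmult_le_pos; apply size_pos.
    - unfold g. eapply Rle_trans; [apply size_mul|]. rewrite size_rot; lra.
    - apply Rmult_le_compat_r; [apply size_pos|].
      apply (size_foot _ v); auto. apply Rabs_lt_between. lra. }
  injection E as Ec Eb.
  destruct (Hc i) as [_ [_ Fi]]. destruct (Hc j) as [_ [_ Fj]].
  pose proof (fUV _ (Sm i)) as UVi. pose proof (fUV _ (Sm j)) as UVj.
  pose proof (fV_pos _ (Sm i)) as Vi. pose proof (fV_pos _ (Sm j)) as Vj.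
  unfold b in Eb. rewrite <- Ec in *.
  assert (Em : forall n, su11_inv (g n) ** (c i ** h) =
    su11_inv (rot (INR n)) ** (su11_inv h ** (c i ** h))).
  { intros n; unfold g. now rewrite su11_inv_mul, <- su11_mul_assoc. }
  rewrite !Em in *. set (m := su11_inv h ** (c i ** h)) in *.
  destruct (fW_rot (INR i) m) as [Wi [Di Zi]]. destruct (fW_rot (INR j) m) as [Wj [Dj Zj]].
  unfold size in Zi, Zj.
  set (mi := su11_inv (rot (INR i)) ** m) in *. set (mj := su11_inv (rot (INR j)) ** m) in *.
  set (W := fW m) in *. set (H := fU m - fV m) in *.
  pose proof (exp_pos (2 * v)) as Pv.
  (* U + V is invariant under rotation and U = exp(2v) V in both frames, so U and V agree; W then
     agrees up to sign, which [b] fixes. *)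
  assert (EV : fV mi = fV mj).
  { apply (Rmult_eq_reg_l (1 + exp (2 * v))); lra. }
  assert (EU : fU mi = fU mj) by (rewrite Fi, Fj, EV; auto).
  assert (EW : fW mi = fW mj).
  { rewrite EU, EV, UVj in UVi. destruct (Rle_dec 0 (fW mi)), (Rle_dec 0 (fW mj)); try easy; nra. }
  assert (ND : fU mi - fV mi <> 0).
  { rewrite Fi. intros Q. assert (Q' : exp (2 * v) = exp 0) by (rewrite exp_0; nra).
    apply exp_inv in Q'. lra. }
  rewrite <- EU, <- EV in Dj. rewrite <- EW in Wj.
  assert (R4 : forall x, (x / sqrt (x ^ 2 + 1)) ^ 2 - (/ sqrt (x ^ 2 + 1)) ^ 2 =
    1 - 2 / (x ^ 2 + 1)).
  { intros x. destruct (rot_sqrt x) as [H1 H2]. set (s := sqrt (x ^ 2 + 1)) in *.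
    transitivity ((x ^ 2 - 1) / s ^ 2); [field; lra|]. rewrite H2. field. nra. }
  rewrite R4 in Wi, Wj, Di, Dj.
  set (Ci := 1 - 2 / (INR i ^ 2 + 1)) in *. set (Cj := 1 - 2 / (INR j ^ 2 + 1)) in *.
  set (Ti := INR i / sqrt (INR i ^ 2 + 1) * / sqrt (INR i ^ 2 + 1)) in *.
  set (Tj := INR j / sqrt (INR j ^ 2 + 1) * / sqrt (INR j ^ 2 + 1)) in *.
  (* The point has (X1,X2) <> 0 because its foot v is not 0. Two rotations that agree on a nonzero
     vector have the same angle, so i = j. *)
  assert (HW : 0 < H ^ 2 + 4 * W ^ 2).
  { destruct (Req_dec H 0) as [H0|H0]; [destruct (Req_dec W 0) as [W0|W0]|]; nra. }
  assert (CC : (Ci - Cj) ^ 2 * (H ^ 2 + 4 * W ^ 2) = 0).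
  { assert (A : (Ci - Cj) * W - (Ti - Tj) * H = 0) by lra.
    assert (B : (Ci - Cj) * H + 4 * (Ti - Tj) * W = 0) by lra.
    transitivity ((Ci - Cj) * (H * ((Ci - Cj) * H + 4 * (Ti - Tj) * W)
      + 4 * W * ((Ci - Cj) * W - (Ti - Tj) * H))); [ring|]. rewrite A, B; ring. }
  assert (EC : Ci = Cj) by (apply Rmult_integral in CC; destruct CC; nra).
  assert (ES : INR i ^ 2 + 1 = INR j ^ 2 + 1).
  { apply Rinv_eq_reg. unfold Ci, Cj, Rdiv in EC. lra. }
  apply Hij, INR_eq. pose proof (pos_INR i). pose proof (pos_INR j). nra.
Qed.

(** * Chaos *)

Lemma pattern_limit (Gam : C * C -> Prop) (gl h g : C * C) (rho : R) :
  fuchsian Gam -> su11 gl -> dense_in_ST Gam (geod gl) -> su11 h -> 0 < rho -> su11 g ->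
  limit_of_translates (pattern Gam h rho gl) (pattern Gam h rho g).
Proof.
  intros HG Hgl Hd Hh Hrho Hg r Hr.
  destruct (pattern_stable Gam h g rho r HG Hh Hg Hrho Hr) as [g1 [Hg1 HN]].
  destruct (dense_frames Gam gl g1 _ HG Hgl Hd Hg1 HN) as [c [t [Hc K]]].
  exists t. rewrite <- pattern_flow, <- (pattern_Gam Gam h (gl ** flow t) c rho HG Hc).
  apply K. repeat apply su11_closed_mul; auto using flow_su11.
  now apply (fuchsian_su11 Gam).
Qed.

Lemma limit_in_closure (eps delta : R) (S T : R -> Prop) :
  delone_ed eps delta S -> delone_ed eps delta T -> limit_of_translates S T ->
  del_closure eps delta (orbit S) T.
Proof.
  intros HS HT Hlim; split; auto. intros U [_ HU] UT.
  destruct (HU T UT) as [r [Hr HN]]. destruct (Hlim r Hr) as [v Hv].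
  exists (translate S v); split; [exists v; intros; tauto|].
  apply HN; auto. now apply delone_ed_translate.
Qed.

Lemma pattern_chaotic (Gam : C * C -> Prop) (gl h : C * C) (rho eps delta : R) :
  fuchsian Gam -> su11 gl -> dense_in_ST Gam (geod gl) -> su11 h -> 0 < rho ->
  0 < eps -> 0 < delta -> delone_ed eps delta (pattern Gam h rho gl) ->
  chaotic eps delta (pattern Gam h rho gl).
Proof.
  intros HG Hgl Hd Hh Hrho He Hdl HS.
  assert (Hlim : forall g, su11 g ->
    limit_of_translates (pattern Gam h rho gl) (pattern Gam h rho g)).
  { intros; now apply pattern_limit. }
  (* All patterns inherit the constants of S(l), so the hull and the periodic patterns lie in one
     space of Delone sets. *)
  assert (Hdel : forall g, su11 g -> delone_ed eps delta (pattern Gam h rho g)).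
  { intros g Hg; apply (delone_ed_limit eps delta (pattern Gam h rho gl)); auto. }
  split.
  (* An open set around T already contains a translate of S(l), which is the pattern of a frame;
     approximating patterns of frames is enough, and the other elements of the hull need no
     description. *)
  - intros T [HT Hcl]; split; auto. intros U HU UT.
    destruct (Hcl U HU UT) as [T' [HT' UT']].
    apply orbit_eq in HT'; destruct HT' as [v ->].
    rewrite <- pattern_flow in UT'.
    assert (Hg : su11 (gl ** flow v)) by (apply su11_closed_mul; auto using flow_su11).
    destruct (proj2 HU _ UT') as [r [Hr HN]].
    destruct (pattern_stable Gam h _ rho r HG Hh Hg Hrho Hr) as [g1 [Hg1 Hnb]].
    destruct (periodic_frames_dense Gam gl g1 _ HG Hgl Hd Hg1 Hnb)
      as [g' [c [p [Hg' [HNr [Hc [Hp Ep]]]]]]].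
    exists (pattern Gam h rho g'). split; [split|].
    + apply limit_in_closure; auto.
    + apply (periodic_of_period eps delta p); auto. intros t.
      change (pattern Gam h rho g' (t + p)) with (translate (pattern Gam h rho g') p t).
      rewrite <- pattern_flow, <- Ep, pattern_Gam; auto. tauto.
    + apply HN; auto.
  - intros v Hv Hper. apply (no_common_period Gam h rho v HG Hh Hrho Hv).
    intros g Hg. apply (period_limit eps delta v (pattern Gam h rho gl)); auto.
Qed.

Theorem theorem3p5 (Gam : C * C -> Prop) (tau : C -> Prop) (l : R -> C)
  (x : C) (rho : R) :
  fuchsian Gam -> cocompact Gam ->
  hyp_polygon tau -> fundamental_domain Gam tau ->
  no_selfinverse_sidepairing Gam tau ->
  geodesic l -> dense_in_ST Gam l ->
  hinterior tau x -> 0 < rho ->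
  ( ( (forall k, geodesic k -> exists t g, Gam g /\ hdist (k t) (mob g x) < rho) ->
      Rbar_lt (Finite rho) (inj Gam x) ->
      delone (Splus Gam l rho x) )
  /\
    ( delone (Splus Gam l rho x) ->
      exists eps delta, 0 < eps /\ 0 < delta /\
        delone_ed eps delta (Splus Gam l rho x) /\
        chaotic eps delta (Splus Gam l rho x) ) ).
Proof.
  intros HG _ Hpoly Hfd _ Hl Hdense [e [He Hint]] Hrho.
  assert (Hx : inD x).
  { assert (Hxt : tau x).
    { apply Hint. replace (Cminus x x) with (RtoC 0) by ring. rewrite Cmod_0; auto. }
    destruct Hpoly as [L [_ [Htau _]]]. now apply Htau in Hxt. }
  destruct (frame_at x Hx) as [h [Hh <-]].
  destruct (geodesic_frame l Hl) as [gl [Hgl ->]].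
  assert (HSu : forall c, Gam c -> su11 c) by (intros; now apply (fuchsian_su11 Gam)).
  rewrite Splus_geod by auto.
  split.
  - intros Hhit Hinj.
    destruct (uniform_hit Gam tau h rho HG Hpoly Hfd Hh Hrho Hhit) as [L HL].
    destruct (pattern_separated Gam h gl rho HG Hh Hgl Hrho Hinj) as [delta [Hd Hsep]].
    assert (HL0 : 0 <= L).
    { destruct (HL gl Hgl) as [t [_ [Ht _]]]. pose proof (Rabs_pos t); lra. }
    exists (L + rho), delta. repeat split; auto; [lra|].
    apply pattern_relatively_dense; auto.
  - intros [eps [delta [Heps [Hdelta HS]]]].
    exists eps, delta. split; [auto|split; [auto|split; [auto|]]].
    now apply pattern_chaotic.
Qed.
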